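(* Let $\mathtt{expRK5s8}$ be the explicit exponential Runge--Kutta method with $s=8$ stages whose nodes are $$c_2=c_3=c_5=\tfrac12,\quad c_4=\tfrac14,\quad c_6=\tfrac15,\quad c_7=\tfrac23,\quad c_8=1,$$ and whose coefficients are, with $\varphi_{k,i}=\varphi_k(c_iz)$, $\varphi_k=\varphi_k(z)$, $$a_{32}=\tfrac12\varphi_{2,3},\quad a_{42}=0,\quad a_{43}=\tfrac18\varphi_{2,4},\quad a_{52}=0,\quad a_{53}=-\tfrac12\varphi_{2,5}+2\varphi_{3,5},\quad a_{54}=2\varphi_{2,5}-4\varphi_{3,5},$$ $$a_{62}=a_{63}=0,\quad a_{64}=\tfrac{8}{25}\varphi_{2,6}-\tfrac{32}{125}\varphi_{3,6},\quad a_{65}=\tfrac{2}{25}\varphi_{2,6}-\tfrac12a_{64},$$ $$a_{72}=a_{73}=0,\quad a_{74}=-\tfrac{125}{162}a_{64},\quad a_{75}=\tfrac{125}{1944}a_{64}-\tfrac{16}{27}\varphi_{2,7}+\tfrac{320}{81}\varphi_{3,7},\quad a_{76}=\tfrac{3125}{3888}a_{64}+\tfrac{100}{27}\varphi_{2,7}-\tfrac{800}{81}\varphi_{3,7},$$ $$a_{82}=a_{83}=a_{84}=0,\quad a_{85}=\tfrac{208}{3}\varphi_{3,8}-\tfrac{16}{3}\varphi_{2,8}-40\phi,$$ $$a_{86}=-\tfrac{250}{3}\varphi_{3,8}+\tfrac{250}{21}\varphi_{2,8}+\tfrac{250}{7}\phi,\quad a_{87}=-27\varphi_{3,8}+\tfrac{27}{14}\varphi_{2,8}+\tfrac{135}{7}\phi,$$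 where $$\phi=\tfrac{5}{32}a_{64}-\tfrac{1}{28}\varphi_{2,6}+\tfrac{36}{175}\varphi_{2,7}-\tfrac{48}{25}\varphi_{3,7}+\tfrac{6}{175}\varphi_{4,6}+\tfrac{192}{35}\varphi_{4,7}+6\varphi_{4,8},$$ and $b_2=b_3=b_4=b_5=0$, $$b_6=\tfrac{125}{14}\varphi_2-\tfrac{625}{14}\varphi_3+\tfrac{1125}{14}\varphi_4,\quad b_7=-\tfrac{27}{14}\varphi_2+\tfrac{162}{7}\varphi_3-\tfrac{405}{7}\varphi_4,\quad b_8=\tfrac12\varphi_2-\tfrac{13}{2}\varphi_3+\tfrac{45}{2}\varphi_4.$$ Then $\mathtt{expRK5s8}$ is a method of order 5: it satisfies the order conditions 1--7 of the context, condition 8 for $Z=0$, and conditions 9--16 with $b_i(Z)$ replaced by $b_i(0)$. Consequently it converges with order 5 for semilinear parabolic problems: if $X$ is a Banach space, $A$ generates an analytic semigroup on $X$, the problem $u'(t)=Au(t)+g(u(t))$, $u(t_0)=u_0$, possesses a sufficiently smooth solution $u:[t_0,T]\to X$ with derivatives in $X$, and $g:X\to X$ is sufficiently often Fréchet differentiable in a strip along the exact solution, with all occurring derivatives uniformly bounded, then the numerical solution $u_n$ obtained with constant step size $h$ satisfies $\|u_n-u(t_n)\|\le Ch^5$ uniformly for $t_0\le t_n=t_0+nh\le T$, with a constant $C$ that depends on $T-t_0$ but is independent of $n$ and $h$.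
   Context: The functions $\varphi_k$ are the entire functions $\varphi_0(z)=\mathrm{e}^z$, $\varphi_k(z)=\int_0^1 \mathrm{e}^{(1-\theta)z}\frac{\theta^{k-1}}{(k-1)!}\,\mathrm{d}\theta$ for $k\ge1$. An $s$-stage explicit exponential Runge--Kutta method for $u'=F(u)=Au+g(u)$, $u(t_0)=u_0$, with nodes $c_i$ and coefficient functions $a_{ij}(z)$ ($2\le j<i\le s$), $b_i(z)$ ($2\le i\le s$) reads, with constant step size $h>0$, $$U_{ni}=u_n+c_ih\varphi_1(c_ihA)F(u_n)+h\sum_{j=2}^{i-1}a_{ij}(hA)D_{nj},\quad 2\le i\le s,$$ $$u_{n+1}=u_n+h\varphi_1(hA)F(u_n)+h\sum_{i=2}^s b_i(hA)D_{ni},\qquad D_{ni}=g(U_{ni})-g(u_n).$$ Here $\varphi_k(chA)=\int_0^1 \mathrm{e}^{(1-\theta)chA}\frac{\theta^{k-1}}{(k-1)!}\,\mathrm{d}\theta$ (a bounded operator for $c\ge0$), and $u_n+ch\varphi_1(chA)F(u_n)$ equals $\mathrm{e}^{chA}u_n+ch\varphi_1(chA)g(u_n)$. Define $\psi_{j,i}(Z)=\sum_{k=2}^{i-1}a_{ik}(Z)\frac{c_k^{j-1}}{(j-1)!}-c_i^j\varphi_j(c_iZ)$. Order conditions. Below, $Z,J,K,L$ denote arbitrary square matrices of the same format and $B$ an arbitrary bilinear mapping of appropriate dimensions; each condition is required for all of these. $B(M,M)$ denotes the bilinear map $(x,y)\mapsto B(Mx,My)$. All outer sums run over $i=2,\dots,s$.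 1: $\sum b_i(Z)c_i=\varphi_2(Z)$. 2: $\sum b_i(Z)\frac{c_i^2}{2!}=\varphi_3(Z)$. 3: $\sum b_i(Z)J\psi_{2,i}(Z)=0$. 4: $\sum b_i(Z)\frac{c_i^3}{3!}=\varphi_4(Z)$. 5: $\sum b_i(Z)J\psi_{3,i}(Z)=0$. 6: $\sum b_i(Z)J\sum_{j=2}^{i-1}a_{ij}(Z)J\psi_{2,j}(Z)=0$. 7: $\sum b_i(Z)c_iK\psi_{2,i}(Z)=0$. 8: $\sum b_i(Z)\frac{c_i^4}{4!}=\varphi_5(Z)$. 9: $\sum b_i(Z)J\psi_{4,i}(Z)=0$. 10: $\sum b_i(Z)J\sum_{j=2}^{i-1}a_{ij}(Z)J\psi_{3,j}(Z)=0$. 11: $\sum b_i(Z)J\sum_{j=2}^{i-1}a_{ij}(Z)J\sum_{k=2}^{j-1}a_{jk}(Z)J\psi_{2,k}(Z)=0$. 12: $\sum b_i(Z)J\sum_{j=2}^{i-1}a_{ij}(Z)c_jK\psi_{2,j}(Z)=0$. 13: $\sum b_i(Z)c_iK\psi_{3,i}(Z)=0$. 14: $\sum b_i(Z)c_iK\sum_{j=2}^{i-1}a_{ij}(Z)J\psi_{2,j}(Z)=0$. 15: $\sum b_i(Z)B(\psi_{2,i}(Z),\psi_{2,i}(Z))=0$. 16: $\sum b_i(Z)c_i^2L\psi_{2,i}(Z)=0$.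
   Formalization: The error bound is stated for step sizes h up to some h0 > 0 (independent of n), and for larger h whenever u_n still lies in the strip; since g is unrestricted outside the strip, no constant C can serve all large h. *)

(* Defs.v *)
From Stdlib Require Import Reals List Factorial.
From Coquelicot Require Import Coquelicot.
Import ListNotations.
Open Scope R_scope.

(** * The functions [phi_k] and linear combinations of them *)

(* If [E t] stands for e^{tz}, then [phi E k c] is phi_k(cz). It is used with
   [E t] an entry of the matrix e^{tZ}, and with [E t = e^{thA} v]. *)
Definition phi {V : CompleteNormedModule R_AbsRing} (E : R -> V)
    (k : nat) (c : R) : V :=
  match k with
  | O => E c
  | S k' =>
      RInt (fun th => scal (th ^ k' / INR (fact k')) (E ((1 - th) * c))) 0 1
  end.

(* Real linear combinations of the functions z |-> phi_k(cz). They are kept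
   symbolic so that one expression can be evaluated at matrices and at
   (unbounded) operators. *)
Inductive cfun : Type :=
  | Phi (k : nat) (c : R)
  | Zero
  | Add (f g : cfun)
  | Sub (f g : cfun)
  | Scale (r : R) (f : cfun).

Declare Scope cfun_scope.
Delimit Scope cfun_scope with cf.
Bind Scope cfun_scope with cfun.
Infix "+" := Add : cfun_scope.
Infix "-" := Sub : cfun_scope.
Notation "r '*:' f" := (Scale r%R f) (at level 40, f at level 39) : cfun_scope.

Fixpoint eval {V : ModuleSpace R_Ring} (P : nat -> R -> V) (f : cfun) : V :=
  match f with
  | Phi k c => P k c
  | Zero => zero
  | Add f g => plus (eval P f) (eval P g)
  | Sub f g => minus (eval P f) (eval P g)
  | Scale r f => scal r (eval P f)
  end.

(* [csum F i] is the sum of [F k] over 2 <= k <= i-1. *)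
Definition csum (F : nat -> cfun) (i : nat) : cfun :=
  fold_right Add Zero (map F (seq 2 (i - 2))).

(** * Explicit exponential Runge-Kutta methods *)

(* Only [node i] and [bcoef i] with 2 <= i <= stages, and [acoef i j] with
   2 <= j < i <= stages, are meaningful. *)
Record expRK := {
  stages : nat;
  node : nat -> R;
  acoef : nat -> nat -> cfun;
  bcoef : nat -> cfun }.

Definition psi (m : expRK) (j i : nat) : cfun :=
  (csum (fun k => (node m k ^ (j - 1) / INR (fact (j - 1))) *: acoef m i k) i
   - (node m i ^ j) *: Phi j (node m i))%cf.

(** ** The method expRK5s8 *)

Definition node58 (i : nat) : R :=
  match i with
  | 2%nat | 3%nat | 5%nat => 1 / 2
  | 4%nat => 1 / 4
  | 6%nat => 1 / 5
  | 7%nat => 2 / 3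
  | 8%nat => 1
  | _ => 0
  end.

(* phi_{k,i} = phi_k(c_i z) and phi_k = phi_k(z) *)
Notation "'φ_{' k ',' i '}'" := (Phi k%nat (node58 i%nat)) : cfun_scope.
Notation "'φ_{' k '}'" := (Phi k%nat 1%R) : cfun_scope.

Definition a64 : cfun := ((8/25) *: φ_{2,6} - (32/125) *: φ_{3,6})%cf.

Definition phi58 : cfun :=
  ((5/32) *: a64 - (1/28) *: φ_{2,6} + (36/175) *: φ_{2,7}
   - (48/25) *: φ_{3,7} + (6/175) *: φ_{4,6} + (192/35) *: φ_{4,7}
   + 6 *: φ_{4,8})%cf.

Definition acoef58 (i j : nat) : cfun :=
  match i, j with
  | 3%nat, 2%nat => (1/2) *: φ_{2,3}
  | 4%nat, 3%nat => (1/8) *: φ_{2,4}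
  | 5%nat, 3%nat => (-(1/2)) *: φ_{2,5} + 2 *: φ_{3,5}
  | 5%nat, 4%nat => 2 *: φ_{2,5} - 4 *: φ_{3,5}
  | 6%nat, 4%nat => a64
  | 6%nat, 5%nat => (2/25) *: φ_{2,6} - (1/2) *: a64
  | 7%nat, 4%nat => (-(125/162)) *: a64
  | 7%nat, 5%nat =>
      (125/1944) *: a64 - (16/27) *: φ_{2,7} + (320/81) *: φ_{3,7}
  | 7%nat, 6%nat =>
      (3125/3888) *: a64 + (100/27) *: φ_{2,7} - (800/81) *: φ_{3,7}
  | 8%nat, 5%nat =>
      (208/3) *: φ_{3,8} - (16/3) *: φ_{2,8} - 40 *: phi58
  | 8%nat, 6%nat =>
      (-(250/3)) *: φ_{3,8} + (250/21) *: φ_{2,8} + (250/7) *: phi58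
  | 8%nat, 7%nat =>
      (-27) *: φ_{3,8} + (27/14) *: φ_{2,8} + (135/7) *: phi58
  | _, _ => Zero
  end%cf.

Definition bcoef58 (i : nat) : cfun :=
  match i with
  | 6%nat => (125/14) *: φ_{2} - (625/14) *: φ_{3} + (1125/14) *: φ_{4}
  | 7%nat => (-(27/14)) *: φ_{2} + (162/7) *: φ_{3} - (405/7) *: φ_{4}
  | 8%nat => (1/2) *: φ_{2} - (13/2) *: φ_{3} + (45/2) *: φ_{4}
  | _ => Zero
  end%cf.

Definition expRK5s8 : expRK :=
  {| stages := 8; node := node58; acoef := acoef58; bcoef := bcoef58 |}.

(** * Order conditions *)

(* Complex square matrices; real ones are a special case. *)
Definition sqmx (n : nat) : Ring := @matrix_Ring C_Ring n.
Definition cvec (n : nat) : Type := @matrix C n 1.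

Definition mx_entry {n : nat} (Z : sqmx n) (p q : nat) : C :=
  coeff_mat (m := n) (n := n) (RtoC 0) Z p q.

(* The entry (p, q) of e^{tZ}, by the exponential series. *)
Definition exp_entry {n : nat} (Z : sqmx n) (p q : nat) (t : R) : C :=
  (Series (fun l => t ^ l / INR (fact l) * Re (mx_entry (pow_n Z l) p q)),
   Series (fun l => t ^ l / INR (fact l) * Im (mx_entry (pow_n Z l) p q))).

(* f(Z), computed entrywise *)
Definition at_mx (f : cfun) {n : nat} (Z : sqmx n) : sqmx n :=
  mk_matrix n n (fun p q =>
    eval (V := C_R_ModuleSpace)
      (phi (V := C_R_CompleteNormedModule) (exp_entry Z p q)) f).

Definition mx_act {n : nat} (M : sqmx n) (x : cvec n) : cvec n :=
  Mmult (T := C_Ring) M x.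

Definition vec_plus {n : nat} (x y : cvec n) : cvec n :=
  Mplus (G := C_AbelianGroup) x y.

Definition vec_scal {n : nat} (r : C) (x : cvec n) : cvec n :=
  mk_matrix n 1 (fun p q => Cmult r (coeff_mat (RtoC 0) x p q)).

Definition bilinear_map {n : nat} (B : cvec n -> cvec n -> cvec n) : Prop :=
  (forall x y z, B (vec_plus x y) z = vec_plus (B x z) (B y z)) /\
  (forall x y z, B x (vec_plus y z) = vec_plus (B x y) (B x z)) /\
  (forall r x y, B (vec_scal r x) y = vec_scal r (B x y)) /\
  (forall r x y, B x (vec_scal r y) = vec_scal r (B x y)).

Section OrderConditions.

Variable m : expRK.
Let s := stages m.
Let c := node m.
Let a := acoef m.
Let b := bcoef m.

(* sum_{i=2}^s b_i(Z) c_i^(k-1)/(k-1)! = phi_k(Z):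
   conditions 1, 2, 4, 8 for k = 2, 3, 4, 5 *)
Definition quadrature_cond (k : nat) {n : nat} (Z : sqmx n) : Prop :=
  sum_n_m (fun i => at_mx ((c i ^ (k - 1) / INR (fact (k - 1))) *: b i) Z) 2 s
  = at_mx (Phi k 1) Z.

(* In the remaining conditions the weights b_i are evaluated at [W]; the
   condition itself is the case W = Z, its weakened form the case W = 0. *)
Section Weighted.

Context {n : nat} (W Z : sqmx n).

Definition cond3 (J : sqmx n) : Prop :=
  sum_n_m (fun i => mult (at_mx (b i) W) (mult J (at_mx (psi m 2 i) Z))) 2 s
  = zero.

Definition cond5 (J : sqmx n) : Prop :=
  sum_n_m (fun i => mult (at_mx (b i) W) (mult J (at_mx (psi m 3 i) Z))) 2 s
  = zero.

Definition cond6 (J : sqmx n) : Prop :=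
  sum_n_m (fun i => mult (at_mx (b i) W) (mult J
    (sum_n_m (fun j =>
       mult (at_mx (a i j) Z) (mult J (at_mx (psi m 2 j) Z))) 2 (i - 1)))) 2 s
  = zero.

Definition cond7 (K : sqmx n) : Prop :=
  sum_n_m (fun i =>
    mult (at_mx (c i *: b i) W) (mult K (at_mx (psi m 2 i) Z))) 2 s
  = zero.

Definition cond9 (J : sqmx n) : Prop :=
  sum_n_m (fun i => mult (at_mx (b i) W) (mult J (at_mx (psi m 4 i) Z))) 2 s
  = zero.

Definition cond10 (J : sqmx n) : Prop :=
  sum_n_m (fun i => mult (at_mx (b i) W) (mult J
    (sum_n_m (fun j =>
       mult (at_mx (a i j) Z) (mult J (at_mx (psi m 3 j) Z))) 2 (i - 1)))) 2 s
  = zero.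

Definition cond11 (J : sqmx n) : Prop :=
  sum_n_m (fun i => mult (at_mx (b i) W) (mult J
    (sum_n_m (fun j => mult (at_mx (a i j) Z) (mult J
       (sum_n_m (fun k =>
          mult (at_mx (a j k) Z) (mult J (at_mx (psi m 2 k) Z)))
        2 (j - 1)))) 2 (i - 1)))) 2 s
  = zero.

Definition cond12 (J K : sqmx n) : Prop :=
  sum_n_m (fun i => mult (at_mx (b i) W) (mult J
    (sum_n_m (fun j =>
       mult (at_mx (c j *: a i j) Z) (mult K (at_mx (psi m 2 j) Z)))
     2 (i - 1)))) 2 s
  = zero.

Definition cond13 (K : sqmx n) : Prop :=
  sum_n_m (fun i =>
    mult (at_mx (c i *: b i) W) (mult K (at_mx (psi m 3 i) Z))) 2 s
  = zero.

Definition cond14 (J K : sqmx n) : Prop :=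
  sum_n_m (fun i => mult (at_mx (c i *: b i) W) (mult K
    (sum_n_m (fun j =>
       mult (at_mx (a i j) Z) (mult J (at_mx (psi m 2 j) Z))) 2 (i - 1)))) 2 s
  = zero.

(* The equality of bilinear maps is stated pointwise. *)
Definition cond15 (B : cvec n -> cvec n -> cvec n) : Prop :=
  forall x y : cvec n,
  sum_n_m (G := @matrix_AbelianMonoid C_AbelianMonoid n 1) (fun i =>
    mx_act (at_mx (b i) W)
      (B (mx_act (at_mx (psi m 2 i) Z) x) (mx_act (at_mx (psi m 2 i) Z) y))) 2 s
  = zero.

Definition cond16 (L : sqmx n) : Prop :=
  sum_n_m (fun i =>
    mult (at_mx ((c i ^ 2) *: b i) W) (mult L (at_mx (psi m 2 i) Z))) 2 s
  = zero.

End Weighted.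
End OrderConditions.

(** * Semilinear parabolic problems *)

Section Problem.

Context {X : CompleteNormedModule R_AbsRing}.

Definition C0_semigroup (T : R -> X -> X) : Prop :=
  (forall t, 0 <= t -> is_linear (T t)) /\
  (forall x, T 0 x = x) /\
  (forall t r x, 0 <= t -> 0 <= r -> T (t + r) x = T t (T r x)) /\
  (forall x, filterlim (fun t => T t x) (at_right 0) (locally x)).

(* The operator with domain [dom] given by [A] there; the values of [A] outside
   [dom] are irrelevant. *)
Definition generator (T : R -> X -> X) (dom : X -> Prop) (A : X -> X) : Prop :=
  let quotient x t := scal (/ t) (minus (T t x) x) in
  (forall x, dom x <->
     exists y, filterlim (quotient x) (at_right 0) (locally y)) /\
  (forall x, dom x -> filterlim (quotient x) (at_right 0) (locally (A x))).

(* Analyticity of a semigroup on a real Banach space refers to the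
   complexification X + iX, realized on pairs. The Euclidean product norm is
   equivalent to any complexification norm. A complex Banach space is covered
   through its underlying real space: its complexification is the sum of the
   space and its conjugate, on which a semigroup of complex-linear operators is
   analytic iff it is so on the space itself. *)
Definition XC : NormedModule R_AbsRing := prod_NormedModule R_AbsRing X X.

Definition cscal (w : C) (p : XC) : XC :=
  (minus (scal (Re w) (fst p)) (scal (Im w) (snd p)),
   plus (scal (Re w) (snd p)) (scal (Im w) (fst p))).

Definition bounded_Clinear (f : XC -> XC) : Prop :=
  is_linear f /\ forall w p, f (cscal w p) = cscal w (f p).

(* The open sector |arg z| < arctan kappa, without its vertex. *)
Definition sector (kappa : R) (z : C) : Prop :=
  0 < Re z /\ Rabs (Im z) < kappa * Re z.

(* Complex differentiability on the sector, in the operator norm. *)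
Definition holomorphic_family (kappa : R) (S : C -> XC -> XC) : Prop :=
  forall z, sector kappa z ->
  exists S' : XC -> XC, bounded_Clinear S' /\
  forall eps, 0 < eps -> exists delta, 0 < delta /\
  forall w, sector kappa w -> Cmod (w - z) < delta ->
  forall p, norm (minus (minus (S w p) (S z p)) (cscal (w - z) (S' p)))
            <= eps * Cmod (w - z) * norm p.

Definition analytic_semigroup (T : R -> X -> X) : Prop :=
  C0_semigroup T /\
  exists kappa, 0 < kappa /\ exists S : C -> XC -> XC,
    (forall z, sector kappa z -> bounded_Clinear (S z)) /\
    (forall t, 0 < t -> forall p, S (RtoC t) p = (T t (fst p), T t (snd p))) /\
    (forall z w p, sector kappa z -> sector kappa w ->
       S (z + w)%C p = S z (S w p)) /\
    (forall p, filterlim (fun z => S z p)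
       (within (sector kappa) (locally (RtoC 0))) (locally p)) /\
    holomorphic_family kappa S.

(* [T t] is e^{tA}. *)
Definition generates_analytic_semigroup
    (dom : X -> Prop) (A : X -> X) (T : R -> X -> X) : Prop :=
  analytic_semigroup T /\ generator T dom A.

Definition deriv_on (a b : R) (u : R -> X) (t : R) (l : X) : Prop :=
  filterdiff u (within (fun r => a <= r <= b) (locally t)) (fun r => scal r l).

(* N times continuously differentiable on [a, b], one-sidedly at the ends *)
Definition smooth_on (N : nat) (a b : R) (u : R -> X) : Prop :=
  exists du : nat -> R -> X,
    (forall t, a <= t <= b -> du 0%nat t = u t) /\
    (forall k t, (k < N)%nat -> a <= t <= b ->
       deriv_on a b (du k) t (du (S k) t)) /\
    (forall k t, (k <= N)%nat -> a <= t <= b ->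
       filterlim (du k) (within (fun r => a <= r <= b) (locally t))
         (locally (du k t))).

(* The initial value problem u' = Au + g(u), u(t0) = u0 on [t0, T]. *)
Definition is_solution (dom : X -> Prop) (A g : X -> X) (t0 T : R) (u0 : X)
    (u : R -> X) : Prop :=
  u t0 = u0 /\
  forall t, t0 <= t <= T ->
    dom (u t) /\ deriv_on t0 T u t (plus (A (u t)) (g (u t))).

Definition strip (t0 T : R) (u : R -> X) (rho : R) (x : X) : Prop :=
  exists t, t0 <= t <= T /\ norm (minus x (u t)) < rho.

Definition prod_norms (l : list X) : R :=
  fold_right (fun v r => norm v * r) 1 l.

(* g is N times Frechet differentiable on the open set D, with derivatives of
   orders 1 to N uniformly bounded. [dg x l] is the derivative of order
   [length l] at x applied to the vectors in [l]; the last clause is Frechet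
   differentiability of [dg] of order k as a map into the bounded k-linear maps
   with the operator norm. *)
Definition frechet_smooth_bounded (N : nat) (D : X -> Prop) (g : X -> X)
    : Prop :=
  exists (dg : X -> list X -> X) (M : R),
    (forall x, D x -> dg x nil = g x) /\
    (forall x l1 l2 v w r, D x -> (length l1 + S (length l2) <= N)%nat ->
       dg x (l1 ++ plus v (scal r w) :: l2)
       = plus (dg x (l1 ++ v :: l2)) (scal r (dg x (l1 ++ w :: l2)))) /\
    (forall x l, D x -> (1 <= length l <= N)%nat ->
       norm (dg x l) <= M * prod_norms l) /\
    (forall x k, D x -> (k < N)%nat ->
       forall eps, 0 < eps -> exists delta, 0 < delta /\
       forall y, D y -> norm (minus y x) < delta ->
       forall l, length l = k ->
         norm (minus (minus (dg y l) (dg x l)) (dg x (minus y x :: l)))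
         <= eps * norm (minus y x) * prod_norms l).

(* f(hA) v, where [T t] is e^{tA} *)
Definition at_op (f : cfun) (T : R -> X -> X) (h : R) (v : X) : X :=
  eval (phi (fun t => T (t * h) v)) f.

(* [un n] and [U n i] are the approximations u_n and the stages U_{ni}
   computed with step size h. All of them lie in the domain of A, because the
   initial value does and phi_k(chA) maps into the domain for k >= 1, c > 0. *)
Definition numerical_solution (m : expRK) (T : R -> X -> X) (A g : X -> X)
    (u0 : X) (h : R) (un : nat -> X) (U : nat -> nat -> X) : Prop :=
  let c := node m in
  let F x := plus (A x) (g x) in
  let D n j := minus (g (U n j)) (g (un n)) in
  un 0%nat = u0 /\
  forall n : nat,
    (forall i, (2 <= i <= stages m)%nat ->
       U n i =
       plus (plus (un n)
              (scal (c i * h) (at_op (Phi 1 (c i)) T h (F (un n)))))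
            (scal h (sum_n_m (fun j => at_op (acoef m i j) T h (D n j))
                       2 (i - 1)))) /\
    un (S n) =
    plus (plus (un n) (scal h (at_op (Phi 1 1) T h (F (un n)))))
         (scal h (sum_n_m (fun i => at_op (bcoef m i) T h (D n i))
                    2 (stages m))).

End Problem.

(* Main.v *)
Require Import Defs.
From Stdlib Require Import Reals List Arith Lra Lia Factorial ClassicalEpsilon.
From Coquelicot Require Import Coquelicot.
Import ListNotations.
Open Scope R_scope.

(* The order conditions reduce to linear identities between the phi_k(c z) at fixed nodes,
   because psi_2,i (i >= 3) and psi_3,i (i >= 5) vanish; a_74 and phi are chosen so that
   conditions 10 and 9 hold with b_i(0).

   For the convergence, one step maps the error e_n to
     e_(n+1) = T(h) e_n + h^5 sum_F (F(hA) - F(0)) w_F(t_n) + O(h (h^5 + |e_n|)),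
   where F runs over b_6, b_7, b_8 and the defect of condition 8, and each w_F is Lipschitz:
   the conditions which hold only at Z = 0 make the terms with F(0) cancel. Cauchy's
   estimate, with the contour integral replaced by sums over roots of unity, bounds the
   derivative of the semigroup by C/t and its second differences by (h/t)^2. Hence the sums
   of T(jh) (F(hA) - F(0)) over j are bounded uniformly in h; summation by parts and
   Gronwall's inequality give the order 5 without a logarithmic factor. *)

(** * Linear identities in real vector spaces *)

(** Since A is unbounded, F(hA) - F(0) is not O(h) in operator norm. The terms h^5 (F(hA) - F(0))
    w_F are therefore of full size h^5 in each step, and adding their norms over about 1/h steps
    would lose one order. They are instead summed before norms are taken: T(jh) (F(hA) - F(0))
    averages differences T(jh + sh) - T(jh) of the semigroup with 0 <= s <= 1. The bound C/t for the
    derivative controls such a difference by 1/j and would leave a harmonic sum. Each one is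
    therefore compared with s (T(jh + h) - T(jh)): the comparison terms telescope, and the
    deviations are second differences, summable like 1/j^2. Summation by parts requires w_F to vary
    slowly from step to step. For this reason the leading errors of the stages are expressed by
    derivatives of g(u(t)) and by the Jacobian along the exact solution, never by the numerical one.
    They have order h^4 in the stages 6 to 8 and two sources: psi_{4,i}, and the h^3 error of stage
    4, passed on by a_{i4}. *)

Fixpoint evalR (P : nat -> R -> R) (f : cfun) : R :=
  match f with
  | Phi k c => P k c
  | Zero => 0
  | Defs.Add f g => evalR P f + evalR P g
  | Sub f g => evalR P f - evalR P g
  | Scale r f => r * evalR P f
  end.

Fixpoint atoms (f : cfun) : list (nat * R) :=
  match f with
  | Phi k c => [(k, c)]
  | Zero => []
  | Defs.Add f g | Sub f g => atoms f ++ atoms g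
  | Scale _ f => atoms f
  end.

Lemma atom_eq_dec (p q : nat * R) : {p = q} + {p <> q}.
Proof. decide equality; [apply Req_EM_T | apply Nat.eq_dec]. Qed.

Definition indicator (p : nat * R) (k : nat) (c : R) : R :=
  if atom_eq_dec p (k, c) then 1 else 0.

Definition lsum {V : ModuleSpace R_Ring} (F : nat * R -> V) (l : list (nat * R)) : V :=
  fold_right (fun p r => plus (F p) r) zero l.

Lemma minus_plus_plus {G : AbelianGroup} (a b c d : G) :
  minus (plus a b) (plus c d) = plus (minus a c) (minus b d).
Proof.
  unfold minus. rewrite opp_plus, <- !plus_assoc. f_equal.
  rewrite !plus_assoc. f_equal. apply plus_comm.
Qed.

Lemma eval_expansion {V : ModuleSpace R_Ring} (P : nat -> R -> V) (L : list (nat * R)) :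
  NoDup L -> forall f, incl (atoms f) L ->
  eval P f = lsum (fun p => scal (evalR (indicator p) f) (P (fst p) (snd p))) L.
Proof.
  intros ND f. induction f as [k c | | f IHf g IHg | f IHf g IHg | r f IHf]; simpl; intros HL.
  - assert (HI : In (k, c) L) by (apply HL; simpl; auto). clear HL.
    induction ND as [|p L Hp ND IH]; [destruct HI|].
    simpl. unfold indicator at 1. destruct (atom_eq_dec p (k, c)) as [->|E].
    + assert (Hz : forall L', ~ In (k, c) L' ->
        lsum (fun p => scal (indicator p k c) (P (fst p) (snd p))) L' = zero).
      { induction L' as [|q L' IH']; intros Hq; simpl; [reflexivity|].
        unfold indicator at 1. destruct (atom_eq_dec q (k, c)) as [->|].
        - exfalso; apply Hq; simpl; auto.
        - rewrite IH'; [|intros H; apply Hq; simpl; auto].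
          rewrite plus_zero_r. apply (scal_zero_l (K := R_Ring)). }
      rewrite Hz by exact Hp. rewrite plus_zero_r. symmetry. apply (scal_one (K := R_Ring)).
    + destruct HI as [HI|HI]; [contradiction|].
      rewrite <- IH by exact HI.
      rewrite (scal_zero_l (K := R_Ring)), plus_zero_l. reflexivity.
  - clear HL ND. induction L as [|p L IH]; simpl; [reflexivity|].
    rewrite <- IH, (scal_zero_l (K := R_Ring)), plus_zero_r. reflexivity.
  - rewrite IHf, IHg by (intros p Hp; apply HL, in_or_app; auto).
    clear. induction L as [|p L IH]; simpl; [apply plus_zero_l|].
    rewrite <- IH, (scal_distr_r (K := R_Ring)), <- !plus_assoc. f_equal.
    rewrite !plus_assoc. f_equal. apply plus_comm.
  - rewrite IHf, IHg by (intros p Hp; apply HL, in_or_app; auto).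
    clear. induction L as [|p L IH]; simpl; [apply (minus_zero_r (G := V))|].
    rewrite <- IH, (scal_minus_distr_r (K := R_Ring)). apply (minus_plus_plus (G := V)).
  - rewrite IHf by exact HL. clear.
    induction L as [|p L IH]; simpl; [apply (scal_zero_r (K := R_Ring))|].
    rewrite <- IH, (scal_distr_l (K := R_Ring)), <- (scal_assoc (K := R_Ring)). reflexivity.
Qed.

(** An expression is determined by its coefficients on finitely many atoms, and the coefficient of
    an atom is the real value of the expression under the assignment that is 1 at this atom and 0
    elsewhere. So an identity that [field] checks for all real assignments holds in every module,
    for matrices and operators alike. *)
Lemma eval_eq (f g : cfun) :
  (forall P, evalR P f = evalR P g) ->
  forall (V : ModuleSpace R_Ring) (P : nat -> R -> V), eval P f = eval P g.
Proof.
  intros H V P. set (L := nodup atom_eq_dec (atoms f ++ atoms g)).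
  assert (ND : NoDup L) by apply NoDup_nodup.
  rewrite (eval_expansion P L ND f), (eval_expansion P L ND g);
    try (intros p Hp; apply nodup_In, in_or_app; auto).
  clear ND. induction L as [|p L IH]; simpl; [reflexivity|].
  rewrite IH, H. reflexivity.
Qed.

(** * Normed spaces *)

(* The module operations with all canonical structures inferred from a
   NormedModule, so that the terms of different statements agree syntactically. *)
Definition vplus {V : NormedModule R_AbsRing} (x y : V) : V := plus x y.
Definition vminus {V : NormedModule R_AbsRing} (x y : V) : V := minus x y.
Definition vscal {V : NormedModule R_AbsRing} (r : R) (x : V) : V := scal r x.
Definition vzero {V : NormedModule R_AbsRing} : V := zero.

Infix "⊕" := vplus (at level 50, left associativity).
Infix "⊖" := vminus (at level 50, left associativity).
Infix "⊙" := vscal (at level 40, left associativity).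

Ltac env_index x env :=
  match env with
  | x :: _ => constr:(O)
  | _ :: ?l => let n := env_index x l in constr:(S n)
  end.

Ltac env_add x env :=
  match env with
  | _ => let _ := env_index x env in env
  | _ => constr:(x :: env)
  end.

Ltac env_collect t env :=
  match t with
  | plus ?a ?b => let e := env_collect a env in env_collect b e
  | vplus ?a ?b => let e := env_collect a env in env_collect b e
  | vminus ?a ?b => let e := env_collect a env in env_collect b e
  | vscal _ ?a => env_collect a env
  | vzero => env
  | minus ?a ?b => let e := env_collect a env in env_collect b e
  | scal _ ?a => env_collect a env
  | zero => env
  | _ => env_add t env
  end.

(** The vector with index n in the environment becomes the atom [Phi n 0], so that a linear identity
    between vectors is an instance of [eval_eq]; the node 0 is a dummy. *)
Ltac reify_lin t env :=
  match t with
  | plus ?a ?b => let a' := reify_lin a env in let b' := reify_lin b env in constr:(Defs.Add a' b')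
  | vplus ?a ?b => let a' := reify_lin a env in let b' := reify_lin b env in constr:(Defs.Add a' b')
  | vminus ?a ?b => let a' := reify_lin a env in let b' := reify_lin b env in constr:(Sub a' b')
  | vscal ?r ?a => let a' := reify_lin a env in constr:(Scale r a')
  | vzero => constr:(Zero)
  | minus ?a ?b => let a' := reify_lin a env in let b' := reify_lin b env in constr:(Sub a' b')
  | scal ?r ?a => let a' := reify_lin a env in constr:(Scale r a')
  | zero => constr:(Zero)
  | _ => let n := env_index t env in constr:(Phi n 0)
  end.

(* Linear identities over the atoms of both sides are reduced to the reals. *)
Ltac lin_reduce :=
  repeat rewrite <- scal_opp_one;
  repeat match goal with
  | |- context [CompleteNormedModule.sort R_AbsRing ?Y] =>
      change (CompleteNormedModule.sort R_AbsRing Y) with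
        (NormedModule.sort R_AbsRing (CompleteNormedModule.NormedModule R_AbsRing Y))
  end;
  match goal with
  | |- @eq ?T ?x ?y =>
      let e0 := constr:(@nil T) in
      let e1 := env_collect x e0 in
      let env := env_collect y e1 in
      let f := reify_lin x env in
      let g := reify_lin y env in
      refine (eval_eq f g _ _ (fun k _ => nth k env zero));
      let P := fresh "P" in
      intros P; cbn [evalR]; try change (@opp _ (@one _)) with (-1)
  end.

Ltac lin_eq := lin_reduce; ring.
Ltac lin_field := lin_reduce; field.

(** * The order conditions *)

(** For i = 2 the sum is empty and -c_2^2 phi_2(c_2 z) remains. The zero coefficients a_{i2} for i
    >= 4 keep this term out of the conditions. *)
Lemma psi2_zero (i : nat) : (3 <= i <= 8)%nat ->
  forall P, evalR P (psi expRK5s8 2 i) = 0.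
Proof.
  intros Hi P.
  assert (i = 3 \/ i = 4 \/ i = 5 \/ i = 6 \/ i = 7 \/ i = 8)%nat as Hc by lia.
  repeat destruct Hc as [->|Hc]; [..|subst i]; cbn; field.
Qed.

(** Among the stages up to 4, where psi_{3,i} survives, only stage 4 enters the stages 6 to 8
    directly, through a_{64} and a_{74}. *)
Lemma psi3_zero (i : nat) : (5 <= i <= 8)%nat ->
  forall P, evalR P (psi expRK5s8 3 i) = 0.
Proof.
  intros Hi P.
  assert (i = 5 \/ i = 6 \/ i = 7 \/ i = 8)%nat as Hc by lia.
  repeat destruct Hc as [->|Hc]; [..|subst i]; cbn; field.
Qed.

Definition at_zero (f : cfun) : R := evalR (fun k _ => / INR (fact k)) f.

(** This equation determines the function phi of the method. Its coefficients -40, 250/7, 135/7 in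
    a_{85}, a_{86}, a_{87} are annihilated by the moments with c_k and c_k^2, so psi_{2,8} and
    psi_{3,8} do not see phi, whereas psi_{4,8} contains phi/6. *)
Lemma weighted_psi4_zero P :
  at_zero (bcoef58 6) * evalR P (psi expRK5s8 4 6)
  + at_zero (bcoef58 7) * evalR P (psi expRK5s8 4 7)
  + at_zero (bcoef58 8) * evalR P (psi expRK5s8 4 8) = 0.
Proof. unfold at_zero. cbn. field. Qed.

(** b_6(0) = 125/336 and b_7(0) = 27/56, whence the factor -125/162 in a_{74}; since a_{84} = 0, b_8
    contributes nothing. *)
Lemma weighted_a4_zero P :
  at_zero (bcoef58 6) * evalR P (acoef58 6 4)
  + at_zero (bcoef58 7) * evalR P (acoef58 7 4) = 0.
Proof. unfold at_zero. cbn. field. Qed.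

Definition weight_moment (k : nat) : cfun :=
  fold_right (fun i f => Defs.Add ((node58 i ^ k / INR (fact k)) *: bcoef58 i)%cf f)
    Zero (seq 2 7).

Lemma weight_moments (k : nat) : (1 <= k <= 3)%nat -> 
  forall P, evalR P (weight_moment k) = P (S k) 1.
Proof.
  intros Hk P. assert (k = 1 \/ k = 2 \/ k = 3)%nat as Hc by lia.
  repeat destruct Hc as [->|Hc]; [..|subst k]; cbn; field.
Qed.

(** At Z = 0 the weights belong to the interpolatory quadrature with nodes 0, 1/5, 2/3, 1. Its
    degree is 4 and not only 3, because x (x - 1/5) (x - 2/3) (x - 1) has integral zero over
    [0, 1]. *)
Lemma weight_moment4_at_zero : at_zero (weight_moment 4) = / INR (fact 5).
Proof. unfold at_zero. cbn. field. Qed.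

(** * Evaluation at matrices *)

Section Matrices.

Context {n : nat}.
Implicit Types (M N Z W J : sqmx n).

Definition mscal (r : R) M : sqmx n :=
  mk_matrix n n (fun p q => Cmult (RtoC r) (mx_entry M p q)).

Lemma sqmx_ext M N :
  (forall p q, (p < n)%nat -> (q < n)%nat -> mx_entry M p q = mx_entry N p q) ->
  M = N.
Proof.
  intros H. rewrite <- (mk_matrix_bij (RtoC 0) M), <- (mk_matrix_bij (RtoC 0) N).
  apply mk_matrix_ext. exact H.
Qed.

Lemma mx_entry_mk (F : nat -> nat -> C) p q : (p < n)%nat -> (q < n)%nat ->
  mx_entry (mk_matrix n n F : sqmx n) p q = F p q.
Proof. apply coeff_mat_bij. Qed.

Lemma mx_entry_plus M N p q : (p < n)%nat -> (q < n)%nat ->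
  mx_entry (plus M N) p q = plus (mx_entry M p q) (mx_entry N p q).
Proof. apply mx_entry_mk. Qed.

Lemma mx_entry_mult M N p q : (p < n)%nat -> (q < n)%nat ->
  mx_entry (mult M N) p q =
  sum_n (fun l => mult (K := C_Ring) (mx_entry M p l) (mx_entry N l q)) (pred n).
Proof. apply mx_entry_mk. Qed.

Lemma mx_entry_at_mx f Z p q : (p < n)%nat -> (q < n)%nat ->
  mx_entry (at_mx f Z) p q =
  eval (V := C_R_ModuleSpace) (phi (V := C_R_CompleteNormedModule) (exp_entry Z p q)) f.
Proof. apply mx_entry_mk. Qed.

Lemma at_mx_ext f g Z : (forall P, evalR P f = evalR P g) -> at_mx f Z = at_mx g Z.
Proof.
  intros H. apply mk_matrix_ext. intros p q _ _. apply (eval_eq f g H C_R_ModuleSpace).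
Qed.

Lemma at_mx_Zero Z : at_mx Zero Z = zero.
Proof. apply mk_matrix_ext. reflexivity. Qed.

Lemma at_mx_zero f Z : (forall P, evalR P f = 0) -> at_mx f Z = zero.
Proof. intros H. rewrite <- (at_mx_Zero Z). apply at_mx_ext. exact H. Qed.

Lemma at_mx_Add f g Z : at_mx (Defs.Add f g) Z = plus (at_mx f Z) (at_mx g Z).
Proof.
  apply sqmx_ext. intros p q Hp Hq.
  rewrite mx_entry_plus, !mx_entry_at_mx by assumption. reflexivity.
Qed.

Lemma scal_C_R (r : R) (z : C) :
  scal (V := C_R_ModuleSpace) r z = Cmult (RtoC r) z.
Proof.
  destruct z as [x y]. apply injective_projections; cbn; unfold scal; cbn; unfold mult; cbn; ring.
Qed.

Lemma at_mx_Scale r f Z : at_mx (r *: f)%cf Z = mscal r (at_mx f Z).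
Proof.
  apply sqmx_ext. intros p q Hp Hq. unfold mscal.
  rewrite mx_entry_mk, !mx_entry_at_mx by assumption. apply scal_C_R.
Qed.

Lemma mscal_mult_l r M N : mult (mscal r M) N = mscal r (mult M N).
Proof.
  apply sqmx_ext. intros p q Hp Hq. unfold mscal at 2.
  rewrite mx_entry_mk, !mx_entry_mult by assumption.
  rewrite <- (sum_n_mult_l (K := C_Ring)).
  apply sum_n_ext_loc. intros l Hl. unfold mscal.
  rewrite mx_entry_mk by lia. symmetry. apply (mult_assoc (K := C_Ring)).
Qed.

Lemma mscal_mult_r r M N : mult M (mscal r N) = mscal r (mult M N).
Proof.
  apply sqmx_ext. intros p q Hp Hq. unfold mscal at 2.
  rewrite mx_entry_mk, !mx_entry_mult by assumption.
  rewrite <- (sum_n_mult_l (K := C_Ring)).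
  apply sum_n_ext_loc. intros l Hl. unfold mscal.
  rewrite mx_entry_mk by lia.
  unfold mult; cbn. rewrite !Cmult_assoc. f_equal. apply Cmult_comm.
Qed.

Lemma mx_entry_one p q : (p < n)%nat -> (q < n)%nat ->
  mx_entry (one : sqmx n) p q = if Nat.eq_dec p q then RtoC 1 else RtoC 0.
Proof.
  intros Hp Hq. etransitivity; [apply coeff_mat_bij; assumption|].
  clear. revert q. induction p as [|p IH]; intros [|q]; try reflexivity.
  cbn [Mone_seq]. rewrite IH.
  destruct (Nat.eq_dec p q), (Nat.eq_dec (S p) (S q)); congruence || lia.
Qed.

Lemma Series_head (a : nat -> R) : (forall l, a (S l) = 0) -> Series a = a 0%nat.
Proof.
  intros H. apply is_series_unique, is_series_decr_1.
  apply (is_series_ext (fun _ => 0)); [intros; symmetry; apply H|].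
  apply filterlim_ext with (f := fun _ : nat => 0).
  - intros m. rewrite sum_n_const. ring.
  - unfold plus, opp; cbn. rewrite Rplus_opp_r. apply filterlim_const.
Qed.

Lemma exp_entry_zero p q t : (p < n)%nat -> (q < n)%nat ->
  exp_entry (zero : sqmx n) p q t = mx_entry (one : sqmx n) p q.
Proof.
  intros Hp Hq. unfold exp_entry.
  assert (H0 : forall l, mx_entry (pow_n (zero : sqmx n) (S l)) p q = RtoC 0).
  { intros l. change (pow_n (zero : sqmx n) (S l)) with (mult (zero : sqmx n) (pow_n zero l)).
    rewrite mult_zero_l. apply mx_entry_mk; assumption. }
  rewrite !Series_head by (intros l; rewrite H0; cbn; ring).
  rewrite (mx_entry_one p q Hp Hq).
  change (pow_n (zero : sqmx n) 0) with (one : sqmx n). 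
  rewrite (mx_entry_one p q Hp Hq).
  destruct (Nat.eq_dec p q); unfold RtoC; cbn; f_equal; field.
Qed.

Lemma phi_const {V : CompleteNormedModule R_AbsRing} (v : V) k c :
  phi (fun _ => v) k c = scal (/ INR (fact k)) v.
Proof.
  destruct k as [|k]; unfold phi.
  - cbn. rewrite Rinv_1. symmetry. apply (scal_one v).
  - apply is_RInt_unique.
    assert (HF : 0 < INR (fact k)) by apply INR_fact_lt_0.
    assert (HS : 0 < INR (S k)) by (apply lt_0_INR; lia).
    replace (scal (/ INR (fact (S k))) v) with
      (minus (scal (1 ^ S k / INR (fact (S k))) v) (scal (0 ^ S k / INR (fact (S k))) v)).
    2: { rewrite pow1, pow_i by lia. rewrite fact_simpl, mult_INR.
         lin_field. split; lra. }
    apply (is_RInt_derive (fun th => scal (th ^ S k / INR (fact (S k))) v)).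
    + intros x _.
      refine (is_derive_scal_l (fun th => th ^ S k / INR (fact (S k))) x
        (x ^ k / INR (fact k)) v _).
      auto_derive; trivial.
      change (fact k + k * fact k)%nat with (S k * fact k)%nat. rewrite mult_INR.
      change (match k with O => 1 | S _ => INR k + 1 end) with (INR (S k)).
      field. split; lra.
    + intros x _. refine (continuous_scal_l (K := R_AbsRing) (V := V) (fun th : R_UniformSpace => th ^ k / INR (fact k)) v x _).
      apply (ex_derive_continuous (fun th => th ^ k / INR (fact k))). auto_derive; trivial.
Qed.

Lemma phi_ext {V : CompleteNormedModule R_AbsRing} (E E' : R -> V) k c :
  (forall t, E t = E' t) -> phi E k c = phi E' k c.
Proof.
  intros H. destruct k; unfold phi; [apply H|].
  apply RInt_ext. intros x _. f_equal. apply H.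
Qed.

Lemma eval_ext {V : ModuleSpace R_Ring} (P Q : nat -> R -> V) f :
  (forall k c, P k c = Q k c) -> eval P f = eval Q f.
Proof. intros H. induction f; cbn; rewrite ?H, ?IHf1, ?IHf2, ?IHf; reflexivity. Qed.

Lemma eval_coef {V : ModuleSpace R_Ring} (a : nat -> R -> R) (v : V) f :
  eval (fun k c => scal (a k c) v) f = scal (evalR a f) v.
Proof.
  induction f as [k c | | f IHf g IHg | f IHf g IHg | r f IHf]; cbn.
  - reflexivity.
  - symmetry. apply (scal_zero_l (K := R_Ring)).
  - rewrite IHf, IHg. symmetry. apply (scal_distr_r (K := R_Ring)).
  - rewrite IHf, IHg. symmetry. apply (scal_minus_distr_r (K := R_Ring)).
  - rewrite IHf. apply (scal_assoc (K := R_Ring)).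
Qed.

(** A scalar matrix commutes with J, so weights taken at Z = 0 may be moved past J and combined with
    the factors behind it. Conditions 9 and 10 hold for this reason. *)
Lemma at_mx_at_zero f : at_mx f (zero : sqmx n) = mscal (at_zero f) one.
Proof.
  apply mk_matrix_ext. intros p q Hp Hq. rewrite <- scal_C_R.
  unfold at_zero. rewrite <- (eval_coef (V := C_R_ModuleSpace)).
  apply (eval_ext (V := C_R_ModuleSpace)). intros k c.
  rewrite (phi_ext (V := C_R_CompleteNormedModule) _ (fun _ => mx_entry (one : sqmx n) p q)).
  - apply (phi_const (V := C_R_CompleteNormedModule)).
  - intros t. apply exp_entry_zero; assumption.
Qed.

Lemma at_zero_mult f M : mult (at_mx f zero) M = mscal (at_zero f) M.
Proof. rewrite at_mx_at_zero, mscal_mult_l. f_equal. apply mult_one_l. Qed.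

End Matrices.

Lemma sum_n_m_zero_terms {G : AbelianMonoid} (F : nat -> G) a b :
  (forall i, (a <= i <= b)%nat -> F i = zero) -> sum_n_m F a b = zero.
Proof.
  intros H. rewrite (sum_n_m_ext_loc _ (fun _ => zero)) by exact H.
  apply sum_n_m_const_zero.
Qed.

Lemma sum_n_m_tail {G : AbelianMonoid} (F : nat -> G) a b m : 
  (a <= S m)%nat -> (m <= b)%nat ->
  (forall i, (a <= i <= m)%nat -> F i = zero) -> sum_n_m F a b = sum_n_m F (S m) b.
Proof.
  intros Ha Hb H. rewrite (sum_n_m_Chasles F a m b) by assumption.
  rewrite sum_n_m_zero_terms by exact H. apply plus_zero_l.
Qed.

Lemma bcoef58_low i : (i <= 5)%nat -> bcoef expRK5s8 i = Zero.
Proof. intros Hi. do 6 (destruct i as [|i]; [reflexivity|]). lia. Qed.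

Lemma acoef58_low i j : (6 <= i <= 8)%nat -> (j <= 3)%nat -> acoef expRK5s8 i j = Zero.
Proof.
  intros Hi Hj. assert (i = 6 \/ i = 7 \/ i = 8)%nat as Hc by lia.
  repeat destruct Hc as [->|Hc]; [..|subst i];
    do 4 (destruct j as [|j]; [reflexivity|]); lia.
Qed.

(** * The sixteen conditions for the method *)

Section OrderConditions58.

Context {n : nat}.
Implicit Types (M N Z W J K L : sqmx n).

Lemma quadrature58 k Z : (2 <= k <= 4)%nat -> quadrature_cond expRK5s8 k Z.
Proof.
  intros Hk. unfold quadrature_cond. destruct k as [|k]; [lia|].
  rewrite <- (at_mx_ext (weight_moment k) (Phi (S k) 1)) by (apply weight_moments; lia).
  unfold weight_moment. cbn [seq fold_right]. rewrite !at_mx_Add, at_mx_Zero.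
  cbn [stages expRK5s8]. rewrite !sum_Sn_m by lia. rewrite sum_n_m_zero by lia.
  rewrite Nat.sub_1_r. reflexivity.
Qed.

Lemma quadrature58_5_at_zero : quadrature_cond expRK5s8 5 (zero : sqmx n).
Proof.
  unfold quadrature_cond. 
  transitivity (at_mx (weight_moment 4) (zero : sqmx n)).
  - unfold weight_moment. cbn [seq fold_right]. rewrite !at_mx_Add, at_mx_Zero.
    cbn [stages expRK5s8]. rewrite !sum_Sn_m by lia. rewrite sum_n_m_zero by lia.
    reflexivity.
  - rewrite !at_mx_at_zero, weight_moment4_at_zero. reflexivity.
Qed.

Lemma psi2_mx_zero i Z : (3 <= i <= 8)%nat -> at_mx (psi expRK5s8 2 i) Z = zero.
Proof. intros Hi. apply at_mx_zero, psi2_zero, Hi. Qed.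

Lemma psi3_mx_zero i Z : (5 <= i <= 8)%nat -> at_mx (psi expRK5s8 3 i) Z = zero.
Proof. intros Hi. apply at_mx_zero, psi3_zero, Hi. Qed.

(* All weights b_i with i <= 5 vanish, so only the factors of b_6, b_7, b_8 matter. *)
Lemma weighted_sum_zero (r : nat -> R) (G : nat -> sqmx n) W :
  (forall i, (6 <= i <= 8)%nat -> G i = zero) ->
  sum_n_m (fun i => mult (at_mx (r i *: bcoef expRK5s8 i)%cf W) (G i)) 2 8 = zero.
Proof.
  intros HG. apply sum_n_m_zero_terms. intros i Hi.
  destruct (le_lt_dec i 5) as [H5|H5].
  - rewrite bcoef58_low, at_mx_zero by (assumption || (intros; cbn; ring)).
    apply mult_zero_l.
  - rewrite HG by lia. apply mult_zero_r.
Qed.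

Lemma weighted_sum_zero_1 (G : nat -> sqmx n) W :
  (forall i, (6 <= i <= 8)%nat -> G i = zero) ->
  sum_n_m (fun i => mult (at_mx (bcoef expRK5s8 i) W) (G i)) 2 8 = zero.
Proof.
  intros HG. rewrite <- (weighted_sum_zero (fun _ => 1) G W HG).
  apply sum_n_m_ext. intros i. f_equal. apply at_mx_ext. intros P. cbn. ring.
Qed.

Lemma weighted_sum_at_zero (G : nat -> sqmx n) :
  sum_n_m (fun i => mult (at_mx (bcoef expRK5s8 i) zero) (G i)) 2 8 =
  plus (mscal (at_zero (bcoef58 6)) (G 6%nat))
    (plus (mscal (at_zero (bcoef58 7)) (G 7%nat)) (mscal (at_zero (bcoef58 8)) (G 8%nat))).
Proof.
  rewrite (sum_n_m_tail _ 2 8 5) by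
    (lia || (intros i Hi; rewrite bcoef58_low, at_mx_Zero by lia; apply mult_zero_l)).
  rewrite !sum_Sn_m by lia. rewrite sum_n_m_zero by lia. rewrite plus_zero_r.
  rewrite !at_zero_mult. reflexivity.
Qed.

Lemma mult_J_zero J : mult J zero = (zero : sqmx n).
Proof. apply mult_zero_r. Qed.

Lemma inner_psi2_zero (r : nat -> R) i J Z : (6 <= i <= 8)%nat ->
  sum_n_m (fun j => mult (at_mx (r j *: acoef expRK5s8 i j)%cf Z)
    (mult J (at_mx (psi expRK5s8 2 j) Z))) 2 (i - 1) = zero.
Proof.
  intros Hi. apply sum_n_m_zero_terms. intros j Hj.
  destruct (le_lt_dec j 3) as [H3|H3].
  - rewrite acoef58_low, at_mx_zero by (lia || (intros; cbn; ring)). apply mult_zero_l.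
  - rewrite psi2_mx_zero, mult_J_zero by lia. apply mult_zero_r.
Qed.

Lemma inner_psi2_zero_1 i J Z : (6 <= i <= 8)%nat ->
  sum_n_m (fun j => mult (at_mx (acoef expRK5s8 i j) Z)
    (mult J (at_mx (psi expRK5s8 2 j) Z))) 2 (i - 1) = zero.
Proof.
  intros Hi. rewrite <- (inner_psi2_zero (fun _ => 1) i J Z Hi).
  apply sum_n_m_ext. intros j. f_equal. apply at_mx_ext. intros P. cbn. ring.
Qed.

Lemma inner_psi3 i J Z : (6 <= i <= 8)%nat ->
  sum_n_m (fun j => mult (at_mx (acoef expRK5s8 i j) Z)
    (mult J (at_mx (psi expRK5s8 3 j) Z))) 2 (i - 1) =
  mult (at_mx (acoef expRK5s8 i 4) Z) (mult J (at_mx (psi expRK5s8 3 4) Z)).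
Proof.
  intros Hi. rewrite (sum_n_m_tail _ 2 (i - 1) 3) by
    (lia || (intros j Hj; rewrite acoef58_low, at_mx_Zero by lia; apply mult_zero_l)).
  rewrite sum_Sn_m by lia. rewrite sum_n_m_zero_terms; [apply plus_zero_r|].
  intros j Hj. rewrite psi3_mx_zero, mult_J_zero by lia. apply mult_zero_r.
Qed.

(** Apart from the quadrature conditions, only 9 and 10 rest on a cancellation between stages; in
    all others each summand vanishes, either by its weight or by its psi. *)
Lemma order_conditions58 (Z J K L : sqmx n) (B : cvec n -> cvec n -> cvec n) :
  bilinear_map B ->
     quadrature_cond expRK5s8 2 Z /\
     quadrature_cond expRK5s8 3 Z /\
     cond3 expRK5s8 Z Z J /\
     quadrature_cond expRK5s8 4 Z /\
     cond5 expRK5s8 Z Z J /\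
     cond6 expRK5s8 Z Z J /\
     cond7 expRK5s8 Z Z K /\
     quadrature_cond expRK5s8 5 (zero : sqmx n) /\
     cond9 expRK5s8 zero Z J /\
     cond10 expRK5s8 zero Z J /\
     cond11 expRK5s8 zero Z J /\
     cond12 expRK5s8 zero Z J K /\
     cond13 expRK5s8 zero Z K /\
     cond14 expRK5s8 zero Z J K /\
     cond15 expRK5s8 zero Z B /\
     cond16 expRK5s8 zero Z L.
Proof.
  intros HB.
  assert (P2 : forall J i, (6 <= i <= 8)%nat -> mult J (at_mx (psi expRK5s8 2 i) Z) = zero)
    by (intros; rewrite psi2_mx_zero by lia; apply mult_zero_r).
  assert (P3 : forall J i, (6 <= i <= 8)%nat -> mult J (at_mx (psi expRK5s8 3 i) Z) = zero)
    by (intros; rewrite psi3_mx_zero by lia; apply mult_zero_r).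
  repeat match goal with |- _ /\ _ => split end.
  - apply quadrature58; lia.
  - apply quadrature58; lia.
  - apply weighted_sum_zero_1. apply P2.
  - apply quadrature58; lia.
  - apply weighted_sum_zero_1. apply P3.
  - apply weighted_sum_zero_1. intros i Hi. cbv zeta.
    rewrite inner_psi2_zero_1 by exact Hi. apply mult_zero_r.
  - apply weighted_sum_zero. apply P2.
  - apply quadrature58_5_at_zero.
  - unfold cond9. rewrite weighted_sum_at_zero. cbv beta.
    (* The scalars b_i(0) move behind J, and the three psi_{4,i} merge into one expression that is
       identically zero. *)
    repeat rewrite <- (mscal_mult_r (n := n)).
    repeat rewrite <- (at_mx_Scale (n := n)).
    repeat rewrite <- mult_distr_l.
    repeat rewrite <- (at_mx_Add (n := n)).
    rewrite at_mx_zero; [apply mult_zero_r|].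
    intros P. cbn [evalR]. rewrite <- Rplus_assoc. apply weighted_psi4_zero.
  - unfold cond10. rewrite weighted_sum_at_zero. cbv beta.
    rewrite !inner_psi3 by lia.
    (* Only a_{i4} J psi_{3,4} is left of the inner sums. The common factor J psi_{3,4} splits off
       on the right, and the a_{i4} combine between the two factors J. *)
    assert (Hk : forall r M N, mscal r (mult J (mult M N)) = mult J (mult (mscal r M) N))
      by (intros r M N; rewrite mscal_mult_l, mscal_mult_r; reflexivity).
    rewrite !Hk.
    repeat rewrite <- (at_mx_Scale (n := n)).
    repeat rewrite <- mult_distr_l.
    repeat rewrite <- mult_distr_r.
    repeat rewrite <- (at_mx_Add (n := n)).
    rewrite at_mx_zero; [rewrite mult_zero_l; apply mult_zero_r|].
    intros P. cbn [evalR]. rewrite <- Rplus_assoc, weighted_a4_zero. cbn. ring.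
  - apply weighted_sum_zero_1. intros i Hi. cbv zeta.
    rewrite sum_n_m_zero_terms; [apply mult_zero_r|]. intros j Hj.
    destruct (le_lt_dec j 3) as [H3|H3].
    + rewrite acoef58_low, at_mx_Zero by lia. apply mult_zero_l.
    + rewrite sum_n_m_zero_terms; [rewrite mult_zero_r; apply mult_zero_r|].
      (* The nonzero psi_{2,2} is multiplied by a_{j2}, which vanishes since j >= 4 here. *)
      intros k Hk. destruct (le_lt_dec k 2) as [H2|H2].
      * replace k with 2%nat by lia.
        assert (acoef expRK5s8 j 2 = Zero) as ->.
        { do 8 (destruct j as [|j]; [lia || reflexivity|]). lia. }
        rewrite at_mx_Zero. apply mult_zero_l.
      * rewrite psi2_mx_zero, mult_J_zero by lia. apply mult_zero_r.
  - apply weighted_sum_zero_1. intros i Hi. cbv zeta.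
    rewrite inner_psi2_zero by exact Hi. apply mult_zero_r.
  - apply weighted_sum_zero. apply P3.
  - apply weighted_sum_zero. intros i Hi. cbv zeta.
    rewrite inner_psi2_zero_1 by exact Hi. apply mult_zero_r.
  - intros x y. apply sum_n_m_zero_terms. intros i Hi.
    assert (HM0 : forall x : cvec n, mx_act (zero : sqmx n) x = zero).
    { intros v. apply mk_matrix_ext. intros p q Hp Hq.
      transitivity (sum_n (fun _ : nat => (zero : C_Ring)) (pred n)).
      - apply sum_n_ext_loc. intros l Hl.
        unfold zero at 2; cbn; unfold Mzero.
        rewrite coeff_mat_bij by lia. apply (mult_zero_l (K := C_Ring)).
      - unfold sum_n. apply sum_n_m_const_zero. }
    destruct (le_lt_dec i 5) as [H5|H5].
    + cbv zeta. rewrite bcoef58_low, at_mx_Zero by exact H5. apply HM0.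
    + rewrite psi2_mx_zero, !HM0 by (cbn [stages expRK5s8] in Hi; lia).
      destruct HB as (_ & _ & HB & _).
      (* The zero vector is written as 0 times itself, so that homogeneity of B gives B(0, 0) = 0
         B(0, 0). *)
      assert (Hz : vec_scal (RtoC 0) (zero : cvec n) = zero).
      { apply mk_matrix_ext. intros p q Hp Hq. apply Cmult_0_l. }
      rewrite <- Hz at 1. rewrite HB.
      apply mk_matrix_ext. intros p q Hp Hq.
      transitivity (sum_n (fun _ : nat => (zero : C_Ring)) (pred n)).
      * apply sum_n_ext_loc. intros l Hl. unfold vec_scal.
        rewrite coeff_mat_bij by lia. rewrite Cmult_0_l. apply (mult_zero_r (K := C_Ring)).
      * unfold sum_n. apply sum_n_m_const_zero.
  - apply weighted_sum_zero. apply P2.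
Qed.

End OrderConditions58.

(** * Differentiation on intervals and the mean value inequality *)

Section Norms.

Context {V : NormedModule R_AbsRing}.
Implicit Types (x y z : V).

Lemma norm_scal_le (r : R) x : norm (r ⊙ x) <= Rabs r * norm x.
Proof. exact (norm_scal r x). Qed.

Lemma norm_plus_le x y : norm (x ⊕ y) <= norm x + norm y.
Proof. exact (norm_triangle x y). Qed.

Lemma norm_minus_sym x y : norm (x ⊖ y) = norm (y ⊖ x).
Proof. unfold vminus. rewrite <- norm_opp. f_equal. apply (opp_minus x y). Qed.

Lemma norm_vzero : norm (vzero : V) = 0.
Proof. exact norm_zero. Qed.

Lemma norm_minus_self x : norm (x ⊖ x) = 0.
Proof. replace (x ⊖ x) with (vzero : V) by lin_eq. apply norm_vzero. Qed.

Lemma norm_minus_le x y : norm (x ⊖ y) <= norm x + norm y.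
Proof.
  rewrite <- (norm_opp y). exact (norm_triangle x (opp y)).
Qed.

Lemma norm_le_add_minus x y : norm x <= norm y + norm (x ⊖ y).
Proof. replace x with (y ⊕ (x ⊖ y)) at 1 by lin_eq. apply norm_plus_le. Qed.

Lemma norm_minus_triangle x y z : norm (x ⊖ z) <= norm (x ⊖ y) + norm (y ⊖ z).
Proof. replace (x ⊖ z) with ((x ⊖ y) ⊕ (y ⊖ z)) by lin_eq. apply norm_plus_le. Qed.

(** Only points of [a, b] are tested, so at the ends of the interval this is a one-sided
    derivative. *)
Definition diff_in (a b : R) (y : R -> V) (s : R) (l : V) : Prop :=
  forall eps, 0 < eps -> exists delta, 0 < delta /\
  forall r, a <= r <= b -> Rabs (r - s) < delta ->
  norm (vminus (vminus (y r) (y s)) (vscal (r - s) l)) <= eps * Rabs (r - s).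

Definition cont_in (a b : R) (y : R -> V) (s : R) : Prop :=
  forall eps, 0 < eps -> exists delta, 0 < delta /\
  forall r, a <= r <= b -> Rabs (r - s) < delta -> norm (vminus (y r) (y s)) <= eps.

Lemma diff_in_cont (a b : R) (y : R -> V) (s : R) (l : V) :
  diff_in a b y s l -> cont_in a b y s.
Proof.
  intros H eps He. destruct (H 1 Rlt_0_1) as (d & Hd & Hr).
  pose proof (norm_ge_0 l) as Hl.
  exists (Rmin d (eps / (1 + norm l))). split.
  { apply Rmin_glb_lt; [exact Hd|]. apply Rdiv_lt_0_compat; lra. }
  intros r Hrab Hrs.
  assert (H1 : Rabs (r - s) < d) by (eapply Rlt_le_trans; [exact Hrs|apply Rmin_l]).
  assert (H2 : Rabs (r - s) < eps / (1 + norm l))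
    by (eapply Rlt_le_trans; [exact Hrs|apply Rmin_r]).
  apply (Rmult_lt_compat_r (1 + norm l)) in H2; [|lra].
  replace (eps / (1 + norm l) * (1 + norm l)) with eps in H2 by (field; lra).
  pose proof (norm_le_add_minus (vminus (y r) (y s)) (vscal (r - s) l)) as H3.
  pose proof (norm_scal_le (r - s) l) as H4.
  specialize (Hr r Hrab H1). lra.
Qed.

(** Supremum argument: consider the points s where the increment from a is at most (K + eps) (s - a)
    + eps. By continuity their supremum belongs to them, and below b it could be exceeded. The
    second eps pays for the first step away from a, where y is only continuous. *)
Lemma mean_value_ineq (a b K : R) (y : R -> V) : a <= b ->
  (forall s, a <= s <= b -> cont_in a b y s) ->
  (forall s, a < s < b -> exists l, norm l <= K /\ diff_in a b y s l) ->
  norm (vminus (y b) (y a)) <= K * (b - a).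
Proof.
  intros Hab Hc Hd.
  destruct (Req_dec a b) as [<-|Hne].
  { rewrite norm_minus_self. lra. }
  assert (HK : 0 <= K).
  { destruct (Hd ((a + b) / 2)) as (l & Hl & _); [lra|].
    pose proof (norm_ge_0 l). lra. }
  apply le_epsilon. intros eps' He'.
  set (eps := eps' / (1 + (b - a))).
  assert (He : 0 < eps) by (apply Rdiv_lt_0_compat; lra).
  assert (Heq : eps * (b - a) + eps = eps') by (unfold eps; field; lra).
  set (E := fun s => a <= s <= b /\ norm (vminus (y s) (y a)) <= (K + eps) * (s - a) + eps).
  assert (HE0 : E a).
  { split; [lra|]. rewrite norm_minus_self. lra. }
  destruct (completeness E) as (s & Hub & Hlub).
  { exists b. intros x [Hx _]. lra. }
  { exists a. exact HE0. }
  assert (Has : a <= s) by (apply Hub; exact HE0).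
  assert (Hsb : s <= b) by (apply Hlub; intros x [Hx _]; lra).
  assert (Hnear : forall d, 0 < d -> exists r, E r /\ s - d < r <= s).
  { intros d Hd0. destruct (Classical_Prop.classic (exists r, E r /\ s - d < r)) as [(r & Hr & Hrs)|Hn].
    - exists r. split; [exact Hr|]. split; [exact Hrs|]. apply Hub, Hr.
    - exfalso. assert (s <= s - d); [|lra]. apply Hlub. intros r Hr.
      apply Rnot_lt_le. intros Hlt. apply Hn. exists r. split; assumption. }
  assert (HEs : E s).
  { split; [lra|]. apply le_epsilon. intros e2 He2.
    destruct (Hc s (conj Has Hsb) e2 He2) as (d & Hd0 & Hcd).
    destruct (Hnear d Hd0) as (r & [Hr HEr] & Hrs).
    assert (Hry : norm (vminus (y r) (y s)) <= e2).
    { apply Hcd; [lra|]. rewrite Rabs_left1; lra. }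
    rewrite norm_minus_sym in Hry.
    pose proof (norm_minus_triangle (y s) (y r) (y a)).
    assert ((K + eps) * (r - a) <= (K + eps) * (s - a)) by (apply Rmult_le_compat_l; lra).
    lra. }
  destruct (Req_dec s b) as [->|Hsb'].
  { destruct HEs as [_ HEs]. nra. }
  exfalso.
  assert (Hstep : exists r, s < r <= b /\ E r).
  { destruct (Req_dec s a) as [->|Hsa].
    - destruct (Hc a (conj (Rle_refl a) Hab) eps He) as (d & Hd0 & Hcd).
      exists (a + Rmin (d / 2) (b - a)).
      assert (0 < Rmin (d / 2) (b - a)) by (apply Rmin_glb_lt; lra).
      pose proof (Rmin_l (d / 2) (b - a)). pose proof (Rmin_r (d / 2) (b - a)).
      split; [lra|]. split; [lra|].
      assert (norm (vminus (y (a + Rmin (d / 2) (b - a))) (y a)) <= eps).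
      { apply Hcd; [lra|]. rewrite Rabs_right; lra. }
      assert (0 <= (K + eps) * (a + Rmin (d / 2) (b - a) - a)) by (apply Rmult_le_pos; lra).
      lra.
    - destruct (Hd s) as (l & Hl & Hdl); [lra|].
      destruct (Hdl eps He) as (d & Hd0 & Hdd).
      set (q := Rmin (d / 2) (b - s)).
      assert (0 < q) by (apply Rmin_glb_lt; lra).
      pose proof (Rmin_l (d / 2) (b - s)) as Hq1. pose proof (Rmin_r (d / 2) (b - s)) as Hq2.
      fold q in Hq1, Hq2.
      exists (s + q). split; [lra|]. split; [lra|].
      assert (H1 : norm (vminus (vminus (y (s + q)) (y s)) (vscal (s + q - s) l))
        <= eps * Rabs (s + q - s)).
      { apply Hdd; [lra|]. rewrite Rabs_right; lra. }
      replace (s + q - s) with q in H1 by ring. rewrite (Rabs_right q) in H1 by lra.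
      pose proof (norm_le_add_minus (vminus (y (s + q)) (y s)) (vscal q l)) as H2.
      pose proof (norm_scal_le q l) as H3. rewrite (Rabs_right q) in H3 by lra.
      assert (q * norm l <= q * K) by (apply Rmult_le_compat_l; lra).
      pose proof (norm_minus_triangle (y (s + q)) (y s) (y a)).
      destruct HEs as [_ HEs]. nra. }
  destruct Hstep as (r & Hr & HEr). apply Hub in HEr. lra.
Qed.

Lemma mean_value_diff (a b K : R) (y : R -> V) : a <= b ->
  (forall s, a <= s <= b -> exists l, norm l <= K /\ diff_in a b y s l) ->
  norm (vminus (y b) (y a)) <= K * (b - a).
Proof.
  intros Hab H. apply mean_value_ineq; [exact Hab| |].
  - intros s Hs. destruct (H s Hs) as (l & _ & Hl). eapply diff_in_cont, Hl.
  - intros s Hs. apply H. lra.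
Qed.

End Norms.

Section Linear.

Context {U V : NormedModule R_AbsRing} (f : U -> V) (H : is_linear f).

Lemma lin_plus x y : f (x ⊕ y) = f x ⊕ f y.
Proof. exact (linear_plus f H x y). Qed.

Lemma lin_scal r x : f (r ⊙ x) = r ⊙ f x.
Proof. exact (linear_scal f H r x). Qed.

Lemma lin_minus x y : f (x ⊖ y) = f x ⊖ f y.
Proof.
  replace (x ⊖ y) with (x ⊕ (-1) ⊙ y) by lin_eq. rewrite lin_plus, lin_scal. lin_eq.
Qed.

Lemma lin_zero : f vzero = vzero.
Proof.
  replace (vzero : U) with (0 ⊙ (vzero : U)) by lin_eq. rewrite lin_scal. lin_eq.
Qed.

End Linear.

(** * The uniform boundedness principle *)

Lemma dependent_choice {A : Type} (R : nat -> A -> A -> Prop) (a0 : A) :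
  (forall n a, exists b, R n a b) ->
  exists s : nat -> A, s 0%nat = a0 /\ forall n, R n (s n) (s (S n)).
Proof.
  intros H.
  set (next := fun n a => proj1_sig (constructive_indefinite_description _ (H n a))).
  exists (fix s n := match n with O => a0 | S m => next m (s m) end).
  split; [reflexivity|]. intros n.
  exact (proj2_sig (constructive_indefinite_description _ (H n _))).
Qed.

(** The balls are nested: the centres x_n and x_{n+k} are at most r_n - r_{n+k} apart. Hence the
    limit of the centres lies in every closed ball. *)
Lemma nested_balls {X : CompleteNormedModule R_AbsRing} (x : nat -> X) (r : nat -> R) :
  (forall n, 0 < r n) -> (forall n, r (S n) <= r n / 2) ->
  (forall n, norm (vminus (x (S n)) (x n)) <= r n / 2) ->
  exists l, forall n, norm (vminus l (x n)) <= r n.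
Proof.
  intros Hr0 Hr2 Hx.
  assert (Hd : forall k n, norm (vminus (x (n + k)%nat) (x n)) <= r n - r (n + k)%nat).
  { induction k as [|k IH]; intros n.
    - rewrite Nat.add_0_r. rewrite norm_minus_self. lra.
    - rewrite Nat.add_succ_r. 
      pose proof (norm_minus_triangle (x (S (n + k))) (x (n + k)%nat) (x n)).
      specialize (IH n). specialize (Hx (n + k)%nat). specialize (Hr2 (n + k)%nat). lra. }
  assert (Hr : forall n, r n <= r 0%nat * (1 / 2) ^ n).
  { induction n as [|n IH]; simpl; [lra|]. specialize (Hr2 n). lra. }
  assert (Hsmall : forall eps, 0 < eps -> exists n, r n < eps).
  { intros eps He. pose proof (Hr0 0%nat) as H0.
    destruct (pow_lt_1_zero (1/2) (ltac:(rewrite Rabs_right; lra)) (eps / r 0%nat)) as (N & HN).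
    { apply Rdiv_lt_0_compat; lra. }
    exists N. specialize (HN N (le_n N)).
    rewrite Rabs_right in HN by (apply Rle_ge, pow_le; lra).
    apply (Rmult_lt_compat_l (r 0%nat)) in HN; [|exact H0].
    replace (r 0%nat * (eps / r 0%nat)) with eps in HN by (field; lra).
    specialize (Hr N). lra. }
  destruct (proj1 (filterlim_locally_cauchy (U := X) (F := eventually) x)) as (l & Hl).
  { intros eps. destruct (Hsmall (eps / 2)) as (N & HN); [destruct eps; simpl; lra|].
    exists (fun n => (N <= n)%nat). split; [exists N; auto|].
    intros u v Hu Hv.
    refine (norm_compat1 (V := CompleteNormedModule.NormedModule R_AbsRing X) (x u) (x v) eps _).
    change (norm (x v ⊖ x u) < eps).
    pose proof (norm_minus_triangle (x v) (x N) (x u)) as H1.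
    rewrite (norm_minus_sym (x N) (x u)) in H1.
    pose proof (Hd (v - N)%nat N) as H2. pose proof (Hd (u - N)%nat N) as H3.
    replace (N + (v - N))%nat with v in H2 by lia.
    replace (N + (u - N))%nat with u in H3 by lia.
    pose proof (Hr0 u). pose proof (Hr0 v). lra. }
  exists l. intros n. apply le_epsilon. intros eps He.
  destruct (proj1 (filterlim_locally_ball_norm x l) Hl (mkposreal eps He)) as (N & HN).
  specialize (HN (n + N)%nat (ltac:(lia))). change (norm (x (n + N)%nat ⊖ l) < eps) in HN.
  pose proof (norm_minus_triangle l (x (n + N)%nat) (x n)) as H1.
  rewrite (norm_minus_sym l (x (n + N)%nat)) in H1. specialize (Hd N n). pose proof (Hr0 (n + N)%nat). lra.
Qed.

(** The index sets [A k] shrink, and both the pointwise bounds and the uniform one hold on some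
    [A k] only. This fits operators S(z) as z tends to 0, where the neighbourhood on which S(z) x is
    bounded depends on x. The proof is a gliding hump: if the claim fails, nested balls are built on
    which the k-th chosen operator has norm at least k throughout. *)
Lemma uniform_boundedness {I : Type} {X : CompleteNormedModule R_AbsRing}
    {Y : NormedModule R_AbsRing} (A : nat -> I -> Prop) (S : I -> X -> Y) :
  (forall k i, A (Datatypes.S k) i -> A k i) ->
  (forall i, A 0%nat i -> is_linear (S i)) ->
  (forall x, exists k C, forall i, A k i -> norm (S i x) <= C) ->
  exists k M, 0 < M /\ forall i x, A k i -> norm (S i x) <= M * norm x.
Proof.
  intros HA Hlin Hpt. apply Classical_Prop.NNPP. intros Hn.
  assert (HA0 : forall k i, A k i -> A 0%nat i) by (induction k; auto).
  assert (HAle : forall k m i, (k <= m)%nat -> A m i -> A k i)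
    by (intros k m i Hkm; induction Hkm; auto).
  set (Rel := fun (k : nat) (p q : X * posreal) =>
    snd q <= snd p / 2 /\ norm (vminus (fst q) (fst p)) <= snd p / 2 /\
    exists i, A k i /\ forall y, norm (vminus y (fst q)) <= snd q -> INR k <= norm (S i y)).
  assert (Hstep : forall k p, exists q, Rel k p q).
  { intros k [x [r Hr]]. unfold Rel. simpl.
    assert (HM : 0 < 4 * (INR k + 1) / r).
    { apply Rdiv_lt_0_compat; [|exact Hr]. pose proof (pos_INR k). lra. }
    assert (Hex : exists i xi, A k i /\ 4 * (INR k + 1) / r * norm xi < norm (S i xi)).
    { apply Classical_Prop.NNPP. intros Hn2. apply Hn.
      exists k, (4 * (INR k + 1) / r). split; [exact HM|].
      intros i xi Hi. apply Rnot_lt_le. intros Hlt. apply Hn2. exists i, xi. auto. }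
    destruct Hex as (i & xi & Hi & Hxi).
    assert (Hli : is_linear (S i)) by (apply Hlin, (HA0 k), Hi).
    assert (Hn0 : 0 < norm xi).
    { destruct (Req_dec (norm xi) 0) as [E|E].
      - assert (E0 : xi = vzero) by exact (norm_eq_zero xi E). rewrite E0 in Hxi. rewrite (lin_zero _ Hli), !norm_vzero in Hxi. lra.
      - pose proof (norm_ge_0 xi). lra. }
    set (eta := vscal (r / 2 / norm xi) xi).
    assert (Heta : norm eta <= r / 2).
    { unfold eta. eapply Rle_trans; [apply norm_scal_le|].
      rewrite Rabs_right by (apply Rle_ge, Rlt_le, Rdiv_lt_0_compat; lra).
      right. field. lra. }
    assert (HSeta : 2 * (INR k + 1) <= norm (S i eta)).
    { assert (E : xi = vscal (norm xi * 2 / r) eta) by (unfold eta; lin_field; lra).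
      rewrite E in Hxi at 2. rewrite (lin_scal _ Hli) in Hxi.
      pose proof (norm_scal_le (norm xi * 2 / r) (S i eta)) as H1.
      rewrite Rabs_right in H1 by (apply Rle_ge, Rlt_le, Rdiv_lt_0_compat; lra).
      assert (H2 : norm xi * 2 / r * (2 * (INR k + 1)) < norm xi * 2 / r * norm (S i eta)).
      { eapply Rle_lt_trans; [|eapply Rlt_le_trans; [exact Hxi|exact H1]]. right. field. lra. }
      left. eapply Rmult_lt_reg_l; [|exact H2]. apply Rdiv_lt_0_compat; lra. }
    assert (Hx' : exists x', norm (vminus x' x) <= r / 2 /\ INR k + 1 <= norm (S i x')).
    { destruct (Rle_dec (INR k + 1) (norm (S i (vplus x eta)))) as [H1|H1].
      - exists (vplus x eta). split; [|exact H1].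
        replace (vminus (vplus x eta) x) with eta by lin_eq. exact Heta.
      - apply Rnot_le_lt in H1. pose proof (pos_INR k). exists (vminus x eta). split.
        + replace (vminus (vminus x eta) x) with (vscal (-1) eta) by lin_eq.
          eapply Rle_trans; [apply norm_scal_le|]. rewrite Rabs_left; lra.
        + assert (E : vscal 2 eta = vminus (vplus x eta) (vminus x eta)) by lin_eq.
          apply (f_equal (S i)) in E.
          rewrite (lin_scal _ Hli), (lin_minus _ Hli (vplus x eta)) in E.
          pose proof (norm_minus_le (S i (vplus x eta)) (S i (vminus x eta))) as H2.
          rewrite <- E in H2.
          assert (H3 : norm (S i eta) <= / 2 * norm (vscal 2 (S i eta))).
          { replace (S i eta) with (vscal (/ 2) (vscal 2 (S i eta))) at 1 by (lin_field).
            eapply Rle_trans; [apply norm_scal_le|]. rewrite Rabs_right; lra. }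
          lra. }
    destruct Hx' as (x' & Hx'1 & Hx'2).
    destruct (linear_norm _ Hli) as (C & HC & HCb).
    (* On a ball of radius 1/C the chosen operator changes by at most 1, which keeps its values
       above k. *)
    assert (Hr' : 0 < Rmin (r / 2) (/ C)).
    { apply Rmin_glb_lt; [lra|]. apply Rinv_0_lt_compat, HC. }
    exists (x', mkposreal _ Hr'). simpl. split; [apply Rmin_l|]. split; [exact Hx'1|].
    exists i. split; [exact Hi|]. intros y Hy.
    pose proof (norm_le_add_minus (S i x') (S i y)) as H1.
    rewrite <- (lin_minus _ Hli) in H1. specialize (HCb (vminus x' y)).
    rewrite norm_minus_sym in Hy.
    assert (norm (vminus x' y) <= / C) by (eapply Rle_trans; [exact Hy|apply Rmin_r]).
    assert (C * norm (vminus x' y) <= C * / C) by (apply Rmult_le_compat_l; lra).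
    rewrite Rinv_r in * by lra. lra. }
  destruct (dependent_choice Rel (vzero, mkposreal 1 Rlt_0_1) Hstep) as (s & _ & Hs).
  destruct (nested_balls (fun n => fst (s n)) (fun n => snd (s n))) as (l & Hl).
  - intros n. apply cond_pos.
  - intros n. apply (Hs n).
  - intros n. apply (Hs n).
  - destruct (Hpt l) as (k & C & HC).
    destruct (INR_unbounded C) as (m & Hm).
    (* An index beyond both k, so that the pointwise bound applies, and C, so that it is
       violated. *)
    destruct (Hs (k + m)%nat) as (_ & _ & i & Hi & Hy).
    specialize (Hy l (Hl _)). specialize (HC i (HAle k (k + m)%nat i (Nat.le_add_r k m) Hi)).
    rewrite plus_INR in Hy. pose proof (pos_INR k). lra.
Qed.

(** * Finite sums of vectors *)

Section Sums.

Context {V : NormedModule R_AbsRing}.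

Fixpoint vsum (n : nat) (f : nat -> V) : V :=
  match n with O => vzero | S n => vsum n f ⊕ f n end.

Lemma vsum_ext n f g : (forall j, (j < n)%nat -> f j = g j) -> vsum n f = vsum n g.
Proof.
  induction n as [|n IH]; intros H; simpl; [reflexivity|].
  rewrite IH by (intros; apply H; lia). rewrite H by lia. reflexivity.
Qed.

Lemma vsum_plus n f g : vsum n (fun j => f j ⊕ g j) = vsum n f ⊕ vsum n g.
Proof. induction n as [|n IH]; simpl; [|rewrite IH]; lin_eq. Qed.

Lemma vsum_minus n f g : vsum n (fun j => f j ⊖ g j) = vsum n f ⊖ vsum n g.
Proof. induction n as [|n IH]; simpl; [|rewrite IH]; lin_eq. Qed.

Lemma vsum_scal n r f : vsum n (fun j => r ⊙ f j) = r ⊙ vsum n f.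
Proof. induction n as [|n IH]; simpl; [|rewrite IH]; lin_eq. Qed.

Lemma vsum_const n v : vsum n (fun _ => v) = INR n ⊙ v.
Proof. induction n as [|n IH]; [simpl|rewrite S_INR; simpl; rewrite IH]; lin_eq. Qed.

Lemma vsum_shift n f : vsum n (fun j => f (S j)) ⊕ f 0%nat = vsum n f ⊕ f n.
Proof.
  induction n as [|n IH]; simpl; [reflexivity|].
  rewrite <- IH. lin_eq.
Qed.

Lemma vsum_telescope n f : vsum n (fun j => f (S j) ⊖ f j) = f n ⊖ f 0%nat.
Proof. induction n as [|n IH]; simpl; [|rewrite IH]; lin_eq. Qed.

Lemma norm_vsum_le n f c : (forall j, (j < n)%nat -> norm (f j) <= c) ->
  norm (vsum n f) <= INR n * c.
Proof.
  induction n as [|n IH]; intros H; [simpl|rewrite S_INR; simpl].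
  - rewrite norm_vzero. lra.
  - eapply Rle_trans; [apply norm_plus_le|].
    specialize (IH (fun j Hj => H j (Nat.lt_lt_succ_r _ _ Hj))).
    specialize (H n (Nat.lt_succ_diag_r n)). lra.
Qed.

End Sums.

Lemma lin_vsum {U V : NormedModule R_AbsRing} (L : U -> V) (HL : is_linear L) n f :
  L (vsum n f) = vsum n (fun j => L (f j)).
Proof.
  induction n as [|n IH]; simpl; [apply (lin_zero L HL)|].
  rewrite (lin_plus L HL), IH. reflexivity.
Qed.

(** * The complexified space and Cauchy's estimate *)

Section Complexified.

Context {X : CompleteNormedModule R_AbsRing}.
Notation E := (@XC X).
Implicit Types (p q : E).

Lemma norm_XC p : norm p = sqrt (norm (fst p) ^ 2 + norm (snd p) ^ 2).
Proof. reflexivity. Qed.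

Lemma norm_fst_le p : norm (fst p) <= norm p.
Proof.
  rewrite norm_XC. rewrite <- (sqrt_pow2 (norm (fst p))) at 1 by apply norm_ge_0.
  apply sqrt_le_1_alt. pose proof (pow2_ge_0 (norm (snd p))). lra.
Qed.

Lemma norm_snd_le p : norm (snd p) <= norm p.
Proof.
  rewrite norm_XC. rewrite <- (sqrt_pow2 (norm (snd p))) at 1 by apply norm_ge_0.
  apply sqrt_le_1_alt. pose proof (pow2_ge_0 (norm (fst p))). lra.
Qed.

Lemma norm_le_fst_snd p : norm p <= norm (fst p) + norm (snd p).
Proof.
  rewrite norm_XC. pose proof (norm_ge_0 (fst p)). pose proof (norm_ge_0 (snd p)).
  rewrite <- (sqrt_pow2 (norm (fst p) + norm (snd p))) by lra.
  apply sqrt_le_1_alt. nra.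
Qed.

Lemma XC_ext p q : fst p = fst q -> snd p = snd q -> p = q.
Proof. apply injective_projections. Qed.

Lemma fst_plus p q : fst (p ⊕ q) = fst p ⊕ fst q.
Proof. reflexivity. Qed.

Lemma fst_minus p q : fst (p ⊖ q) = fst p ⊖ fst q.
Proof. reflexivity. Qed.

Lemma fst_cscal w p : fst (cscal w p) = Re w ⊙ fst p ⊖ Im w ⊙ snd p.
Proof. reflexivity. Qed.

Lemma snd_plus p q : snd (p ⊕ q) = snd p ⊕ snd q.
Proof. reflexivity. Qed.

Lemma snd_minus p q : snd (p ⊖ q) = snd p ⊖ snd q.
Proof. reflexivity. Qed.

Lemma fst_scal r p : fst (r ⊙ p) = r ⊙ fst p.
Proof. reflexivity. Qed.

Lemma snd_scal r p : snd (r ⊙ p) = r ⊙ snd p.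
Proof. reflexivity. Qed.

Lemma snd_cscal w p : snd (cscal w p) = Re w ⊙ snd p ⊕ Im w ⊙ fst p.
Proof. reflexivity. Qed.

Ltac cscal_solve :=
  apply XC_ext; rewrite ?fst_cscal, ?snd_cscal, ?fst_plus, ?snd_plus, ?fst_minus, ?snd_minus,
    ?fst_scal, ?snd_scal, ?fst_cscal, ?snd_cscal; unfold Re, Im, Cminus, Cmult, Cplus, Copp, RtoC; cbn [fst snd];
  lin_eq.

Lemma cscal_mult w z p : cscal (w * z)%C p = cscal w (cscal z p).
Proof. cscal_solve. Qed.

Lemma cscal_sub w z p : cscal (w - z)%C p = cscal w p ⊖ cscal z p.
Proof. cscal_solve. Qed.

Lemma cscal_real r p : cscal (RtoC r) p = r ⊙ p.
Proof. cscal_solve. Qed.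

(** The Euclidean product norm need not be a complex norm, so multiplication by a unimodular number
    need not be isometric. Each of the four real products is bounded separately, which gives the
    factor 4. *)
Lemma norm_cscal_le w p : norm (cscal w p) <= 4 * Cmod w * norm p.
Proof.
  eapply Rle_trans; [apply norm_le_fst_snd|]. rewrite fst_cscal, snd_cscal.
  pose proof (norm_minus_le (Re w ⊙ fst p) (Im w ⊙ snd p)) as H1.
  pose proof (norm_plus_le (Re w ⊙ snd p) (Im w ⊙ fst p)) as H2.
  pose proof (norm_scal_le (Re w) (fst p)) as H3. pose proof (norm_scal_le (Im w) (snd p)) as H4.
  pose proof (norm_scal_le (Re w) (snd p)) as H5. pose proof (norm_scal_le (Im w) (fst p)) as H6.
  pose proof (Rmax_Cmod w) as H7.
  pose proof (Rmax_l (Rabs (fst w)) (Rabs (snd w))). pose proof (Rmax_r (Rabs (fst w)) (Rabs (snd w))).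
  assert (H8 : forall a x, 0 <= a <= Cmod w -> 0 <= x <= norm p -> a * x <= Cmod w * norm p)
    by (intros a x Ha Hx; apply Rmult_le_compat; lra).
  pose proof (H8 (Rabs (Re w)) (norm (fst p))) as G1. pose proof (H8 (Rabs (Im w)) (norm (snd p))) as G2.
  pose proof (H8 (Rabs (Re w)) (norm (snd p))) as G3. pose proof (H8 (Rabs (Im w)) (norm (fst p))) as G4.
  pose proof (norm_fst_le p). pose proof (norm_snd_le p).
  pose proof (norm_ge_0 (fst p)). pose proof (norm_ge_0 (snd p)).
  pose proof (Rabs_pos (Re w)). pose proof (Rabs_pos (Im w)). unfold Re, Im in *.
  lra.
Qed.

Lemma cscal_linear w : is_linear (cscal w : E -> E).
Proof.
  split.
  - intros p q. change (cscal w (p ⊕ q) = cscal w p ⊕ cscal w q). cscal_solve.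
  - intros r p. change (cscal w (r ⊙ p) = r ⊙ cscal w p). cscal_solve.
  - exists (4 * Cmod w + 1). split; [pose proof (Cmod_ge_0 w); lra|].
    intros p. pose proof (norm_cscal_le w p). pose proof (norm_ge_0 p). lra.
Qed.

End Complexified.

Section Cauchy.

Context {X : CompleteNormedModule R_AbsRing}.
Notation E := (@XC X).

Definition cis (t : R) : C := (cos t, sin t).

Lemma cis_add s t : cis (s + t) = (cis s * cis t)%C.
Proof.
  unfold cis, Cmult; cbn [fst snd]. rewrite cos_plus, sin_plus. f_equal; ring.
Qed.

Lemma cis_0 : cis 0 = 1%C.
Proof. unfold cis. rewrite cos_0, sin_0. reflexivity. Qed.

Lemma cis_2PI : cis (2 * PI) = 1%C.
Proof. unfold cis. rewrite cos_2PI, sin_2PI. reflexivity. Qed.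

Lemma Cmod_cis t : Cmod (cis t) = 1.
Proof.
  unfold Cmod, cis; cbn [fst snd]. pose proof (sin2_cos2 t) as H. unfold Rsqr in H.
  replace (cos t ^ 2 + sin t ^ 2) with 1 by (simpl; lra). apply sqrt_1.
Qed.

Lemma cis_neg t : (cis (- t) * cis t)%C = 1%C.
Proof. rewrite <- cis_add, Rplus_opp_l. apply cis_0. Qed.

(** The lower bound matters as much as the upper one: the distance of neighbouring roots of unity is
    also the relative step between radii, and it appears in denominators. *)
Lemma cis_close (eps : R) : 0 < eps -> exists t0, 0 < t0 /\
  forall t, 0 < t < t0 -> 0 < Cmod (cis t - 1) < eps.
Proof.
  intros He.
  destruct (continuity_cos 0 (eps / 2)) as (d1 & Hd1 & Hc); [lra|].
  destruct (continuity_sin 0 (eps / 2)) as (d2 & Hd2 & Hs); [lra|].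
  unfold R_dist, dist in Hc, Hs; simpl in Hc, Hs. unfold R_dist in Hc, Hs.
  exists (Rmin (Rmin d1 d2) PI). pose proof PI_RGT_0.
  split; [repeat apply Rmin_glb_lt; assumption|]. intros t Ht.
  pose proof (Rmin_l (Rmin d1 d2) PI). pose proof (Rmin_r (Rmin d1 d2) PI).
  pose proof (Rmin_l d1 d2). pose proof (Rmin_r d1 d2).
  assert (Ht0 : Rabs (t - 0) = t) by (rewrite Rminus_0_r; apply Rabs_right; lra).
  specialize (Hc t). specialize (Hs t). rewrite Ht0, cos_0 in Hc. rewrite Ht0, sin_0 in Hs.
  assert (C1 : Rabs (cos t - 1) < eps / 2) by (apply Hc; repeat split; lra).
  assert (C2 : Rabs (sin t - 0) < eps / 2) by (apply Hs; repeat split; lra).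
  rewrite Rminus_0_r in C2. split.
  - apply Cmod_gt_0. intros E0. apply (f_equal snd) in E0. cbn in E0.
    assert (0 < sin t) by (apply sin_gt_0; lra). lra.
  - replace (cis t - 1)%C with (RtoC (cos t - 1) + Ci * RtoC (sin t))%C.
    + eapply Rle_lt_trans; [apply Cmod_triangle|].
      rewrite Cmod_mult, !Cmod_R. replace (Cmod Ci) with 1; [lra|].
      unfold Cmod, Ci; cbn [fst snd]. replace (0 ^ 2 + 1 ^ 2) with 1 by ring. symmetry; apply sqrt_1.
    + unfold cis. apply injective_projections; cbn; ring.
Qed.

Variables (F F' : C -> E) (r K : R).
Hypothesis r_pos : 0 < r.
Hypothesis F_bound : forall z, Cmod z <= r -> norm (F z) <= K.

(** One delta serves all points of the disc. This uniformity takes the place of Goursat's argument;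
    for a semigroup it follows from differentiability at one point. *)
Definition quotient_close (eps delta : R) : Prop :=
  forall z w, Cmod z <= r -> Cmod (z + w) <= r -> Cmod w < delta ->
  norm (F (z + w)%C ⊖ F z ⊖ cscal w (F' z)) <= eps * Cmod w.

Hypothesis F_diff : forall eps, 0 < eps -> exists delta, 0 < delta /\ quotient_close eps delta.

(* N rho times a discretization of Cauchy's integral for F'(0) *)
Definition circle_sum (N : nat) (rho : R) : E :=
  vsum N (fun j => cscal (cis (- (INR j * (2 * PI / INR N))))
    (F (rho * cis (INR j * (2 * PI / INR N)))%C)).

Section Circle.

Variable N : nat.
Hypothesis N_pos : (0 < N)%nat.
Let alpha := 2 * PI / INR N.
Let e (j : nat) := cis (INR j * alpha).
Let e' (j : nat) := cis (- (INR j * alpha)).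
Let lambda := Cmod (cis alpha - 1).

Let A (rho : R) : E := vsum N (fun j => cscal (e' j) (F (rho * e j)%C)).

Lemma e_S j : e (S j) = (cis alpha * e j)%C.
Proof. unfold e. rewrite S_INR, <- cis_add. f_equal. ring. Qed.

Lemma e'_S j : (cis alpha * e' (S j))%C = e' j.
Proof. unfold e'. rewrite S_INR, <- cis_add. f_equal. ring. Qed.

Lemma e_N : e N = e 0%nat.
Proof.
  unfold e. rewrite Rmult_0_l, cis_0. unfold alpha.
  replace (INR N * (2 * PI / INR N)) with (2 * PI); [apply cis_2PI|].
  field. apply not_0_INR. lia.
Qed.

Lemma e'_N : e' N = e' 0%nat.
Proof.
  unfold e'. rewrite Rmult_0_l, Ropp_0, cis_0. unfold alpha.
  replace (INR N * (2 * PI / INR N)) with (2 * PI) by (field; apply not_0_INR; lia).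
  unfold cis. rewrite cos_neg, sin_neg, cos_2PI, sin_2PI, Ropp_0. reflexivity.
Qed.

Lemma Cmod_circle (rho : R) j : 0 <= rho -> Cmod (rho * e j) = rho.
Proof.
  intros H. rewrite Cmod_mult, Cmod_R. unfold e. rewrite Cmod_cis, Rabs_right; lra.
Qed.

Lemma rotated_sum (G : nat -> E) : G N = G 0%nat -> vsum N (fun j => G (S j)) = vsum N G.
Proof.
  intros HG. pose proof (vsum_shift N G) as H. rewrite HG in H.
  transitivity (vsum N (fun j => G (S j)) ⊕ G 0%nat ⊖ G 0%nat); [lin_eq|].
  rewrite H. lin_eq.
Qed.

(** Advancing the points by one root of unity is compensated by the conjugate weights, up to the
    factor e^{i alpha}. *)
Lemma A_rotate (rho : R) :
  vsum N (fun j => cscal (e' j) (F (rho * e (S j))%C)) = cscal (cis alpha) (A rho).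
Proof.
  unfold A. rewrite <- (rotated_sum (fun j => cscal (e' j) (F (rho * e j)%C))).
  - rewrite (lin_vsum _ (cscal_linear _)). apply vsum_ext. intros j _.
    rewrite <- cscal_mult, e'_S. reflexivity.
  - rewrite e'_N, e_N. reflexivity.
Qed.

Hypothesis lambda_pos : 0 < lambda.

(* The step along the ray is the step along the circle turned by the unimodular
   factor u, and the steps along the circle sum up cyclically. *)
Lemma A_step (eps delta rho : R) : 0 < eps -> quotient_close eps delta -> 0 < rho ->
  (1 + lambda) * rho <= r -> lambda * rho < delta ->
  norm (A ((1 + lambda) * rho) ⊖ (1 + lambda) ⊙ A rho) <= INR N * (8 * eps * (lambda * rho)).
Proof.
  intros He Hq Hrho Hr Hd.
  assert (Hne : (cis alpha - 1)%C <> 0%C) by (apply Cmod_gt_0; exact lambda_pos).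
  set (u := (RtoC lambda / (cis alpha - 1))%C).
  assert (Hu : (u * (cis alpha - 1))%C = RtoC lambda) by (unfold u; field; exact Hne).
  assert (Hu1 : Cmod u = 1).
  { unfold u. rewrite Cmod_div by exact Hne. rewrite Cmod_R, Rabs_right by lra.
    fold lambda. field. lra. }
  set (w1 := fun j => (RtoC (lambda * rho) * e j)%C).
  set (w2 := fun j => ((cis alpha - 1) * (rho * e j))%C).
  assert (Hw : forall j, (w1 j = u * w2 j)%C).
  { intros j. unfold w1, w2. rewrite Cmult_assoc, Hu, RtoC_mult. ring. }
  set (R1 := fun j => F (rho * e j + w1 j)%C ⊖ F (rho * e j)%C ⊖ cscal (w1 j) (F' (rho * e j)%C)).
  set (R2 := fun j => F (rho * e j + w2 j)%C ⊖ F (rho * e j)%C ⊖ cscal (w2 j) (F' (rho * e j)%C)).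
  assert (Ew1 : forall j, (rho * e j + w1 j = RtoC ((1 + lambda) * rho) * e j)%C).
  { intros j. unfold w1. rewrite !RtoC_mult, RtoC_plus. ring. }
  assert (Ew2 : forall j, (rho * e j + w2 j = rho * e (S j))%C).
  { intros j. unfold w2. rewrite e_S. ring. }
  assert (Hlr : 0 < lambda * rho) by (apply Rmult_lt_0_compat; assumption).
  assert (HR1 : forall j, norm (R1 j) <= eps * (lambda * rho)).
  { intros j. assert (Hm : Cmod (w1 j) = lambda * rho) by (apply Cmod_circle; lra).
    rewrite <- Hm. apply Hq.
    - rewrite Cmod_circle; lra.
    - rewrite Ew1, Cmod_circle; lra.
    - lra. }
  assert (HR2 : forall j, norm (R2 j) <= eps * (lambda * rho)).
  { intros j. assert (Hm : Cmod (w2 j) = lambda * rho).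
    { unfold w2. rewrite Cmod_mult, Cmod_circle by lra. reflexivity. }
    rewrite <- Hm. apply Hq.
    - rewrite Cmod_circle; lra.
    - rewrite Ew2, Cmod_circle; lra.
    - lra. }
  (* Since [w1 j] is u times [w2 j], the terms with F' cancel and only the two remainders are left.
     Each is bounded with the factor 4 of [norm_cscal_le], whence the 8. *)
  replace (A ((1 + lambda) * rho) ⊖ (1 + lambda) ⊙ A rho) with
    (vsum N (fun j => cscal (e' j) (R1 j) ⊖ cscal (e' j * u) (R2 j))).
  - apply norm_vsum_le. intros j _.
    eapply Rle_trans; [apply norm_minus_le|].
    pose proof (norm_cscal_le (e' j) (R1 j)) as H1.
    pose proof (norm_cscal_le (e' j * u) (R2 j)) as H2.
    rewrite Cmod_mult, Hu1 in H2. unfold e' at 2 in H1. unfold e' at 2 in H2.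
    rewrite Cmod_cis in H1, H2. specialize (HR1 j). specialize (HR2 j). lra.
  - rewrite (vsum_ext N _ (fun j =>
      (cscal (e' j) (F (RtoC ((1 + lambda) * rho) * e j)%C) ⊖ cscal (e' j) (F (rho * e j)%C))
      ⊖ cscal u (cscal (e' j) (F (rho * e (S j))%C) ⊖ cscal (e' j) (F (rho * e j)%C)))).
    + rewrite vsum_minus, <- (lin_vsum _ (cscal_linear u)), !vsum_minus, A_rotate.
      fold (A ((1 + lambda) * rho)). fold (A rho).
      transitivity (A ((1 + lambda) * rho) ⊖ A rho ⊖ cscal (u * (cis alpha - 1)) (A rho)).
      * rewrite cscal_mult, cscal_sub. do 3 f_equal.
        symmetry. rewrite cscal_real. lin_eq.
      * rewrite Hu, cscal_real. lin_eq.
    + intros j _. unfold R1, R2. rewrite Ew1, Ew2, !(lin_minus _ (cscal_linear _)).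
      rewrite <- !cscal_mult. rewrite Hw.
      replace (e' j * u * w2 j)%C with (e' j * (u * w2 j))%C by ring.
      replace (u * e' j)%C with (e' j * u)%C by ring. lin_eq.
Qed.

(** Multiplication by e^{i alpha} permutes the summands, and e^{i alpha} differs from 1. *)
Lemma sum_e' (p : E) : vsum N (fun j => cscal (e' j) p) = vzero.
Proof.
  assert (Hne : (cis alpha - 1)%C <> 0%C) by (apply Cmod_gt_0; exact lambda_pos).
  set (s := vsum N (fun j => cscal (e' j) p)).
  assert (H : cscal (cis alpha - 1) s = vzero).
  { rewrite cscal_sub, cscal_real. unfold s at 1.
    rewrite <- (rotated_sum (fun j => cscal (e' j) p)) by (rewrite e'_N; reflexivity).
    rewrite (lin_vsum _ (cscal_linear _)).
    rewrite (vsum_ext N _ (fun j => cscal (e' j) p)).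
    - fold s. lin_eq.
    - intros j _. rewrite <- cscal_mult, e'_S. reflexivity. }
  apply (f_equal (cscal (/ (cis alpha - 1)))) in H.
  rewrite (lin_zero _ (cscal_linear _)), <- cscal_mult in H.
  rewrite Cinv_l in H by exact Hne. rewrite cscal_real in H.
  rewrite <- H. lin_eq.
Qed.

(** On a small circle F is almost affine. The constant part is lost because the weights sum to zero,
    and in the linear part each weight cancels its root of unity. *)
Lemma A_small (eps delta rho : R) : 0 < eps -> quotient_close eps delta -> 0 < rho <= r ->
  rho < delta -> norm (A rho ⊖ (INR N * rho) ⊙ F' 0%C) <= INR N * (4 * (eps * rho)).
Proof.
  intros He Hq Hrho Hd.
  replace (A rho ⊖ (INR N * rho) ⊙ F' 0%C) with
    (vsum N (fun j => cscal (e' j)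
      (F (0 + rho * e j)%C ⊖ F 0%C ⊖ cscal (rho * e j) (F' 0%C)))).
  - apply norm_vsum_le. intros j _.
    eapply Rle_trans; [apply norm_cscal_le|]. unfold e' at 1. rewrite Cmod_cis.
    assert (Hm : Cmod (rho * e j) = rho) by (apply Cmod_circle; lra).
    assert (norm (F (0 + rho * e j)%C ⊖ F 0%C ⊖ cscal (rho * e j) (F' 0%C)) <= eps * rho).
    { eapply Rle_trans; [apply Hq|rewrite Hm; lra].
      - rewrite Cmod_0. lra.
      - rewrite Cplus_0_l, Hm. lra.
      - lra. }
    lra.
  - rewrite (vsum_ext N _ (fun j => cscal (e' j) (F (rho * e j)%C) ⊖ cscal (e' j) (F 0%C)
      ⊖ rho ⊙ F' 0%C)).
    + rewrite !vsum_minus, vsum_const, sum_e'. fold (A rho). lin_eq.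
    + intros j _. rewrite Cplus_0_l, !(lin_minus _ (cscal_linear _)), <- cscal_mult.
      replace (e' j * (rho * e j))%C with (RtoC rho).
      * rewrite cscal_real. reflexivity.
      * replace (e' j * (rho * e j))%C with (rho * (e' j * e j))%C by ring.
        unfold e', e. rewrite cis_neg. ring.
Qed.

Lemma A_bound (rho : R) : 0 < rho <= r -> norm (A rho) <= INR N * (4 * K).
Proof.
  intros Hrho. apply norm_vsum_le. intros j _.
  eapply Rle_trans; [apply norm_cscal_le|]. unfold e' at 1. rewrite Cmod_cis.
  assert (norm (F (rho * e j)%C) <= K); [|lra].
  apply F_bound. rewrite Cmod_circle; lra.
Qed.

(** Discrete form of the fact that Cauchy's integral does not depend on the radius: [A rho] divided
    by rho changes by at most 8 N eps lambda when the radius grows by the factor 1 + lambda. *)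
Lemma A_steps (eps delta rho : R) m : 0 < eps -> quotient_close eps delta -> 0 < rho ->
  (1 + lambda) ^ m * rho <= r -> lambda * r < delta ->
  norm (/ ((1 + lambda) ^ m * rho) ⊙ A ((1 + lambda) ^ m * rho) ⊖ / rho ⊙ A rho)
  <= INR N * (8 * eps * (INR m * lambda)).
Proof.
  intros He Hq Hrho. induction m as [|m IH]; intros Hr Hd.
  - rewrite !Rmult_1_l, norm_minus_self. simpl. lra.
  - set (q := 1 + lambda) in *. set (s := q ^ m * rho) in *.
    assert (Hqm : 0 < q ^ m) by (apply pow_lt; unfold q; lra).
    assert (Hs : 0 < s) by (apply Rmult_lt_0_compat; assumption).
    assert (Hqs : q ^ S m * rho = q * s) by (unfold s; simpl; ring).
    rewrite Hqs in *.
    assert (Hsr : s <= q * s) by (unfold q; nra).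
    eapply Rle_trans; [apply (norm_minus_triangle _ (/ s ⊙ A s))|].
    specialize (IH (Rle_trans _ _ _ Hsr Hr) Hd).
    assert (H1 : norm (/ (q * s) ⊙ A (q * s) ⊖ / s ⊙ A s) <= INR N * (8 * eps * lambda)).
    { replace (/ (q * s) ⊙ A (q * s) ⊖ / s ⊙ A s) with (/ (q * s) ⊙ (A (q * s) ⊖ q ⊙ A s)).
      - eapply Rle_trans; [apply norm_scal_le|].
        assert (Hqs0 : 0 < q * s) by (unfold q; nra).
        rewrite Rabs_right by (apply Rle_ge, Rlt_le, Rinv_0_lt_compat, Hqs0).
        apply (Rmult_le_reg_l (q * s)); [exact Hqs0|].
        rewrite <- Rmult_assoc, Rinv_r, Rmult_1_l by lra.
        eapply Rle_trans.
        + apply (A_step eps delta s He Hq Hs Hr).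
          assert (lambda * s <= lambda * r) by (apply Rmult_le_compat_l; lra). lra.
        + fold q. replace (q * s * (INR N * (8 * eps * lambda)))
            with (q * (INR N * (8 * eps * (lambda * s)))) by ring.
          assert (0 <= INR N * (8 * eps * (lambda * s))).
          { apply Rmult_le_pos; [apply pos_INR|]. apply Rmult_le_pos; [lra|].
            apply Rmult_le_pos; lra. }
          unfold q. nra.
      - lin_field. unfold q; split; lra. }
    rewrite S_INR. lra.
Qed.

End Circle.

Lemma geometric_below (q rho : R) : 1 < q -> 0 < rho <= r -> exists m,
  q ^ m * rho <= r < q * (q ^ m * rho).
Proof.
  intros Hq Hrho. apply Classical_Prop.NNPP. intros Hn.
  assert (H : forall m, q ^ m * rho <= r).
  { induction m as [|m IH]; [simpl; lra|].
    apply Rnot_lt_le. intros Hlt. apply Hn. exists m. split; [exact IH|].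
    replace (q * (q ^ m * rho)) with (q ^ S m * rho) by (simpl; ring). exact Hlt. }
  destruct (INR_unbounded (r / rho / (q - 1))) as (m & Hm).
  pose proof (poly m (q - 1)) as H1. replace (1 + (q - 1)) with q in H1 by ring.
  specialize (H1 (ltac:(lra))). specialize (H m).
  assert (r / rho < INR m * (q - 1)).
  { apply (Rmult_lt_compat_r (q - 1)) in Hm; [|lra].
    replace (r / rho / (q - 1) * (q - 1)) with (r / rho) in Hm by (field; lra). exact Hm. }
  assert (q ^ m <= r / rho).
  { apply (Rmult_le_reg_r rho); [lra|]. replace (r / rho * rho) with r by (field; lra). exact H. }
  lra.
Qed.

(** F'(0) is read off on a small circle, and the sum is carried outwards to a circle close to the
    boundary, where only the bound K is used. Of the constant 8, a factor 4 comes from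
    [norm_cscal_le] and a factor 2 from the last radius, which exceeds r/2 because lambda < 1. *)
Lemma cauchy_estimate : norm (F' 0%C) <= 8 * K / r.
Proof.
  apply le_epsilon. intros eps He.
  destruct (F_diff (eps / 8)) as (d0 & Hd0 & Hq0); [lra|].
  set (rho := Rmin (d0 / 2) r).
  assert (Hrho : 0 < rho <= r) by (split; [apply Rmin_glb_lt; lra|apply Rmin_r]).
  assert (Hrd : rho < d0) by (pose proof (Rmin_l (d0 / 2) r); fold rho in H; lra).
  (* By Bernoulli's inequality the m steps outwards satisfy m lambda <= r/rho, so this accuracy per
     step costs at most N eps/2 in total. *)
  destruct (F_diff (eps / 16 * (rho / r))) as (d1 & Hd1 & Hq1).
  { apply Rmult_lt_0_compat; [lra|]. apply Rdiv_lt_0_compat; lra. }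
  destruct (cis_close (Rmin 1 (d1 / r))) as (t0 & Ht0 & Hcis).
  { apply Rmin_glb_lt; [lra|]. apply Rdiv_lt_0_compat; lra. }
  destruct (INR_unbounded (2 * PI / t0)) as (N & HN).
  pose proof PI_RGT_0 as HPI.
  assert (HN0 : 0 < INR N).
  { eapply Rlt_trans; [|exact HN]. apply Rdiv_lt_0_compat; lra. }
  assert (HNpos : (0 < N)%nat) by (apply INR_lt; exact HN0).
  assert (Halpha : 0 < 2 * PI / INR N < t0).
  { split; [apply Rdiv_lt_0_compat; lra|].
    apply (Rmult_lt_reg_r (INR N)); [exact HN0|].
    replace (2 * PI / INR N * INR N) with (2 * PI) by (field; lra).
    apply (Rmult_lt_compat_r t0) in HN; [|exact Ht0].
    replace (2 * PI / t0 * t0) with (2 * PI) in HN by (field; lra). lra. }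
  destruct (Hcis _ Halpha) as (Hl0 & Hl1).
  set (lambda := Cmod (cis (2 * PI / INR N) - 1)) in *.
  assert (Hl2 : lambda < 1) by (eapply Rlt_le_trans; [exact Hl1|apply Rmin_l]).
  assert (Hl3 : lambda * r < d1).
  { assert (H : lambda < d1 / r) by (eapply Rlt_le_trans; [exact Hl1|apply Rmin_r]).
    apply (Rmult_lt_compat_r r) in H; [|exact r_pos].
    replace (d1 / r * r) with d1 in H by (field; lra). exact H. }
  destruct (geometric_below (1 + lambda) rho) as (m & Hm1 & Hm2); [lra|exact Hrho|].
  set (s := (1 + lambda) ^ m * rho) in *.
  assert (Hs : 0 < s) by (apply Rmult_lt_0_compat; [apply pow_lt|]; lra).
  assert (H1 : norm (/ s ⊙ circle_sum N s ⊖ / rho ⊙ circle_sum N rho)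
    <= INR N * (8 * (eps / 16 * (rho / r)) * (INR m * lambda))).
  { apply (A_steps N HNpos Hl0 (eps / 16 * (rho / r)) d1 rho m); try assumption.
    - apply Rmult_lt_0_compat; [lra|apply Rdiv_lt_0_compat; lra].
    - apply Hrho. }
  assert (H2 : norm (circle_sum N rho ⊖ (INR N * rho) ⊙ F' 0%C) <= INR N * (4 * (eps / 8 * rho))).
  { apply (A_small N HNpos Hl0 (eps / 8) d0 rho); try assumption. lra. }
  assert (H3 : norm (circle_sum N s) <= INR N * (4 * K))
    by exact (A_bound N s (conj Hs Hm1)).
  set (As := circle_sum N s) in *. set (Ar := circle_sum N rho) in *.
  assert (Hml : INR m * lambda <= r / rho).
  { pose proof (poly m lambda Hl0) as H4.
    assert ((1 + lambda) ^ m <= r / rho); [|lra].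
    apply (Rmult_le_reg_r rho); [lra|]. replace (r / rho * rho) with r by (field; lra). exact Hm1. }
  assert (HK : 0 <= K).
  { eapply Rle_trans; [apply (norm_ge_0 (F 0%C))|]. apply (F_bound 0%C). rewrite Cmod_0. lra. }
  assert (G1 : norm (/ s ⊙ As ⊖ / rho ⊙ Ar) <= INR N * (eps / 2)).
  { eapply Rle_trans; [exact H1|]. apply Rmult_le_compat_l; [lra|].
    replace (eps / 2) with (8 * (eps / 16 * (rho / r)) * (r / rho)) by (field; lra).
    apply Rmult_le_compat_l; [|exact Hml].
    apply Rmult_le_pos; [lra|]. apply Rmult_le_pos; [lra|]. apply Rlt_le, Rdiv_lt_0_compat; lra. }
  assert (G2 : norm (/ rho ⊙ Ar ⊖ INR N ⊙ F' 0%C) <= INR N * (eps / 2)).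
  { replace (/ rho ⊙ Ar ⊖ INR N ⊙ F' 0%C) with (/ rho ⊙ (Ar ⊖ (INR N * rho) ⊙ F' 0%C))
      by (lin_field; lra).
    eapply Rle_trans; [apply norm_scal_le|].
    rewrite Rabs_right by (apply Rle_ge, Rlt_le, Rinv_0_lt_compat; lra).
    replace (INR N * (eps / 2)) with (/ rho * (INR N * (4 * (eps / 8 * rho)))) by (field; lra).
    apply Rmult_le_compat_l; [apply Rlt_le, Rinv_0_lt_compat; lra|exact H2]. }
  assert (G3 : norm (/ s ⊙ As) <= INR N * (8 * K / r)).
  { eapply Rle_trans; [apply norm_scal_le|].
    rewrite Rabs_right by (apply Rle_ge, Rlt_le, Rinv_0_lt_compat; lra).
    apply (Rmult_le_reg_l s); [lra|]. rewrite <- Rmult_assoc, Rinv_r, Rmult_1_l by lra.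
    eapply Rle_trans; [exact H3|].
    replace (s * (INR N * (8 * K / r))) with (INR N * (4 * K) * (2 * s / r)) by (field; lra).
    rewrite <- (Rmult_1_r (INR N * (4 * K))) at 1.
    apply Rmult_le_compat_l; [apply Rmult_le_pos; lra|].
    apply (Rmult_le_reg_r r); [lra|]. replace (2 * s / r * r) with (2 * s) by (field; lra).
    nra. }
  replace (F' 0%C) with (/ INR N ⊙ (INR N ⊙ F' 0%C)) by (lin_field; lra).
  eapply Rle_trans; [apply norm_scal_le|].
  rewrite Rabs_right by (apply Rle_ge, Rlt_le, Rinv_0_lt_compat; lra).
  apply (Rmult_le_reg_l (INR N)); [lra|]. rewrite <- Rmult_assoc, Rinv_r, Rmult_1_l by lra.
  pose proof (norm_le_add_minus (INR N ⊙ F' 0%C) (/ s ⊙ As)) as H5.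
  rewrite norm_minus_sym in G1, G2.
  pose proof (norm_minus_triangle (INR N ⊙ F' 0%C) (/ rho ⊙ Ar) (/ s ⊙ As)).
  lra.
Qed.

End Cauchy.

(** Differentiability in operator norm: delta does not depend on v. This is essential where T acts
    on a vector that moves with the same parameter, as in [transported_diff]. *)
Definition op_deriv {X : CompleteNormedModule R_AbsRing} (T : R -> X -> X) (t : R) (D : X -> X)
    : Prop :=
  forall eps, 0 < eps -> exists delta, 0 < delta /\
  forall r, 0 < r -> Rabs (r - t) < delta ->
  forall v, norm (T r v ⊖ T t v ⊖ (r - t) ⊙ D v) <= eps * Rabs (r - t) * norm v.

(** * Bounds for an analytic semigroup and its derivative *)

Section AnalyticBounds.

Context {X : CompleteNormedModule R_AbsRing}.
Notation E := (@XC X).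
Variables (T : R -> X -> X) (kappa : R) (Sg : C -> E -> E).
Hypothesis kappa_pos : 0 < kappa.
Hypothesis Sg_lin : forall z, sector kappa z -> bounded_Clinear (Sg z).
Hypothesis Sg_T : forall t, 0 < t -> forall p, Sg (RtoC t) p = (T t (fst p), T t (snd p)).
Hypothesis Sg_add : forall z w p, sector kappa z -> sector kappa w ->
  Sg (z + w)%C p = Sg z (Sg w p).
Hypothesis Sg_cont : forall p, filterlim (fun z => Sg z p)
  (within (sector kappa) (locally (RtoC 0))) (locally p).
Hypothesis Sg_hol : holomorphic_family kappa Sg.

Definition emb (v : X) : E := (v, vzero).

Lemma emb_linear : is_linear emb.
Proof.
  split.
  - intros x y. apply XC_ext; [reflexivity|].
    change (vzero = vzero ⊕ (vzero : X)). lin_eq.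
  - intros r x. apply XC_ext; [reflexivity|].
    change (vzero = r ⊙ (vzero : X)). lin_eq.
  - exists 1. split; [lra|]. intros x.
    eapply Rle_trans; [apply norm_le_fst_snd|]. cbn [emb fst snd]. rewrite norm_vzero. lra.
Qed.

Lemma norm_emb v : norm (emb v) <= norm v.
Proof.
  eapply Rle_trans; [apply norm_le_fst_snd|]. cbn [emb fst snd]. rewrite norm_vzero. lra.
Qed.

Lemma XC_decompose (p : E) : p = emb (fst p) ⊕ cscal Ci (emb (snd p)).
Proof.
  apply XC_ext; rewrite ?fst_plus, ?snd_plus, ?fst_cscal, ?snd_cscal; cbn [emb Re Im Ci fst snd];
  lin_eq.
Qed.

Lemma sector_real t : 0 < t -> sector kappa (RtoC t).
Proof.
  intros Ht. split; cbn; [exact Ht|]. rewrite Rabs_R0. apply Rmult_lt_0_compat; assumption.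
Qed.

Lemma sector_scale r z : 0 < r -> sector kappa z -> sector kappa (RtoC r * z)%C.
Proof.
  intros Hr [H1 H2]. unfold Re, Im in *. split; cbn.
  - rewrite Rmult_0_l, Rminus_0_r. apply Rmult_lt_0_compat; assumption.
  - rewrite Rmult_0_l, Rplus_0_r, Rmult_0_l, Rminus_0_r, Rabs_mult, (Rabs_right r) by lra. nra.
Qed.

Lemma Sg_linear z : sector kappa z -> is_linear (Sg z).
Proof. intros H. apply (Sg_lin z H). Qed.

Lemma Cmod_ball (eps : posreal) (z : C) : Cmod z < eps -> ball (RtoC 0) eps z.
Proof.
  intros H. pose proof (Rmax_Cmod z) as Hm.
  pose proof (Rmax_l (Rabs (fst z)) (Rabs (snd z))). pose proof (Rmax_r (Rabs (fst z)) (Rabs (snd z))).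
  split.
  - change (Rabs (fst z - 0) < eps). rewrite Rminus_0_r. lra.
  - change (Rabs (snd z - 0) < eps). rewrite Rminus_0_r. lra.
Qed.

(** Strong continuity at 0 in the sector bounds S(z) v near 0 for each v; uniform boundedness over
    the shrinking sets |z| < 1/(k+1) removes the dependence on v. It is applied on X, embedded as
    the real part, where completeness is at hand. *)
Lemma Sg_bound_near_0 : exists delta M, 0 < delta /\ 0 < M /\
  forall z v, sector kappa z -> Cmod z < delta -> norm (Sg z (emb v)) <= M * norm v.
Proof.
  destruct (uniform_boundedness (fun k z => sector kappa z /\ Cmod z < / INR (S k))
    (fun z v => Sg z (emb v))) as (k & M & HM & HMb).
  - intros k z [Hz1 Hz2]. split; [exact Hz1|]. eapply Rlt_le_trans; [exact Hz2|].
    apply Rinv_le_contravar; [apply lt_0_INR; lia|]. apply le_INR. lia.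
  - intros z [Hz _]. split.
    + intros x y. change (Sg z (emb (x ⊕ y)) = Sg z (emb x) ⊕ Sg z (emb y)).
      rewrite (lin_plus _ emb_linear), (lin_plus _ (Sg_linear z Hz)). reflexivity.
    + intros r x. change (Sg z (emb (r ⊙ x)) = r ⊙ Sg z (emb x)).
      rewrite (lin_scal _ emb_linear), (lin_scal _ (Sg_linear z Hz)). reflexivity.
    + destruct (linear_norm _ (Sg_linear z Hz)) as (M & HM & HMb).
      exists M. split; [exact HM|]. intros x. eapply Rle_trans; [apply HMb|].
      apply Rmult_le_compat_l; [lra|apply norm_emb].
  - intros v.
    destruct (proj1 (filterlim_locally_ball_norm (K := R_AbsRing) (fun z => Sg z (emb v)) (emb v))
      (Sg_cont (emb v)) (mkposreal 1 Rlt_0_1)) as (eps & Heps).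
    destruct (INR_unbounded (/ eps)) as (k & Hk).
    exists k, (norm v + 1). intros z [Hz1 Hz2].
    assert (Hb : ball (RtoC 0) eps z).
    { apply Cmod_ball. eapply Rlt_trans; [exact Hz2|].
      rewrite <- (Rinv_inv eps).
      apply Rinv_lt_contravar; [|rewrite S_INR; lra].
      pose proof (cond_pos eps). apply Rmult_lt_0_compat; [apply Rinv_0_lt_compat; lra|].
      apply lt_0_INR. lia. }
    specialize (Heps z Hb Hz1). change (norm (Sg z (emb v) ⊖ emb v) < 1) in Heps.
    pose proof (norm_le_add_minus (Sg z (emb v)) (emb v)). pose proof (norm_emb v). lra.
  - exists (/ INR (S k)), M. split; [apply Rinv_0_lt_compat, lt_0_INR; lia|].
    split; [exact HM|]. intros z v H1 H2. apply HMb. split; assumption.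
Qed.

Lemma Sg_bound_XC z M p : 0 < M -> sector kappa z ->
  (forall v, norm (Sg z (emb v)) <= M * norm v) -> norm (Sg z p) <= 5 * M * norm p.
Proof.
  intros HM Hz H. rewrite (XC_decompose p) at 1.
  rewrite (lin_plus _ (Sg_linear z Hz)), (proj2 (Sg_lin z Hz)).
  eapply Rle_trans; [apply norm_plus_le|].
  pose proof (norm_cscal_le Ci (Sg z (emb (snd p)))) as H1.
  replace (Cmod Ci) with 1 in H1.
  2: { unfold Cmod, Ci; cbn [fst snd]. replace (0 ^ 2 + 1 ^ 2) with 1 by ring. symmetry; apply sqrt_1. }
  pose proof (H (fst p)). pose proof (H (snd p)).
  assert (M * norm (fst p) <= M * norm p) by (apply Rmult_le_compat_l; [lra|apply norm_fst_le]).
  assert (M * norm (snd p) <= M * norm p) by (apply Rmult_le_compat_l; [lra|apply norm_snd_le]).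
  lra.
Qed.

(** A point z of the sector is m + 1 times a point w near 0 in the same direction, and S(z) is a
    power of S(w). *)
Lemma Sg_bound (rad : R) : exists M, 1 <= M /\
  forall z p, sector kappa z -> Cmod z <= rad -> norm (Sg z p) <= M * norm p.
Proof.
  destruct Sg_bound_near_0 as (delta & M0 & Hd & HM0 & HM).
  set (M := Rmax 1 (5 * M0)).
  assert (HM1 : 1 <= M) by apply Rmax_l.
  assert (HMs : forall z p, sector kappa z -> Cmod z < delta -> norm (Sg z p) <= M * norm p).
  { intros z p Hz Hz2. eapply Rle_trans.
    - apply (Sg_bound_XC z M0 p HM0 Hz). intros v. apply HM; assumption.
    - apply Rmult_le_compat_r; [apply norm_ge_0|apply Rmax_r]. }
  destruct (INR_unbounded (rad / delta)) as (m & Hm).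
  assert (HmS : rad < INR (S m) * delta).
  { rewrite S_INR. apply (Rmult_lt_compat_r delta) in Hm; [|exact Hd].
    replace (rad / delta * delta) with rad in Hm by (field; lra). lra. }
  exists (M ^ S m). split; [apply pow_R1_Rle, HM1|]. intros z p Hz Hzr.
  set (w := (RtoC (/ INR (S m)) * z)%C).
  assert (HSm : 0 < INR (S m)) by (apply lt_0_INR; lia).
  assert (Hw : sector kappa w) by (apply sector_scale; [apply Rinv_0_lt_compat|]; assumption).
  assert (Hwd : Cmod w < delta).
  { unfold w. rewrite Cmod_mult, Cmod_R, Rabs_right by (apply Rle_ge, Rlt_le, Rinv_0_lt_compat; lra).
    apply (Rmult_lt_reg_l (INR (S m))); [exact HSm|].
    rewrite <- Rmult_assoc, Rinv_r by lra. lra. }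
  assert (Hk : forall k, norm (Sg (RtoC (INR (S k)) * w)%C p) <= M ^ S k * norm p).
  { induction k as [|k IH].
    - simpl INR. rewrite Cmult_1_l. rewrite pow_1. apply HMs; assumption.
    - replace (RtoC (INR (S (S k))) * w)%C with (w + RtoC (INR (S k)) * w)%C
        by (rewrite (S_INR (S k)), RtoC_plus; ring).
      rewrite Sg_add; [|exact Hw|apply sector_scale; [apply lt_0_INR; lia|exact Hw]].
      eapply Rle_trans; [apply HMs; assumption|].
      replace (M ^ S (S k) * norm p) with (M * (M ^ S k * norm p)) by (simpl; ring).
      apply Rmult_le_compat_l; [lra|exact IH]. }
  specialize (Hk m). replace (RtoC (INR (S m)) * w)%C with z in Hk; [exact Hk|].
  unfold w. rewrite Cmult_assoc, <- RtoC_mult, Rinv_r, Cmult_1_l by lra. reflexivity.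
Qed.

Lemma sector_ball (b : R) (z : C) : 0 < b -> Cmod z < Rmin kappa 1 * (b / 2) ->
  sector kappa (RtoC b + z)%C.
Proof.
  intros Hb Hz. pose proof (Rmax_Cmod z).
  pose proof (Rmax_l (Rabs (fst z)) (Rabs (snd z))). pose proof (Rmax_r (Rabs (fst z)) (Rabs (snd z))).
  pose proof (Rmin_l kappa 1). pose proof (Rmin_r kappa 1).
  assert (Rmin kappa 1 * (b / 2) <= kappa * (b / 2)) by (apply Rmult_le_compat_r; lra).
  assert (Rmin kappa 1 * (b / 2) <= 1 * (b / 2)) by (apply Rmult_le_compat_r; lra).
  assert (Hfst : - (b / 2) < fst z) by (assert (Hf : Rabs (fst z) < b / 2) by lra; apply Rabs_def2 in Hf; lra).
  unfold sector, Re, Im; cbn. split; [lra|]. rewrite Rplus_0_l.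
  apply Rle_lt_trans with (kappa * (b / 2)); [lra|].
  apply Rmult_lt_compat_l; [exact kappa_pos|lra].
Qed.

(** S(t1 + w + z) = S(t1 + w) S(z): the derivative at the single point t1 yields one at every point
    t1 + z, with the same delta and an error relative to the norm of S(z) p. *)
Lemma Sg_uniform_deriv (t1 : R) : 0 < t1 -> exists D1, bounded_Clinear D1 /\
  forall eps, 0 < eps -> exists delta, 0 < delta /\
  forall z w p, sector kappa z -> Cmod w < delta ->
  norm (Sg (RtoC t1 + w + z)%C p ⊖ Sg (RtoC t1 + z)%C p ⊖ cscal w (D1 (Sg z p)))
  <= eps * Cmod w * norm (Sg z p).
Proof.
  intros Ht1. destruct (Sg_hol (RtoC t1) (sector_real t1 Ht1)) as (D1 & HD1 & Hd).
  exists D1. split; [exact HD1|]. intros eps He.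
  destruct (Hd eps He) as (d & Hd0 & Hdd).
  assert (Hk : 0 < Rmin kappa 1 * (t1 / 2)).
  { apply Rmult_lt_0_compat; [apply Rmin_glb_lt|]; lra. }
  exists (Rmin d (Rmin kappa 1 * (t1 / 2))). split; [apply Rmin_glb_lt; lra|].
  intros z w p Hz Hw.
  assert (Hw1 : Cmod w < d) by (eapply Rlt_le_trans; [exact Hw|apply Rmin_l]).
  assert (Hw2 : sector kappa (RtoC t1 + w)%C).
  { apply sector_ball; [exact Ht1|]. eapply Rlt_le_trans; [exact Hw|apply Rmin_r]. }
  rewrite (Sg_add (RtoC t1 + w)%C z) by assumption.
  rewrite (Sg_add (RtoC t1) z) by (assumption || apply sector_real, Ht1).
  assert (Ew : (RtoC t1 + w - RtoC t1 = w)%C) by ring.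
  pose proof (Hdd (RtoC t1 + w)%C Hw2) as H1. rewrite Ew in H1. exact (H1 Hw1 (Sg z p)).
Qed.

(** Cauchy's estimate on the disc about t of radius r = k t/4, whose size is proportional to t,
    gives 8 M / r = (32 M / k) / t. Only t1 = t/4 is used for differentiating; the disc about the
    rest 3t/4 still lies in the sector, as [quotient_close] requires. *)
Lemma semigroup_deriv (H : R) : 0 < H -> exists C, 0 <= C /\
  forall t, 0 < t <= H -> exists D, is_linear D /\ op_deriv T t D /\
  forall v, norm (D v) <= C / t * norm v.
Proof.
  intros HH. destruct (Sg_bound (2 * H)) as (M & HM & HMb).
  set (k := Rmin kappa 1).
  assert (Hk : 0 < k <= 1) by (split; [apply Rmin_glb_lt; lra|apply Rmin_r]).
  exists (32 * M / k). split; [apply Rlt_le, Rdiv_lt_0_compat; lra|].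
  intros t Ht. set (t1 := t / 4). set (r := k * (t / 4)).
  assert (Hr : 0 < r <= t / 4) by (unfold r; split; [apply Rmult_lt_0_compat; lra|nra]).
  destruct (Sg_uniform_deriv t1) as (D1 & HD1 & Hd); [unfold t1; lra|].
  assert (Hsec : forall z b, 3 / 4 * t <= b -> Cmod z <= r -> sector kappa (RtoC b + z)%C).
  { intros z b Hb Hz. apply sector_ball; [lra|]. fold k. unfold r in Hz. nra. }
  assert (Hbd : forall z b p, 3 / 4 * t <= b <= t -> Cmod z <= r ->
    norm (Sg (RtoC b + z)%C p) <= M * norm p).
  { intros z b p Hb Hz. apply HMb; [apply Hsec; lra|].
    eapply Rle_trans; [apply Cmod_triangle|]. rewrite Cmod_R, Rabs_right; lra. }
  assert (Hunif : forall eps, 0 < eps -> exists delta, 0 < delta /\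
    forall z w p, Cmod z <= r -> Cmod w < delta ->
    norm (Sg (RtoC t + z + w)%C p ⊖ Sg (RtoC t + z)%C p
      ⊖ cscal w (D1 (Sg (RtoC (t - t1) + z)%C p))) <= eps * Cmod w * (M * norm p)).
  { intros eps He. destruct (Hd eps He) as (d & Hd0 & Hdd). exists d. split; [exact Hd0|].
    intros z w p Hz Hw. specialize (Hdd (RtoC (t - t1) + z)%C w p).
    replace (RtoC t1 + w + (RtoC (t - t1) + z))%C with (RtoC t + z + w)%C in Hdd
      by (rewrite RtoC_minus; ring).
    replace (RtoC t1 + (RtoC (t - t1) + z))%C with (RtoC t + z)%C in Hdd
      by (rewrite RtoC_minus; ring).
    eapply Rle_trans; [apply Hdd; [apply Hsec; unfold t1; lra|exact Hw]|].
    apply Rmult_le_compat_l; [apply Rmult_le_pos; [lra|apply Cmod_ge_0]|].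
    apply Hbd; [unfold t1; lra|exact Hz]. }
  assert (Hst : sector kappa (RtoC (t - t1))) by (apply sector_real; unfold t1; lra).
  assert (HDl : forall p, norm (D1 (Sg (RtoC (t - t1)) p)) <= 32 * M / k / t * norm p).
  { intros p.
    pose proof (cauchy_estimate (fun z => Sg (RtoC t + z)%C p)
      (fun z => D1 (Sg (RtoC (t - t1) + z)%C p)) r (M * norm p) (proj1 Hr)) as Hc.
    cbv beta in Hc. rewrite Cplus_0_r in Hc.
    replace (32 * M / k / t * norm p) with (8 * (M * norm p) / r) by (unfold r; field; lra).
    apply Hc.
    - intros z Hz. apply Hbd; [lra|exact Hz].
    - intros eps He. pose proof (norm_ge_0 p) as Hp.
      assert (HMp : 0 < M * norm p + 1) by (assert (0 <= M * norm p) by (apply Rmult_le_pos; lra); lra).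
      destruct (Hunif (eps / (M * norm p + 1))) as (d & Hd0 & Hdd).
      { apply Rdiv_lt_0_compat; assumption. }
      exists d. split; [exact Hd0|]. intros z w Hz _ Hw.
      rewrite Cplus_assoc. eapply Rle_trans; [apply Hdd; assumption|].
      apply Rle_trans with (eps / (M * norm p + 1) * Cmod w * (M * norm p + 1)).
      + apply Rmult_le_compat_l; [|lra].
        apply Rmult_le_pos; [apply Rlt_le, Rdiv_lt_0_compat; assumption|apply Cmod_ge_0].
      + right. field. lra. }
  exists (fun v => fst (D1 (Sg (RtoC (t - t1)) (emb v)))).
  assert (Hbound : forall v, norm (fst (D1 (Sg (RtoC (t - t1)) (emb v)))) <= 32 * M / k / t * norm v).
  { intros v. eapply Rle_trans; [apply norm_fst_le|]. eapply Rle_trans; [apply HDl|].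
    apply Rmult_le_compat_l; [|apply norm_emb].
    apply Rlt_le. do 2 (apply Rdiv_lt_0_compat; [|lra]). lra. }
  split; [|split; [|exact Hbound]].
  - destruct HD1 as [HD1 _]. split.
    + intros x y.
      change (fst (D1 (Sg (RtoC (t - t1)) (emb (x ⊕ y)))) =
        fst (D1 (Sg (RtoC (t - t1)) (emb x))) ⊕ fst (D1 (Sg (RtoC (t - t1)) (emb y)))).
      rewrite (lin_plus _ emb_linear), (lin_plus _ (Sg_linear _ Hst)), (lin_plus _ HD1). reflexivity.
    + intros a x.
      change (fst (D1 (Sg (RtoC (t - t1)) (emb (a ⊙ x)))) = a ⊙ fst (D1 (Sg (RtoC (t - t1)) (emb x)))).
      rewrite (lin_scal _ emb_linear), (lin_scal _ (Sg_linear _ Hst)), (lin_scal _ HD1). reflexivity.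
    + exists (32 * M / k / t). split; [|exact Hbound].
      do 2 (apply Rdiv_lt_0_compat; [|lra]). lra.
  - intros eps He. destruct (Hunif (eps / M)) as (d & Hd0 & Hdd).
    { apply Rdiv_lt_0_compat; lra. }
    exists d. split; [exact Hd0|]. intros s Hs Hst' v.
    specialize (Hdd (RtoC 0) (RtoC (s - t)) (emb v)).
    rewrite Cmod_0, Cmod_R, !Cplus_0_r, <- RtoC_plus in Hdd.
    replace (t + (s - t)) with s in Hdd by ring.
    rewrite !Sg_T, cscal_real in Hdd by lra.
    eapply Rle_trans.
    { eapply Rle_trans; [|apply Hdd; [lra|exact Hst']].
      exact (norm_fst_le ((T s v, T s vzero) ⊖ (T t v, T t vzero)
        ⊖ (s - t) ⊙ D1 (Sg (RtoC (t - t1)) (emb v)))). }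
    replace (eps / M * Rabs (s - t) * (M * norm (emb v))) with (eps * Rabs (s - t) * norm (emb v))
      by (field; lra).
    apply Rmult_le_compat_l; [|apply norm_emb].
    apply Rmult_le_pos; [lra|apply Rabs_pos].
Qed.

Lemma semigroup_bound (H : R) : 0 < H -> exists M, 1 <= M /\
  forall t v, 0 < t <= H -> norm (T t v) <= M * norm v.
Proof.
  intros HH. destruct (Sg_bound H) as (M & HM & HMb). exists M. split; [exact HM|].
  intros t v Ht. specialize (HMb (RtoC t) (emb v) (sector_real t (proj1 Ht))).
  rewrite Cmod_R, Rabs_right, Sg_T in HMb by lra.
  eapply Rle_trans; [exact (norm_fst_le (T t v, T t vzero))|].
  eapply Rle_trans; [apply HMb; lra|]. apply Rmult_le_compat_l; [lra|apply norm_emb].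
Qed.

End AnalyticBounds.

Lemma analytic_semigroup_estimates {X : CompleteNormedModule R_AbsRing} (T : R -> X -> X) :
  analytic_semigroup T -> forall H, 0 < H -> exists M C, 1 <= M /\ 0 <= C /\
  (forall t v, 0 <= t <= H -> norm (T t v) <= M * norm v) /\
  (forall t, 0 < t <= H -> exists D, is_linear D /\ op_deriv T t D /\
     forall v, norm (D v) <= C / t * norm v).
Proof.
  intros [(_ & HT0 & _) (kappa & Hk & Sg & H1 & H2 & H3 & H4 & H5)] H HH.
  destruct (semigroup_bound T kappa Sg Hk H1 H2 H3 H4 H HH) as (M & HM & HMb).
  destruct (semigroup_deriv T kappa Sg Hk H1 H2 H3 H4 H5 H HH) as (C & HC & HCb).
  exists M, C. split; [exact HM|]. split; [exact HC|]. split; [|exact HCb].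
  intros t v Ht. destruct (Req_dec t 0) as [->|Hne].
  - rewrite HT0. pose proof (norm_ge_0 v). nra.
  - apply HMb. lra.
Qed.

(** * Continuity, differentiation and integration of vector-valued functions *)

Section Calculus.

Context {X : CompleteNormedModule R_AbsRing}.
Implicit Types (y : R -> X) (v x : X).

Lemma continuous_eps y s :
  (forall eps, 0 < eps -> exists delta, 0 < delta /\
    forall r, Rabs (r - s) < delta -> norm (y r ⊖ y s) <= eps) ->
  continuous y s.
Proof.
  intros H.
  apply (proj2 (filterlim_locally_ball_norm (K := R_AbsRing) (F := locally s) y (y s))).
  intros eps. destruct (H (eps / 2)) as (d & Hd & Hdd).
  { pose proof (cond_pos eps). lra. }
  exists (mkposreal d Hd). intros r Hr. change (norm (y r ⊖ y s) < eps).
  specialize (Hdd r Hr). pose proof (cond_pos eps). lra.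
Qed.

(** Composition with the clamp extends a function on [a, b] by its end values. One-sided continuity
    at the ends thus becomes continuity on the line, as integration needs it. *)
Definition clamp (a b s : R) : R := Rmax a (Rmin b s).

Lemma clamp_in a b s : a <= b -> a <= clamp a b s <= b.
Proof.
  intros H. unfold clamp. split; [apply Rmax_l|]. apply Rmax_lub; [exact H|apply Rmin_l].
Qed.

Lemma clamp_id a b s : a <= s <= b -> clamp a b s = s.
Proof. intros H. unfold clamp. rewrite Rmin_right, Rmax_right; lra. Qed.

Lemma clamp_lipschitz a b r s : Rabs (clamp a b r - clamp a b s) <= Rabs (r - s).
Proof.
  unfold clamp, Rmax, Rmin. repeat destruct (Rle_dec _ _); unfold Rabs;
    repeat destruct (Rcase_abs _); lra.
Qed.

Lemma continuous_clamp a b y : a <= b ->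
  (forall s, a <= s <= b -> cont_in a b y s) -> forall s, continuous (fun s => y (clamp a b s)) s.
Proof.
  intros Hab Hc s. apply continuous_eps. intros eps He.
  destruct (Hc (clamp a b s) (clamp_in a b s Hab) eps He) as (d & Hd & Hdd).
  exists d. split; [exact Hd|]. intros r Hr. apply Hdd; [apply clamp_in, Hab|].
  eapply Rle_lt_trans; [apply clamp_lipschitz|exact Hr].
Qed.

Lemma is_derive_diff_in a b y s l : is_derive y s l -> diff_in a b y s l.
Proof.
  intros [_ H] eps He.
  destruct (H s (fun P HP => HP) (mkposreal eps He)) as (d & Hd).
  exists d. split; [apply cond_pos|]. intros r _ Hr. exact (Hd r Hr).
Qed.

Lemma diff_in_primitive (g : R -> X) a b c s : (forall r, continuous g r) ->
  diff_in a b (fun t => RInt g c t) s (g s).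
Proof.
  intros Hg. apply is_derive_diff_in.
  apply (is_derive_RInt g (fun t => RInt g c t) c s); [|apply Hg].
  apply filter_forall. intros t. apply (RInt_correct g c t).
  apply (ex_RInt_continuous g). intros z _. apply Hg.
Qed.

Lemma diff_in_minus a b y1 y2 s l1 l2 : diff_in a b y1 s l1 -> diff_in a b y2 s l2 ->
  diff_in a b (fun r => y1 r ⊖ y2 r) s (l1 ⊖ l2).
Proof.
  intros H1 H2 eps He.
  destruct (H1 (eps / 2)) as (d1 & Hd1 & G1); [lra|].
  destruct (H2 (eps / 2)) as (d2 & Hd2 & G2); [lra|].
  exists (Rmin d1 d2). split; [apply Rmin_glb_lt; assumption|]. intros r Hr Hrs.
  specialize (G1 r Hr (Rlt_le_trans _ _ _ Hrs (Rmin_l _ _))).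
  specialize (G2 r Hr (Rlt_le_trans _ _ _ Hrs (Rmin_r _ _))).
  replace (y1 r ⊖ y2 r ⊖ (y1 s ⊖ y2 s) ⊖ (r - s) ⊙ (l1 ⊖ l2)) with
    ((y1 r ⊖ y1 s ⊖ (r - s) ⊙ l1) ⊖ (y2 r ⊖ y2 s ⊖ (r - s) ⊙ l2)) by lin_eq.
  eapply Rle_trans; [apply norm_minus_le|]. lra.
Qed.

Lemma diff_in_scal a b (p : R -> R) dp s v : derivable_pt_lim p s dp ->
  diff_in a b (fun r => p r ⊙ v) s (dp ⊙ v).
Proof.
  intros H eps He. pose proof (norm_ge_0 v) as Hv.
  destruct (H (eps / (norm v + 1))) as (d & Hd).
  { apply Rdiv_lt_0_compat; lra. }
  exists d. split; [apply cond_pos|]. intros r _ Hr.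
  destruct (Req_dec r s) as [->|Hne].
  - replace (p s ⊙ v ⊖ p s ⊙ v ⊖ (s - s) ⊙ (dp ⊙ v)) with (vzero : X) by lin_eq.
    rewrite norm_vzero. apply Rmult_le_pos; [lra|apply Rabs_pos].
  - specialize (Hd (r - s) (ltac:(lra)) Hr). replace (s + (r - s)) with r in Hd by ring.
    replace (p r ⊙ v ⊖ p s ⊙ v ⊖ (r - s) ⊙ (dp ⊙ v)) with
      (((p r - p s) / (r - s) - dp) * (r - s) ⊙ v) by (lin_field; lra).
    eapply Rle_trans; [apply norm_scal_le|]. rewrite Rabs_mult.
    apply Rle_trans with (eps / (norm v + 1) * Rabs (r - s) * (norm v + 1)).
    + apply Rmult_le_compat; [|exact Hv| |lra].
      * apply Rmult_le_pos; apply Rabs_pos.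
      * apply Rmult_le_compat_r; [apply Rabs_pos|lra].
    + right. field. lra.
Qed.

Lemma cont_in_minus a b y1 y2 s : cont_in a b y1 s -> cont_in a b y2 s ->
  cont_in a b (fun r => y1 r ⊖ y2 r) s.
Proof.
  intros H1 H2 eps He.
  destruct (H1 (eps / 2)) as (d1 & Hd1 & G1); [lra|].
  destruct (H2 (eps / 2)) as (d2 & Hd2 & G2); [lra|].
  exists (Rmin d1 d2). split; [apply Rmin_glb_lt; assumption|]. intros r Hr Hrs.
  specialize (G1 r Hr (Rlt_le_trans _ _ _ Hrs (Rmin_l _ _))).
  specialize (G2 r Hr (Rlt_le_trans _ _ _ Hrs (Rmin_r _ _))).
  replace (y1 r ⊖ y2 r ⊖ (y1 s ⊖ y2 s)) with ((y1 r ⊖ y1 s) ⊖ (y2 r ⊖ y2 s)) by lin_eq.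
  eapply Rle_trans; [apply norm_minus_le|]. lra.
Qed.

Lemma is_RInt_lin (L : X -> X) (g : R -> X) a b l : is_linear L ->
  is_RInt g a b l -> is_RInt (fun t => L (g t)) a b (L l).
Proof.
  intros HL Hg. unfold is_RInt in *.
  assert (HLR : forall ptd, Riemann_sum (fun t => L (g t)) ptd = L (Riemann_sum g ptd)).
  { intros ptd. apply (SF_cons_ind (T := R) (fun ptd =>
      Riemann_sum (fun t => L (g t)) ptd = L (Riemann_sum g ptd))).
    - intros x0. symmetry. apply (lin_zero L HL).
    - intros h s IH. rewrite !Riemann_sum_cons, IH.
      change ((SF_h s - fst h) ⊙ L (g (snd h)) ⊕ L (Riemann_sum g s) =
        L ((SF_h s - fst h) ⊙ g (snd h) ⊕ Riemann_sum g s)).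
      rewrite (lin_plus L HL), (lin_scal L HL). reflexivity. }
  apply (filterlim_ext (fun ptd => L (scal (sign (b - a)) (Riemann_sum g ptd)))).
  { intros ptd. rewrite HLR. apply (lin_scal L HL). }
  apply (filterlim_comp _ _ _ _ L _ (locally l) _ Hg).
  apply (proj2 (filterlim_locally_ball_norm (K := R_AbsRing) (F := locally l) L (L l))).
  intros eps. destruct (linear_norm L HL) as (M & HM & HMb).
  assert (He : 0 < eps / M) by (apply Rdiv_lt_0_compat; [apply cond_pos|exact HM]).
  apply (locally_le_locally_norm (V := CompleteNormedModule.NormedModule R_AbsRing X) l).
  exists (mkposreal _ He). intros z Hz. change (norm (z ⊖ l) < eps / M) in Hz.
  change (norm (L z ⊖ L l) < eps). rewrite <- (lin_minus L HL).
  eapply Rle_lt_trans; [apply HMb|].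
  apply (Rmult_lt_compat_l M) in Hz; [|exact HM].
  replace (M * (eps / M)) with (pos eps) in Hz by (field; lra). exact Hz.
Qed.

End Calculus.

(** * The semigroup and the operators phi_k *)

Record semigroup_bounds {X : CompleteNormedModule R_AbsRing} (T : R -> X -> X) (H M C : R)
    : Prop := {
  sg_H : 0 < H;
  sg_M : 1 <= M;
  sg_C : 0 <= C;
  sg_lin : forall t, 0 <= t -> is_linear (T t);
  sg_0 : forall x, T 0 x = x;
  sg_add : forall t r x, 0 <= t -> 0 <= r -> T (t + r) x = T t (T r x);
  sg_cont0 : forall x eps, 0 < eps -> exists delta, 0 < delta /\
    forall t, 0 <= t < delta -> norm (T t x ⊖ x) <= eps;
  sg_bound : forall t v, 0 <= t <= H -> norm (T t v) <= M * norm v;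
  sg_deriv : forall t, 0 < t <= H -> exists D, is_linear D /\ op_deriv T t D /\
    forall v, norm (D v) <= C / t * norm v }.

Lemma analytic_semigroup_bounds {X : CompleteNormedModule R_AbsRing} (T : R -> X -> X) (H : R) :
  analytic_semigroup T -> 0 < H -> exists M C, semigroup_bounds T H M C.
Proof.
  intros HT HH. destruct (analytic_semigroup_estimates T HT H HH) as (M & C & HM & HC & Hb & Hd).
  exists M, C. destruct HT as [(H1 & H2 & H3 & H4) _]. split; try assumption.
  intros x eps He.
  destruct (proj1 (filterlim_locally_ball_norm (K := R_AbsRing) (fun t => T t x) x)
    (H4 x) (mkposreal eps He)) as (d & Hd0).
  exists d. split; [apply cond_pos|]. intros t Ht.
  destruct (Req_dec t 0) as [->|Hne].
  - rewrite H2, norm_minus_self. lra.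
  - left. apply (Hd0 t).
    + change (Rabs (t - 0) < d). rewrite Rabs_right; lra.
    + lra.
Qed.

Section Semigroup.

Context {X : CompleteNormedModule R_AbsRing}.
Context {T : R -> X -> X} {H M C : R} (HT : semigroup_bounds T H M C).
Implicit Types (v x z : X).

Let H_pos := sg_H _ _ _ _ HT.
Let M_ge_1 := sg_M _ _ _ _ HT.
Let C_ge_0 := sg_C _ _ _ _ HT.

Lemma op_deriv_diff_in t D v a b : 0 < t -> op_deriv T t D -> diff_in a b (fun s => T s v) t (D v).
Proof.
  intros Ht HD eps He. pose proof (norm_ge_0 v) as Hv.
  destruct (HD (eps / (norm v + 1))) as (d & Hd & Hdd).
  { apply Rdiv_lt_0_compat; lra. }
  exists (Rmin d t). split; [apply Rmin_glb_lt; assumption|]. intros r _ Hr.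
  assert (Hr1 : Rabs (r - t) < d) by (eapply Rlt_le_trans; [exact Hr|apply Rmin_l]).
  assert (Hr2 : Rabs (r - t) < t) by (eapply Rlt_le_trans; [exact Hr|apply Rmin_r]).
  apply Rabs_def2 in Hr2.
  eapply Rle_trans; [apply Hdd; [lra|exact Hr1]|].
  apply Rle_trans with (eps / (norm v + 1) * Rabs (r - t) * (norm v + 1)).
  - apply Rmult_le_compat_l; [|lra].
    apply Rmult_le_pos; [apply Rlt_le, Rdiv_lt_0_compat; lra|apply Rabs_pos].
  - right. field. lra.
Qed.

Lemma sg_cont_in v t : 0 <= t <= H -> cont_in 0 H (fun s => T s v) t.
Proof.
  intros Ht. destruct (Req_dec t 0) as [->|Hne].
  - intros eps He. destruct (sg_cont0 _ _ _ _ HT v eps He) as (d & Hd & Hdd).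
    exists d. split; [exact Hd|]. intros r Hr Hr0.
    rewrite (sg_0 _ _ _ _ HT). apply Hdd. rewrite Rminus_0_r, Rabs_right in Hr0; lra.
  - destruct (sg_deriv _ _ _ _ HT t) as (D & _ & HD & _); [lra|].
    eapply diff_in_cont. apply op_deriv_diff_in; [lra|exact HD].
Qed.

Lemma sg_lipschitz t s v : 0 < t -> 0 <= s -> t + s <= H ->
  norm (T (t + s) v ⊖ T t v) <= C / t * norm v * s.
Proof.
  intros Ht Hs Hts. replace s with (t + s - t) at 2 by ring.
  apply (mean_value_diff t (t + s) _ (fun r => T r v)); [lra|].
  intros r Hr. destruct (sg_deriv _ _ _ _ HT r) as (D & _ & HD & HDb); [lra|].
  exists (D v). split.
  - eapply Rle_trans; [apply HDb|]. apply Rmult_le_compat_r; [apply norm_ge_0|].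
    unfold Rdiv. apply Rmult_le_compat_l; [exact C_ge_0|].
    apply Rinv_le_contravar; lra.
  - apply op_deriv_diff_in; [lra|exact HD].
Qed.

(** From T(t + s) = T(t) T(s). A single operator D, taken at one time, thereby describes the
    derivative at all later times. *)
Lemma op_deriv_shift t s D : 0 < t -> 0 <= s -> s <= H -> op_deriv T t D ->
  op_deriv T (t + s) (fun v => D (T s v)).
Proof.
  intros Ht Hs HsH HD eps He. destruct (HD (eps / M)) as (d & Hd & Hdd).
  { apply Rdiv_lt_0_compat; lra. }
  exists (Rmin d t). split; [apply Rmin_glb_lt; assumption|]. intros r _ Hr v.
  assert (Hr1 : Rabs (r - (t + s)) < d) by (eapply Rlt_le_trans; [exact Hr|apply Rmin_l]).
  assert (Hr2 : Rabs (r - (t + s)) < t) by (eapply Rlt_le_trans; [exact Hr|apply Rmin_r]).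
  apply Rabs_def2 in Hr2.
  replace r with (r - s + s) at 1 by ring. rewrite !(sg_add _ _ _ _ HT) by lra.
  specialize (Hdd (r - s) (ltac:(lra))). replace (r - s - t) with (r - (t + s)) in Hdd by ring.
  eapply Rle_trans; [apply Hdd, Hr1|].
  replace (eps * Rabs (r - (t + s)) * norm v) with
    (eps / M * Rabs (r - (t + s)) * (M * norm v)) by (field; lra).
  apply Rmult_le_compat_l.
  - apply Rmult_le_pos; [apply Rlt_le, Rdiv_lt_0_compat; lra|apply Rabs_pos].
  - apply (sg_bound _ _ _ _ HT). lra.
Qed.

(* This second-order estimate makes the sums over the time steps below
   converge without a logarithm. *)
Lemma sg_second_difference t h s v : 0 < t -> 0 < h -> t + h <= H -> 0 <= s <= 1 ->
  norm (T (t + s * h) v ⊖ T t v ⊖ s ⊙ (T (t + h) v ⊖ T t v))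
  <= 8 * C ^ 2 * (h / t) ^ 2 * norm v.
Proof.
  intros Ht Hh Hth Hs.
  destruct (sg_deriv _ _ _ _ HT (t / 2)) as (D & HDl & HD & HDb); [lra|].
  (* D is A T(t/2) and l is A T(t) v. The derivative of T(t + r) v - r l is D applied to T(t/2 + r)
     v - T(t/2) v, so two bounds of size C/(t/2) multiply. One bounds D, the other the increment of
     the semigroup. *)
  set (l := D (T (t / 2) v)).
  assert (Hy : forall q, 0 <= q <= h ->
    norm (T (t + q) v ⊖ T t v ⊖ q ⊙ l) <= 4 * C ^ 2 * (h / t) ^ 2 * norm v).
  { intros q Hq.
    pose proof (mean_value_diff 0 q (C / (t / 2) * (C / (t / 2) * norm v * h))
      (fun r => T (t + r) v ⊖ r ⊙ l) (proj1 Hq)) as Hm.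
    cbv beta in Hm. rewrite Rplus_0_r, Rminus_0_r in Hm.
    replace (T (t + q) v ⊖ T t v ⊖ q ⊙ l) with (T (t + q) v ⊖ q ⊙ l ⊖ (T t v ⊖ 0 ⊙ l)) by lin_eq.
    eapply Rle_trans; [apply Hm|].
    - intros r Hr. exists (D (T (t / 2 + r) v) ⊖ l). split.
      + unfold l. rewrite <- (lin_minus D HDl). eapply Rle_trans; [apply HDb|].
        apply Rmult_le_compat_l.
        { apply Rmult_le_pos; [exact C_ge_0|]. apply Rlt_le, Rinv_0_lt_compat. lra. }
        eapply Rle_trans; [apply sg_lipschitz; lra|].
        apply Rmult_le_compat_l; [|lra]. apply Rmult_le_pos; [|apply norm_ge_0].
        apply Rmult_le_pos; [exact C_ge_0|]. apply Rlt_le, Rinv_0_lt_compat. lra.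
      + apply diff_in_minus.
        * assert (HDr : op_deriv T (t + r) (fun v => D (T (t / 2 + r) v))).
          { replace (t + r) with (t / 2 + (t / 2 + r)) by field.
            apply op_deriv_shift; [lra|lra|lra|exact HD]. }
          intros eps He.
          destruct (op_deriv_diff_in (t + r) (fun v => D (T (t / 2 + r) v)) v t (t + q) (Rplus_lt_le_0_compat t r Ht (proj1 Hr)) HDr eps He)
            as (d & Hd & Hdd).
          exists d. split; [exact Hd|]. intros r' Hr' Hrr.
          specialize (Hdd (t + r') (ltac:(lra))).
          replace (t + r' - (t + r)) with (r' - r) in Hdd by ring. exact (Hdd Hrr).
        * intros eps He. exists 1. split; [lra|]. intros r' _ _.
          replace (r' ⊙ l ⊖ r ⊙ l ⊖ (r' - r) ⊙ l) with (vzero : X) by lin_eq.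
          rewrite norm_vzero. apply Rmult_le_pos; [lra|apply Rabs_pos].
    - replace (4 * C ^ 2 * (h / t) ^ 2 * norm v) with
        (C / (t / 2) * (C / (t / 2) * norm v * h) * h) by (field; lra).
      apply Rmult_le_compat_l; [|lra].
      assert (Hc0 : 0 <= C / (t / 2)).
      { apply Rmult_le_pos; [exact C_ge_0|]. apply Rlt_le, Rinv_0_lt_compat. lra. }
      pose proof (norm_ge_0 v). clear Hm HDb. generalize dependent (C / (t / 2)). intros c0 Hc0. repeat apply Rmult_le_pos; lra. }
  replace (T (t + s * h) v ⊖ T t v ⊖ s ⊙ (T (t + h) v ⊖ T t v)) with
    ((T (t + s * h) v ⊖ T t v ⊖ (s * h) ⊙ l) ⊖ s ⊙ (T (t + h) v ⊖ T t v ⊖ h ⊙ l)) by lin_eq.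
  eapply Rle_trans; [apply norm_minus_le|].
  assert (G1 : 0 <= s * h <= h) by nra.
  pose proof (Hy (s * h) G1). pose proof (Hy h (ltac:(lra))) as G3.
  pose proof (norm_scal_le s (T (t + h) v ⊖ T t v ⊖ h ⊙ l)) as G4.
  rewrite (Rabs_right s) in G4 by lra.
  pose proof (norm_ge_0 (T (t + h) v ⊖ T t v ⊖ h ⊙ l)).
  assert (s * norm (T (t + h) v ⊖ T t v ⊖ h ⊙ l) <= 1 * norm (T (t + h) v ⊖ T t v ⊖ h ⊙ l))
    by (apply Rmult_le_compat_r; lra).
  lra.
Qed.

(** In this order: the summand j = 0, the sum of 8 C^2 / j^2 over j >= 1, and the telescoped
    comparison terms. *)
Definition sum_const : R := 4 * M + 16 * C ^ 2 + 2 * M.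

Lemma sum_difference_bound (m : nat) h s v : 0 < h -> INR m * h <= H -> 0 <= s <= 1 ->
  norm (vsum m (fun j => T (INR j * h) (T (s * h) v ⊖ v))) <= sum_const * norm v.
Proof.
  intros Hh Hmh Hs. destruct m as [|m].
  { simpl. rewrite norm_vzero. apply Rmult_le_pos; [|apply norm_ge_0].
    unfold sum_const. pose proof (pow2_ge_0 C). lra. }
  set (d := fun j => T (INR j * h + s * h) v ⊖ T (INR j * h) v
    ⊖ s ⊙ (T (INR j * h + h) v ⊖ T (INR j * h) v)).
  pose proof (norm_ge_0 v) as Hv.
  assert (HjH : forall j, (j <= m)%nat -> 0 <= INR j * h /\ INR j * h + h <= H).
  { intros j Hj. apply le_INR in Hj. rewrite S_INR in Hmh. pose proof (pos_INR j).
    split; [apply Rmult_le_pos; lra|].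
    apply (Rmult_le_compat_r h) in Hj; lra. }
  (* The estimate of second differences is singular at t = 0, so the first summand is bounded
     directly. *)
  assert (Hd0 : norm (d 0%nat) <= 4 * M * norm v).
  { unfold d. simpl INR. rewrite !Rmult_0_l, !Rplus_0_l.
    destruct (HjH 0%nat (Nat.le_0_l m)) as [_ Hh'].  simpl in Hh'.
    assert (Hsh : 0 <= s * h <= h) by nra.
    pose proof (sg_bound _ _ _ _ HT (s * h) v (ltac:(lra))).
    pose proof (sg_bound _ _ _ _ HT h v (ltac:(lra))).
    pose proof (sg_bound _ _ _ _ HT 0 v (ltac:(lra))).
    eapply Rle_trans; [apply norm_minus_le|].
    pose proof (norm_minus_le (T (s * h) v) (T 0 v)).
    pose proof (norm_minus_le (T h v) (T 0 v)).
    pose proof (norm_scal_le s (T h v ⊖ T 0 v)) as G. rewrite (Rabs_right s) in G by lra.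
    pose proof (norm_ge_0 (T h v ⊖ T 0 v)).
    assert (s * norm (T h v ⊖ T 0 v) <= 1 * norm (T h v ⊖ T 0 v)) by (apply Rmult_le_compat_r; lra).
    lra. }
  assert (Hd : forall k, (k <= m)%nat ->
    norm (vsum (S k) d) <= (4 * M + 16 * C ^ 2 * (1 - / INR (S k))) * norm v).
  { induction k as [|k IH]; intros Hk.
    - simpl vsum. simpl INR. rewrite Rinv_1.
      replace (vzero ⊕ d 0%nat) with (d 0%nat) by lin_eq. lra.
    - change (vsum (S (S k)) d) with (vsum (S k) d ⊕ d (S k)).
      eapply Rle_trans; [apply norm_plus_le|].
      specialize (IH (ltac:(lia))).
      destruct (HjH (S k) Hk) as [G1 G2].
      assert (HSk : 0 < INR (S k)) by (apply lt_0_INR; lia).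
      pose proof (sg_second_difference (INR (S k) * h) h s v
        (Rmult_lt_0_compat _ _ HSk Hh) Hh G2 Hs) as G3.
      fold (d (S k)) in G3.
      replace (h / (INR (S k) * h)) with (/ INR (S k)) in G3 by (field; lra).
      (* Majorizing 1/j^2 by a telescoping difference gives the partial sums in closed form. *)
      assert (G4 : (/ INR (S k)) ^ 2 <= 2 * (/ INR (S k) - / INR (S (S k)))).
      { rewrite (S_INR (S k)).
        replace (2 * (/ INR (S k) - / (INR (S k) + 1))) with
          ((/ INR (S k)) ^ 2 * (2 * (INR (S k) / (INR (S k) + 1)))) by (field; lra).
        rewrite <- (Rmult_1_r ((/ INR (S k)) ^ 2)) at 1.
        apply Rmult_le_compat_l; [apply pow2_ge_0|].
        assert (1 <= INR (S k)) by (rewrite S_INR; pose proof (pos_INR k); lra).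
        apply (Rmult_le_reg_r (INR (S k) + 1)); [lra|].
        replace (2 * (INR (S k) / (INR (S k) + 1)) * (INR (S k) + 1)) with (2 * INR (S k))
          by (field; lra). lra. }
      assert (G5 : 8 * C ^ 2 * (/ INR (S k)) ^ 2 * norm v <=
        8 * C ^ 2 * (2 * (/ INR (S k) - / INR (S (S k)))) * norm v).
      { apply Rmult_le_compat_r; [exact Hv|]. apply Rmult_le_compat_l; [|exact G4].
        pose proof (pow2_ge_0 C). lra. }
      lra. }
  replace (vsum (S m) (fun j => T (INR j * h) (T (s * h) v ⊖ v))) with
    (vsum (S m) d ⊕ s ⊙ (T (INR (S m) * h) v ⊖ T 0 v)).
  - eapply Rle_trans; [apply norm_plus_le|].
    pose proof (Hd m (le_n m)) as G1.
    assert (HmH : 0 <= INR (S m) * h) by (apply Rmult_le_pos; [apply pos_INR|lra]).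
    pose proof (sg_bound _ _ _ _ HT (INR (S m) * h) v (conj HmH Hmh)).
    pose proof (sg_bound _ _ _ _ HT 0 v (ltac:(lra))).
    pose proof (norm_minus_le (T (INR (S m) * h) v) (T 0 v)).
    pose proof (norm_scal_le s (T (INR (S m) * h) v ⊖ T 0 v)) as G. rewrite (Rabs_right s) in G by lra.
    pose proof (norm_ge_0 (T (INR (S m) * h) v ⊖ T 0 v)) as G0.
    assert (s * norm (T (INR (S m) * h) v ⊖ T 0 v) <= 1 * norm (T (INR (S m) * h) v ⊖ T 0 v))
      by (apply Rmult_le_compat_r; lra).
    assert (G2 : 16 * C ^ 2 * (1 - / INR (S m)) * norm v <= 16 * C ^ 2 * 1 * norm v).
    { apply Rmult_le_compat_r; [exact Hv|]. apply Rmult_le_compat_l.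
      - pose proof (pow2_ge_0 C). lra.
      - assert (0 < / INR (S m)) by (apply Rinv_0_lt_compat, lt_0_INR; lia). lra. }
    unfold sum_const. lra.
  - replace (T 0 v) with (T (INR 0 * h) v) by (simpl INR; rewrite Rmult_0_l; reflexivity).
    rewrite <- (vsum_telescope (S m) (fun j => T (INR j * h) v)), <- vsum_scal, <- vsum_plus.
    apply vsum_ext. intros j Hj. destruct (HjH j (ltac:(lia))) as [G1 _].
    rewrite (lin_minus _ (sg_lin _ _ _ _ HT (INR j * h) G1)).
    rewrite <- (sg_add _ _ _ _ HT) by nra. unfold d.
    rewrite S_INR. replace ((INR j + 1) * h) with (INR j * h + h) by ring. lin_eq.
Qed.

End Semigroup.

Lemma linear_intro {U V : NormedModule R_AbsRing} (f : U -> V) (M : R) :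
  (forall x y, f (x ⊕ y) = f x ⊕ f y) -> (forall r x, f (r ⊙ x) = r ⊙ f x) ->
  (forall x, norm (f x) <= M * norm x) -> is_linear f.
Proof.
  intros H1 H2 H3. split; [exact H1|exact H2|].
  exists (Rmax 1 M). split; [pose proof (Rmax_l 1 M); lra|]. intros x.
  eapply Rle_trans; [apply H3|]. apply Rmult_le_compat_r; [apply norm_ge_0|apply Rmax_r].
Qed.

Lemma lin_bound {U V : NormedModule R_AbsRing} (f : U -> V) : is_linear f ->
  exists M, 0 < M /\ forall x, norm (f x) <= M * norm x.
Proof. intros H. exact (linear_norm f H). Qed.

Lemma is_linear_vsum {U V : NormedModule R_AbsRing} (f : nat -> U -> V) n :
  (forall j, (j < n)%nat -> is_linear (f j)) -> is_linear (fun x => vsum n (fun j => f j x)).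
Proof.
  induction n as [|n IH]; intros Hf.
  - apply (linear_intro _ 0); simpl; intros; try lin_eq. rewrite norm_vzero. lra.
  - specialize (IH (fun j Hj => Hf j (Nat.lt_lt_succ_r _ _ Hj))).
    specialize (Hf n (Nat.lt_succ_diag_r n)).
    destruct (lin_bound _ IH) as (M1 & HM1 & Hb1). destruct (lin_bound _ Hf) as (M2 & HM2 & Hb2).
    apply (linear_intro _ (M1 + M2)); simpl.
    + intros x y. pose proof (lin_plus _ IH x y) as E. cbv beta in E.
      rewrite E, (lin_plus _ Hf). lin_eq.
    + intros r x. pose proof (lin_scal _ IH r x) as E. cbv beta in E.
      rewrite E, (lin_scal _ Hf). lin_eq.
    + intros x. eapply Rle_trans; [apply norm_plus_le|]. specialize (Hb1 x). specialize (Hb2 x). lra.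
Qed.

Lemma weight_bound th k : 0 <= th <= 1 -> 0 <= th ^ k / INR (fact k) <= 1.
Proof.
  intros Hth. pose proof (INR_fact_lt_0 k) as Hf.
  assert (0 <= th ^ k) by (apply pow_le; lra).
  assert (th ^ k <= 1) by (rewrite <- (pow1 k); apply pow_incr; lra).
  assert (1 <= INR (fact k)) by (apply (le_INR 1), lt_O_fact).
  split.
  - apply Rmult_le_pos; [lra|]. apply Rlt_le, Rinv_0_lt_compat. lra.
  - apply (Rmult_le_reg_r (INR (fact k))); [lra|].
    replace (th ^ k / INR (fact k) * INR (fact k)) with (th ^ k) by (field; lra). lra.
Qed.

(* phi_k(tau A) v *)
Definition phiT {X : CompleteNormedModule R_AbsRing} (T : R -> X -> X) (k : nat) (tau : R) (v : X)
    : X :=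
  match k with
  | O => T tau v
  | S k' => RInt (fun th => (th ^ k' / INR (fact k')) ⊙ T ((1 - th) * tau) v) 0 1
  end.

Fixpoint nodes_in_01 (f : cfun) : Prop :=
  match f with
  | Phi _ c => 0 <= c <= 1
  | Zero => True
  | Defs.Add f g | Sub f g => nodes_in_01 f /\ nodes_in_01 g
  | Scale _ f => nodes_in_01 f
  end.

Fixpoint nodes_1 (f : cfun) : Prop :=
  match f with
  | Phi _ c => c = 1
  | Zero => True
  | Defs.Add f g | Sub f g => nodes_1 f /\ nodes_1 g
  | Scale _ f => nodes_1 f
  end.

Fixpoint cnorm (f : cfun) : R :=
  match f with
  | Phi _ _ => 1
  | Zero => 0
  | Defs.Add f g | Sub f g => cnorm f + cnorm g
  | Scale r f => Rabs r * cnorm f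
  end.

Lemma cnorm_pos f : 0 <= cnorm f.
Proof.
  induction f; simpl; try lra. apply Rmult_le_pos; [apply Rabs_pos|assumption].
Qed.

Lemma nodes_1_in_01 f : nodes_1 f -> nodes_in_01 f.
Proof. induction f; simpl; intros Hf; try tauto. subst. lra. Qed.

Section PhiOperators.

Context {X : CompleteNormedModule R_AbsRing}.
Context {T : R -> X -> X} {H M C : R} (HT : semigroup_bounds T H M C).
Implicit Types (v x z : X).

Let H_pos := sg_H _ _ _ _ HT.
Let M_ge_1 := sg_M _ _ _ _ HT.

(** The clamped version of the integrand of phi_{k+1}(tau A) v: it is continuous on the whole line
    and agrees with the true one on [0, 1]. *)
Definition integrand (k : nat) (tau : R) v (th : R) : X :=
  (th ^ k / INR (fact k)) ⊙ T (clamp 0 H ((1 - th) * tau)) v.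

Lemma integrand_eq k tau v th : 0 <= tau <= H -> 0 <= th <= 1 ->
  integrand k tau v th = (th ^ k / INR (fact k)) ⊙ T ((1 - th) * tau) v.
Proof. intros H1 H2. unfold integrand. rewrite clamp_id; [reflexivity|nra]. Qed.

Lemma continuous_integrand k tau v th : continuous (integrand k tau v) th.
Proof.
  apply (continuous_scal (K := R_AbsRing) (V := CompleteNormedModule.NormedModule R_AbsRing X)
    (fun th : R_UniformSpace => th ^ k / INR (fact k))
    (fun th => T (clamp 0 H ((1 - th) * tau)) v)).
  - apply (ex_derive_continuous (fun th => th ^ k / INR (fact k))). auto_derive. trivial.
  - apply (continuous_comp (fun th : R_UniformSpace => (1 - th) * tau : R_UniformSpace)
      (fun s => T (clamp 0 H s) v)).
    + apply (ex_derive_continuous (fun th => (1 - th) * tau)). auto_derive. trivial.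
    + apply (continuous_clamp 0 H (fun s => T s v)); [lra|].
      intros s Hs. apply (sg_cont_in HT), Hs.
Qed.

Lemma RInt_integrand k tau v : 0 <= tau <= H ->
  RInt (integrand k tau v) 0 1 = phiT T (S k) tau v.
Proof.
  intros Ht. apply RInt_ext. intros th Hth.
  rewrite Rmin_left, Rmax_right in Hth by lra. apply integrand_eq; [exact Ht|lra].
Qed.

Lemma is_RInt_phiT k tau v : 0 <= tau <= H ->
  is_RInt (fun th => (th ^ k / INR (fact k)) ⊙ T ((1 - th) * tau) v) 0 1 (phiT T (S k) tau v).
Proof.
  intros Ht. rewrite <- (RInt_integrand k tau v Ht).
  apply (is_RInt_ext (integrand k tau v)).
  - intros th Hth. rewrite Rmin_left, Rmax_right in Hth by lra. apply integrand_eq; [exact Ht|lra].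
  - apply (RInt_correct (integrand k tau v)).
    apply (ex_RInt_continuous (integrand k tau v)). intros. apply continuous_integrand.
Qed.

Lemma phiT_unique k tau v l : 0 <= tau <= H ->
  is_RInt (fun th => (th ^ k / INR (fact k)) ⊙ T ((1 - th) * tau) v) 0 1 l ->
  phiT T (S k) tau v = l.
Proof. intros Ht Hl. exact (is_RInt_unique _ 0 1 l Hl). Qed.

Lemma phiT_bound k tau v : 0 <= tau <= H -> norm (phiT T k tau v) <= M * norm v.
Proof.
  intros Ht. destruct k as [|k]; [apply (sg_bound _ _ _ _ HT), Ht|].
  replace (M * norm v) with ((1 - 0) * (M * norm v)) by ring.
  eapply (norm_RInt_le_const _ 0 1 (phiT T (S k) tau v)); [lra| |apply (is_RInt_phiT k tau v Ht)].
  intros th Hth. cbv beta. eapply Rle_trans; [apply norm_scal_le|].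
  destruct (weight_bound th k Hth) as [W1 W2].
  rewrite Rabs_right by lra.
  pose proof (sg_bound _ _ _ _ HT ((1 - th) * tau) v (ltac:(nra))) as HB.
  pose proof (norm_ge_0 (T ((1 - th) * tau) v)).
  apply Rle_trans with (1 * norm (T ((1 - th) * tau) v)); [apply Rmult_le_compat_r; lra|lra].
Qed.

Lemma phiT_linear k tau : 0 <= tau <= H -> is_linear (phiT T k tau).
Proof.
  intros Ht. destruct k as [|k]; [apply (sg_lin _ _ _ _ HT), Ht|].
  assert (HL : forall th, 0 < th < 1 -> is_linear (T ((1 - th) * tau)))
    by (intros th Hth; apply (sg_lin _ _ _ _ HT); nra).
  apply (linear_intro _ M).
  - intros x y. apply (phiT_unique k tau); [exact Ht|].
    apply (is_RInt_ext (fun th => plus ((th ^ k / INR (fact k)) ⊙ T ((1 - th) * tau) x)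
      ((th ^ k / INR (fact k)) ⊙ T ((1 - th) * tau) y))).
    + intros th Hth. rewrite Rmin_left, Rmax_right in Hth by lra.
      rewrite (lin_plus _ (HL th Hth)). lin_eq.
    + apply (is_RInt_plus (V := CompleteNormedModule.NormedModule R_AbsRing X));
        apply is_RInt_phiT; exact Ht.
  - intros r x. apply (phiT_unique k tau); [exact Ht|].
    apply (is_RInt_ext (fun th => scal r ((th ^ k / INR (fact k)) ⊙ T ((1 - th) * tau) x))).
    + intros th Hth. rewrite Rmin_left, Rmax_right in Hth by lra.
      rewrite (lin_scal _ (HL th Hth)). lin_eq.
    + apply (is_RInt_scal (V := CompleteNormedModule.NormedModule R_AbsRing X)).
      apply is_RInt_phiT; exact Ht.
  - intros x. apply phiT_bound, Ht.
Qed.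

(** T(s) is bounded and passes under the integral, where the semigroup operators commute. *)
Lemma phiT_commute k tau s v : 0 <= tau <= H -> 0 <= s ->
  T s (phiT T k tau v) = phiT T k tau (T s v).
Proof.
  intros Ht Hs. destruct k as [|k].
  - simpl. rewrite <- !(sg_add _ _ _ _ HT) by lra. f_equal. ring.
  - symmetry. apply (phiT_unique k tau); [exact Ht|].
    pose proof (sg_lin _ _ _ _ HT s Hs) as HL.
    apply (is_RInt_ext (fun th => T s ((th ^ k / INR (fact k)) ⊙ T ((1 - th) * tau) v))).
    + intros th Hth. rewrite Rmin_left, Rmax_right in Hth by lra.
      rewrite (lin_scal _ HL), <- !(sg_add _ _ _ _ HT) by nra. do 2 f_equal. ring.
    + apply (is_RInt_lin (T s)); [exact HL|]. apply is_RInt_phiT, Ht.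
Qed.

Lemma at_op_Phi k c h v : at_op (Phi k c) T h v = phiT T k (c * h) v.
Proof.
  destruct k as [|k]; [reflexivity|].
  unfold at_op; cbn [eval phi phiT]. apply RInt_ext. intros th _.
  rewrite Rmult_assoc. reflexivity.
Qed.

Lemma at_op_Zero h v : at_op Zero T h v = vzero.
Proof. reflexivity. Qed.

Lemma at_op_Add f g h v : at_op (Defs.Add f g) T h v = at_op f T h v ⊕ at_op g T h v.
Proof. reflexivity. Qed.

Lemma at_op_Sub f g h v : at_op (Sub f g) T h v = at_op f T h v ⊖ at_op g T h v.
Proof. reflexivity. Qed.

Lemma at_op_Scale r f h v : at_op (Scale r f) T h v = r ⊙ at_op f T h v.
Proof. reflexivity. Qed.

Lemma at_op_eq f g h v : (forall P, evalR P f = evalR P g) -> at_op f T h v = at_op g T h v.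
Proof. intros E. exact (eval_eq f g E X _). Qed.

Lemma at_op_bound f h v : 0 <= h <= H -> nodes_in_01 f ->
  norm (at_op f T h v) <= cnorm f * (M * norm v).
Proof.
  intros Hh. assert (Hv : 0 <= M * norm v) by (apply Rmult_le_pos; [lra|apply norm_ge_0]).
  induction f as [k c | | f IHf g IHg | f IHf g IHg | r f IHf]; simpl nodes_in_01; intros Hn;
    simpl cnorm.
  - rewrite at_op_Phi, Rmult_1_l. apply phiT_bound. nra.
  - rewrite at_op_Zero, norm_vzero. lra.
  - rewrite at_op_Add. eapply Rle_trans; [apply norm_plus_le|].
    specialize (IHf (proj1 Hn)). specialize (IHg (proj2 Hn)). lra.
  - rewrite at_op_Sub. eapply Rle_trans; [apply norm_minus_le|].
    specialize (IHf (proj1 Hn)). specialize (IHg (proj2 Hn)). lra.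
  - rewrite at_op_Scale. eapply Rle_trans; [apply norm_scal_le|].
    rewrite Rmult_assoc. apply Rmult_le_compat_l; [apply Rabs_pos|apply IHf, Hn].
Qed.

Lemma at_op_linear f h : 0 <= h <= H -> nodes_in_01 f -> is_linear (at_op f T h).
Proof.
  intros Hh Hn. apply (linear_intro _ (cnorm f * M)).
  - intros x y. induction f as [k c | | f IHf g IHg | f IHf g IHg | r f IHf]; simpl in Hn.
    + rewrite !at_op_Phi. apply lin_plus, phiT_linear. nra.
    + rewrite !at_op_Zero. lin_eq.
    + rewrite !at_op_Add, IHf, IHg by tauto. lin_eq.
    + rewrite !at_op_Sub, IHf, IHg by tauto. lin_eq.
    + rewrite !at_op_Scale, IHf by tauto. lin_eq.
  - intros a x. induction f as [k c | | f IHf g IHg | f IHf g IHg | r f IHf]; simpl in Hn.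
    + rewrite !at_op_Phi. apply lin_scal, phiT_linear. nra.
    + rewrite !at_op_Zero. lin_eq.
    + rewrite !at_op_Add, IHf, IHg by tauto. lin_eq.
    + rewrite !at_op_Sub, IHf, IHg by tauto. lin_eq.
    + rewrite !at_op_Scale, IHf by tauto. lin_eq.
  - intros x. rewrite Rmult_assoc. apply at_op_bound; assumption.
Qed.

(** For k >= 1, phi_k(hA) - 1/k! is the integral of the weight times T((1 - th) h) - 1, because the
    weight itself has integral 1/k!. The summation over j is linear, so it passes under the
    integral, and the bound for differences is uniform in th. *)
Lemma sum_phiT_bound m k h v : 0 < h -> INR m * h <= H -> h <= H ->
  norm (vsum m (fun j => T (INR j * h) (phiT T k h v ⊖ (/ INR (fact k)) ⊙ v)))
  <= sum_const (M := M) (C := C) * norm v.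
Proof.
  intros Hh Hmh HhH. destruct k as [|k].
  - pose proof (sum_difference_bound HT m h 1 v Hh Hmh (ltac:(lra))) as Hb.
    rewrite Rmult_1_l in Hb. simpl phiT.
    replace (/ INR (fact 0) ⊙ v) with v; [exact Hb|].
    simpl fact. rewrite INR_1, Rinv_1. lin_eq.
  - set (L := fun x => vsum m (fun j => T (INR j * h) x)).
    assert (HL : is_linear L).
    { apply (is_linear_vsum (fun j => T (INR j * h))). intros j _.
      apply (sg_lin _ _ _ _ HT). apply Rmult_le_pos; [apply pos_INR|lra]. }
    assert (HI : is_RInt (fun th => (th ^ k / INR (fact k)) ⊙ (T ((1 - th) * h) v ⊖ v)) 0 1
      (phiT T (S k) h v ⊖ (/ INR (fact (S k))) ⊙ v)).
    { apply (is_RInt_ext (fun th => minus ((th ^ k / INR (fact k)) ⊙ T ((1 - th) * h) v)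
        ((th ^ k / INR (fact k)) ⊙ v))); [intros; lin_eq|].
      apply (is_RInt_minus (V := CompleteNormedModule.NormedModule R_AbsRing X)).
      - apply is_RInt_phiT. lra.
      - pose proof (phi_const v (S k) 0) as E. cbn [phi] in E.
        change (/ INR (fact (S k)) ⊙ v) with (scal (/ INR (fact (S k))) v). rewrite <- E.
        apply (RInt_correct (fun th => scal (th ^ k / INR (fact k)) v)).
        apply (ex_RInt_continuous (fun th => scal (th ^ k / INR (fact k)) v)). intros z _.
        apply (continuous_scal_l (K := R_AbsRing) (V := CompleteNormedModule.NormedModule R_AbsRing X)
          (fun th : R_UniformSpace => th ^ k / INR (fact k)) v z).
        apply (ex_derive_continuous (fun th => th ^ k / INR (fact k))). auto_derive. trivial. }
    apply (is_RInt_lin L) in HI; [|exact HL].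
    replace (sum_const (M := M) (C := C) * norm v) with
      ((1 - 0) * (sum_const (M := M) (C := C) * norm v)) by ring.
    refine (norm_RInt_le_const _ 0 1 _ _ Rle_0_1 _ HI).
    intros th Hth. cbv beta. rewrite (lin_scal L HL).
    eapply Rle_trans; [apply norm_scal_le|].
    destruct (weight_bound th k Hth) as [W1 W2]. rewrite Rabs_right by lra.
    pose proof (sum_difference_bound HT m h (1 - th) v Hh Hmh (ltac:(lra))) as Hb.
    pose proof (norm_ge_0 (L (T ((1 - th) * h) v ⊖ v))).
    apply Rle_trans with (1 * norm (L (T ((1 - th) * h) v ⊖ v))); [apply Rmult_le_compat_r; lra|].
    unfold L. lra.
Qed.

Lemma sum_at_op_bound m f h v : 0 < h -> INR m * h <= H -> h <= H -> nodes_1 f ->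
  norm (vsum m (fun j => T (INR j * h) (at_op f T h v ⊖ at_zero f ⊙ v)))
  <= cnorm f * (sum_const (M := M) (C := C) * norm v).
Proof.
  intros Hh Hmh HhH.
  assert (HL : forall j, is_linear (T (INR j * h))).
  { intros j. apply (sg_lin _ _ _ _ HT). apply Rmult_le_pos; [apply pos_INR|lra]. }
  unfold at_zero.
  induction f as [k c | | f IHf g IHg | f IHf g IHg | r f IHf]; simpl nodes_1; intros Hn;
    simpl cnorm; simpl evalR.
  - subst c. rewrite at_op_Phi, !Rmult_1_l. apply sum_phiT_bound; assumption.
  - rewrite (vsum_ext m _ (fun _ => vzero)).
    + rewrite vsum_const. replace (INR m ⊙ (vzero : X)) with (vzero : X) by lin_eq.
      rewrite norm_vzero. lra.
    + intros j _. replace (at_op Zero T h v ⊖ 0 ⊙ v) with (vzero : X)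
        by (rewrite at_op_Zero; lin_eq). apply lin_zero, HL.
  - specialize (IHf (proj1 Hn)). specialize (IHg (proj2 Hn)).
    set (rf := evalR _ f) in *. set (rg := evalR _ g) in *.
    rewrite (vsum_ext m _ (fun j => T (INR j * h) (at_op f T h v ⊖ rf ⊙ v)
      ⊕ T (INR j * h) (at_op g T h v ⊖ rg ⊙ v))).
    + rewrite vsum_plus. eapply Rle_trans; [apply norm_plus_le|]. lra.
    + intros j _. rewrite <- (lin_plus _ (HL j)), at_op_Add. f_equal. lin_eq.
  - specialize (IHf (proj1 Hn)). specialize (IHg (proj2 Hn)).
    set (rf := evalR _ f) in *. set (rg := evalR _ g) in *.
    rewrite (vsum_ext m _ (fun j => T (INR j * h) (at_op f T h v ⊖ rf ⊙ v)
      ⊖ T (INR j * h) (at_op g T h v ⊖ rg ⊙ v))).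
    + rewrite vsum_minus. eapply Rle_trans; [apply norm_minus_le|]. lra.
    + intros j _. rewrite <- (lin_minus _ (HL j)), at_op_Sub. f_equal. lin_eq.
  - specialize (IHf Hn). set (rf := evalR _ f) in *.
    rewrite (vsum_ext m _ (fun j => r ⊙ T (INR j * h) (at_op f T h v ⊖ rf ⊙ v))).
    + rewrite vsum_scal. eapply Rle_trans; [apply norm_scal_le|].
      rewrite Rmult_assoc. apply Rmult_le_compat_l; [apply Rabs_pos|exact IHf].
    + intros j _. rewrite <- (lin_scal _ (HL j)), at_op_Scale. f_equal. lin_eq.
Qed.

End PhiOperators.

(** * The generator and the variation-of-constants formula *)

(** The graph of the generator: x lies in its domain and y is the image. As a relation it avoids the
    values of A outside the domain. *)
Definition is_gen {X : CompleteNormedModule R_AbsRing} (T : R -> X -> X) (x y : X) : Prop :=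
  forall eta, 0 < eta -> exists delta, 0 < delta /\
  forall eps, 0 < eps < delta -> norm (T eps x ⊖ x ⊖ eps ⊙ y) <= eta * eps.

Lemma eq_of_norm_le {V : NormedModule R_AbsRing} (c : R) (x y : V) :
  (forall eta, 0 < eta -> norm (x ⊖ y) <= c * eta) -> x = y.
Proof.
  intros H. assert (H0 : norm (x ⊖ y) = 0).
  { apply Rle_antisym; [|apply norm_ge_0]. apply le_epsilon. intros eps He.
    pose proof (Rle_abs c) as Hc. pose proof (Rabs_pos c) as Hc0.
    eapply Rle_trans; [apply (H (eps / (Rabs c + 1)))|].
    - apply Rdiv_lt_0_compat; lra.
    - rewrite Rplus_0_l. apply (Rmult_le_reg_r (Rabs c + 1)); [lra|].
      replace (c * (eps / (Rabs c + 1)) * (Rabs c + 1)) with (c * eps) by (field; lra).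
      nra. }
  apply (norm_eq_zero (x ⊖ y)) in H0. change (x ⊖ y = vzero) in H0.
  transitivity (x ⊖ y ⊕ y); [lin_eq|]. rewrite H0. lin_eq.
Qed.

Definition lin_comb {X : NormedModule R_AbsRing} (F : nat -> X -> X) (l : list (nat * X)) : X :=
  fold_right (fun p s => F (fst p) (snd p) ⊕ s) vzero l.

Section Generator.

Context {X : CompleteNormedModule R_AbsRing}.
Context {T : R -> X -> X} {H M C : R} (HT : semigroup_bounds T H M C).
Implicit Types (v x y z : X).

Let H_pos := sg_H _ _ _ _ HT.
Let M_ge_1 := sg_M _ _ _ _ HT.

Lemma quotient_is_gen x y :
  filterlim (fun t => scal (/ t) (minus (T t x) x)) (at_right 0) (locally y) <-> is_gen T x y.
Proof.
  split.
  - intros Hl eta He.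
    destruct (proj1 (filterlim_locally_ball_norm (K := R_AbsRing) _ y) Hl (mkposreal eta He))
      as (d & Hd).
    exists d. split; [apply cond_pos|]. intros eps Heps.
    assert (Hq : norm (/ eps ⊙ (T eps x ⊖ x) ⊖ y) < eta).
    { apply (Hd eps); [|lra]. change (Rabs (eps - 0) < d). rewrite Rabs_right; lra. }
    replace (T eps x ⊖ x ⊖ eps ⊙ y) with (eps ⊙ (/ eps ⊙ (T eps x ⊖ x) ⊖ y)) by (lin_field; lra).
    eapply Rle_trans; [apply norm_scal_le|]. rewrite Rabs_right by lra.
    rewrite Rmult_comm. apply Rmult_le_compat_r; lra.
  - intros Hg.
    apply (proj2 (filterlim_locally_ball_norm (K := R_AbsRing) (F := at_right 0)
      (fun t => scal (/ t) (minus (T t x) x)) y)).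
    intros eta. destruct (Hg (eta / 2)) as (d & Hd & Hdd).
    { pose proof (cond_pos eta). lra. }
    exists (mkposreal d Hd). intros eps He1 He2. change (Rabs (eps - 0) < d) in He1.
    rewrite Rminus_0_r, Rabs_right in He1 by lra.
    specialize (Hdd eps (conj He2 He1)).
    change (norm (/ eps ⊙ (T eps x ⊖ x) ⊖ y) < eta).
    replace (/ eps ⊙ (T eps x ⊖ x) ⊖ y) with (/ eps ⊙ (T eps x ⊖ x ⊖ eps ⊙ y)) by (lin_field; lra).
    eapply Rle_lt_trans; [apply norm_scal_le|].
    rewrite Rabs_right by (apply Rle_ge, Rlt_le, Rinv_0_lt_compat; lra).
    apply (Rmult_lt_reg_l eps); [lra|]. rewrite <- Rmult_assoc, Rinv_r, Rmult_1_l by lra.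
    pose proof (cond_pos eta). nra.
Qed.

Lemma is_gen_unique x y y' : is_gen T x y -> is_gen T x y' -> y = y'.
Proof.
  intros H1 H2. apply (eq_of_norm_le 2). intros eta He.
  destruct (H1 eta He) as (d1 & Hd1 & G1). destruct (H2 eta He) as (d2 & Hd2 & G2).
  set (e := Rmin d1 d2 / 2).
  assert (Hm : 0 < Rmin d1 d2) by (apply Rmin_glb_lt; assumption).
  pose proof (Rmin_l d1 d2) as L1. pose proof (Rmin_r d1 d2) as L2.
  specialize (G1 e (ltac:(unfold e; lra))). specialize (G2 e (ltac:(unfold e; lra))).
  assert (He0 : 0 < e) by (unfold e; lra).
  replace (y ⊖ y') with (/ e ⊙ ((T e x ⊖ x ⊖ e ⊙ y') ⊖ (T e x ⊖ x ⊖ e ⊙ y))) by (lin_field; lra).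
  eapply Rle_trans; [apply norm_scal_le|].
  rewrite Rabs_right by (apply Rle_ge, Rlt_le, Rinv_0_lt_compat; lra).
  apply (Rmult_le_reg_l e); [lra|]. rewrite <- Rmult_assoc, Rinv_r, Rmult_1_l by lra.
  eapply Rle_trans; [apply norm_minus_le|]. lra.
Qed.

Lemma is_gen_plus x y x' y' : is_gen T x y -> is_gen T x' y' -> is_gen T (x ⊕ x') (y ⊕ y').
Proof.
  intros H1 H2 eta He.
  destruct (H1 (eta / 2)) as (d1 & Hd1 & G1); [lra|].
  destruct (H2 (eta / 2)) as (d2 & Hd2 & G2); [lra|].
  exists (Rmin d1 d2). split; [apply Rmin_glb_lt; assumption|]. intros e Hee.
  pose proof (Rmin_l d1 d2). pose proof (Rmin_r d1 d2).
  specialize (G1 e (ltac:(lra))). specialize (G2 e (ltac:(lra))).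
  rewrite (lin_plus _ (sg_lin _ _ _ _ HT e (ltac:(lra)))).
  replace (T e x ⊕ T e x' ⊖ (x ⊕ x') ⊖ e ⊙ (y ⊕ y')) with
    ((T e x ⊖ x ⊖ e ⊙ y) ⊕ (T e x' ⊖ x' ⊖ e ⊙ y')) by lin_eq.
  eapply Rle_trans; [apply norm_plus_le|]. lra.
Qed.

Lemma is_gen_op (L : X -> X) x y : is_linear L ->
  (forall e v, 0 <= e -> T e (L v) = L (T e v)) -> is_gen T x y -> is_gen T (L x) (L y).
Proof.
  intros HL Hc Hg eta He. destruct (lin_bound L HL) as (K & HK & HKb).
  destruct (Hg (eta / K)) as (d & Hd & Hdd); [apply Rdiv_lt_0_compat; lra|].
  exists d. split; [exact Hd|]. intros e Hee.
  rewrite Hc by lra. rewrite <- (lin_scal L HL), <- !(lin_minus L HL).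
  eapply Rle_trans; [apply HKb|].
  apply Rle_trans with (K * (eta / K * e)); [|right; field; lra].
  apply Rmult_le_compat_l; [lra|apply Hdd, Hee].
Qed.

Lemma scal_linear (r : R) : is_linear (fun x : X => r ⊙ x).
Proof.
  apply (linear_intro _ (Rabs r)); intros; try lin_eq. apply norm_scal_le.
Qed.

Lemma is_gen_scal (r : R) x y : is_gen T x y -> is_gen T (r ⊙ x) (r ⊙ y).
Proof.
  apply (is_gen_op (fun x => r ⊙ x) x y (scal_linear r)).
  intros e v He. apply (lin_scal _ (sg_lin _ _ _ _ HT e He)).
Qed.

Lemma is_gen_T s x y : 0 <= s -> is_gen T x y -> is_gen T (T s x) (T s y).
Proof.
  intros Hs. apply (is_gen_op (T s) x y (sg_lin _ _ _ _ HT s Hs)).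
  intros e v He. rewrite <- !(sg_add _ _ _ _ HT) by assumption. f_equal. ring.
Qed.

(** The derivative of the orbit of v at a positive time is also the derivative at 0 of the orbit
    that starts at T(s) v; so T(s) maps all of X into the domain. *)
Lemma is_gen_smoothing s D v : 0 < s -> op_deriv T s D -> is_gen T (T s v) (D v).
Proof.
  intros Hs HD eta He.
  destruct (op_deriv_diff_in s D v s (s + 1) Hs HD eta He) as (d & Hd & Hdd).
  exists (Rmin d 1). split; [apply Rmin_glb_lt; lra|]. intros e Hee.
  pose proof (Rmin_l d 1). pose proof (Rmin_r d 1).
  specialize (Hdd (s + e) (ltac:(lra))).
  replace (s + e - s) with e in Hdd by ring. rewrite Rabs_right in Hdd by lra.
  rewrite <- (sg_add _ _ _ _ HT) by lra. rewrite (Rplus_comm e s). apply Hdd. lra.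
Qed.

Lemma op_deriv_gen s D x z : 0 < s -> op_deriv T s D -> is_gen T x z -> D x = T s z.
Proof.
  intros Hs HD Hg. apply (is_gen_unique (T s x)).
  - apply is_gen_smoothing; assumption.
  - apply is_gen_T; [lra|exact Hg].
Qed.

(** A product rule: the time derivative of the semigroup contributes -tau T A w. At th0 = 1 the
    operator would be T(0), where the semigroup is only strongly continuous; hence the open
    interval. *)
Lemma transported_diff tau (w : R -> X) th0 w' z : 0 < tau <= H -> 0 < th0 < 1 ->
  diff_in 0 1 w th0 w' -> is_gen T (w th0) z ->
  diff_in 0 1 (fun th => T ((1 - th) * tau) (w th)) th0 (T ((1 - th0) * tau) (w' ⊖ tau ⊙ z)).
Proof.
  intros Ht Hth Hw Hg eps He.
  set (r0 := (1 - th0) * tau). assert (Hr0 : 0 < r0 <= H) by (unfold r0; split; nra).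
  destruct (sg_deriv _ _ _ _ HT r0 Hr0) as (D & _ & HD & HDb).
  set (K := C / r0) in *.
  assert (HK : 0 <= K).
  { apply Rmult_le_pos; [exact (sg_C _ _ _ _ HT)|]. apply Rlt_le, Rinv_0_lt_compat. lra. }
  pose proof (op_deriv_gen r0 D (w th0) z (proj1 Hr0) HD Hg) as HDz.
  assert (He3 : 0 < eps / (3 * tau)) by (apply Rdiv_lt_0_compat; lra).
  destruct (op_deriv_diff_in r0 D (w th0) 0 H (proj1 Hr0) HD (eps / (3 * tau)) He3)
    as (d1 & Hd1 & G1).
  rewrite HDz in G1.
  destruct (Hw (eps / (3 * M))) as (d2 & Hd2 & G2); [apply Rdiv_lt_0_compat; lra|].
  destruct (HD 1 Rlt_0_1) as (d3 & Hd3 & G3).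
  destruct (diff_in_cont 0 1 w th0 w' Hw (eps / (3 * (tau * (1 + K))))) as (d4 & Hd4 & G4).
  { apply Rdiv_lt_0_compat; [lra|]. apply Rmult_lt_0_compat; [lra|]. apply Rmult_lt_0_compat; lra. }
  set (d := Rmin (Rmin (d1 / tau) (d3 / tau)) (Rmin (Rmin d2 d4) (r0 / tau))).
  exists d. split.
  { unfold d. repeat apply Rmin_glb_lt; try assumption; apply Rdiv_lt_0_compat; lra. }
  intros th Hth01 Hthd.
  assert (Hall : Rabs (th - th0) < d1 / tau /\ Rabs (th - th0) < d3 / tau /\
    Rabs (th - th0) < d2 /\ Rabs (th - th0) < d4 /\ Rabs (th - th0) < r0 / tau).
  { unfold d in Hthd. repeat match goal with
      | h : _ < Rmin _ _ |- _ => apply Rmin_Rgt_l in h; destruct h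
      | h : Rmin _ _ > _ |- _ => apply Rmin_Rgt_l in h; destruct h end.
    repeat split; assumption. }
  destruct Hall as (B1 & B3 & B2 & B4 & B5).
  set (r := (1 - th) * tau).
  assert (Hrr : r - r0 = - (th - th0) * tau) by (unfold r, r0; ring).
  assert (Habs : Rabs (r - r0) = Rabs (th - th0) * tau).
  { rewrite Hrr, Rabs_mult, Rabs_Ropp, (Rabs_right tau) by lra. reflexivity. }
  assert (Hdiv : forall c, Rabs (th - th0) < c / tau -> Rabs (r - r0) < c).
  { intros c Hc. rewrite Habs. apply (Rmult_lt_compat_r tau) in Hc; [|lra].
    replace (c / tau * tau) with c in Hc by (field; lra). exact Hc. }
  apply Hdiv in B1. apply Hdiv in B3. apply Hdiv in B5.
  assert (Hrpos : 0 < r) by (apply Rabs_def2 in B5; lra).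
  assert (HrH : 0 <= r <= H) by (unfold r; split; nra).
  (* The first summand moves the time only, the second the vector only. The third is the mixed
     increment, small because the operator-norm derivative is applied to w(th) - w(th0). *)
  replace (T r (w th) ⊖ T r0 (w th0) ⊖ (th - th0) ⊙ T r0 (w' ⊖ tau ⊙ z)) with
    ((T r (w th0) ⊖ T r0 (w th0) ⊖ (r - r0) ⊙ T r0 z)
     ⊕ T r0 (w th ⊖ w th0 ⊖ (th - th0) ⊙ w')
     ⊕ (T r (w th ⊖ w th0) ⊖ T r0 (w th ⊖ w th0))).
  2: { pose proof (sg_lin _ _ _ _ HT r (proj1 HrH)) as L1.
       pose proof (sg_lin _ _ _ _ HT r0 (Rlt_le _ _ (proj1 Hr0))) as L2.
       rewrite !(lin_minus _ L1), !(lin_minus _ L2), !(lin_scal _ L2), Hrr. lin_eq. }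
  specialize (G1 r HrH B1). specialize (G2 th Hth01 B2).
  specialize (G3 r Hrpos B3 (w th ⊖ w th0)). specialize (G4 th Hth01 B4).
  eapply Rle_trans; [apply norm_plus_le|].
  eapply Rle_trans; [apply Rplus_le_compat_r, norm_plus_le|].
  assert (E1 : norm (T r (w th0) ⊖ T r0 (w th0) ⊖ (r - r0) ⊙ T r0 z) <= eps / 3 * Rabs (th - th0)).
  { eapply Rle_trans; [exact G1|]. rewrite Habs. right. field. lra. }
  assert (E2 : norm (T r0 (w th ⊖ w th0 ⊖ (th - th0) ⊙ w')) <= eps / 3 * Rabs (th - th0)).
  { eapply Rle_trans; [apply (sg_bound _ _ _ _ HT); lra|].
    apply Rle_trans with (M * (eps / (3 * M) * Rabs (th - th0))); [|right; field; lra].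
    apply Rmult_le_compat_l; lra. }
  assert (E3 : norm (T r (w th ⊖ w th0) ⊖ T r0 (w th ⊖ w th0)) <= eps / 3 * Rabs (th - th0)).
  { set (q := w th ⊖ w th0) in *.
    pose proof (norm_le_add_minus (T r q ⊖ T r0 q) ((r - r0) ⊙ D q)) as N1.
    pose proof (norm_scal_le (r - r0) (D q)) as N2.
    specialize (HDb q).
    assert (N3 : Rabs (r - r0) * norm (D q) <= Rabs (r - r0) * (K * norm q))
      by (apply Rmult_le_compat_l; [apply Rabs_pos|exact HDb]).
    apply Rle_trans with (Rabs (r - r0) * (1 + K) * norm q); [lra|].
    rewrite Habs.
    apply Rle_trans with (Rabs (th - th0) * tau * (1 + K) * (eps / (3 * (tau * (1 + K))))).
    - apply Rmult_le_compat_l; [|exact G4].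
      apply Rmult_le_pos; [|lra]. apply Rmult_le_pos; [apply Rabs_pos|lra].
    - right. field. split; lra. }
  lra.
Qed.

Lemma transported_cont tau (w : R -> X) th0 : 0 < tau <= H -> 0 <= th0 <= 1 ->
  cont_in 0 1 w th0 -> cont_in 0 1 (fun th => T ((1 - th) * tau) (w th)) th0.
Proof.
  intros Ht Hth Hw eps He.
  set (r0 := (1 - th0) * tau). assert (Hr0 : 0 <= r0 <= H) by (unfold r0; split; nra).
  destruct (Hw (eps / (2 * M))) as (d1 & Hd1 & G1); [apply Rdiv_lt_0_compat; lra|].
  destruct (sg_cont_in HT (w th0) r0 Hr0 (eps / 2)) as (d2 & Hd2 & G2); [lra|].
  exists (Rmin d1 (d2 / tau)). split.
  { apply Rmin_glb_lt; [exact Hd1|]. apply Rdiv_lt_0_compat; lra. }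
  intros th Hth01 Hthd. apply Rmin_Rgt_l in Hthd. destruct Hthd as [B1 B2].
  set (r := (1 - th) * tau). assert (Hr : 0 <= r <= H) by (unfold r; split; nra).
  assert (B3 : Rabs (r - r0) < d2).
  { replace (r - r0) with (- (th - th0) * tau) by (unfold r, r0; ring).
    rewrite Rabs_mult, Rabs_Ropp, (Rabs_right tau) by lra.
    apply (Rmult_lt_compat_r tau) in B2; [|lra].
    replace (d2 / tau * tau) with d2 in B2 by (field; lra). exact B2. }
  specialize (G1 th Hth01 B1). specialize (G2 r Hr B3). cbv beta in G2.
  replace (T r (w th) ⊖ T r0 (w th0)) with
    (T r (w th ⊖ w th0) ⊕ (T r (w th0) ⊖ T r0 (w th0))).
  2: { rewrite (lin_minus _ (sg_lin _ _ _ _ HT r (proj1 Hr))). lin_eq. }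
  eapply Rle_trans; [apply norm_plus_le|].
  assert (norm (T r (w th ⊖ w th0)) <= eps / 2); [|lra].
  eapply Rle_trans; [apply (sg_bound _ _ _ _ HT), Hr|].
  apply Rle_trans with (M * (eps / (2 * M))); [apply Rmult_le_compat_l; lra|right; field; lra].
Qed.

Lemma diff_in_lin_comb (F : nat -> X -> R -> X) (G : nat -> X -> X) l a b s :
  (forall k v, diff_in a b (F k v) s (G k v)) ->
  diff_in a b (fun t => lin_comb (fun k v => F k v t) l) s (lin_comb G l).
Proof.
  intros HF. induction l as [|[k v] l IH]; cbn [lin_comb fold_right].
  - intros eps He. exists 1. split; [lra|]. intros r _ _.
    replace (vzero ⊖ vzero ⊖ (r - s) ⊙ vzero) with (vzero : X) by lin_eq.
    rewrite norm_vzero. apply Rmult_le_pos; [lra|apply Rabs_pos].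
  - intros eps He.
    destruct (HF k v (eps / 2)) as (d1 & Hd1 & G1); [lra|].
    destruct (IH (eps / 2)) as (d2 & Hd2 & G2); [lra|].
    exists (Rmin d1 d2). split; [apply Rmin_glb_lt; assumption|]. intros r Hr Hrs.
    specialize (G1 r Hr (Rlt_le_trans _ _ _ Hrs (Rmin_l _ _))).
    specialize (G2 r Hr (Rlt_le_trans _ _ _ Hrs (Rmin_r _ _))).
    cbn [fst snd]. fold (lin_comb (fun k v => F k v r) l). fold (lin_comb (fun k v => F k v s) l).
    fold (lin_comb G l).
    replace (F k v r ⊕ lin_comb (fun k v => F k v r) l ⊖ (F k v s ⊕ lin_comb (fun k v => F k v s) l)
      ⊖ (r - s) ⊙ (G k v ⊕ lin_comb G l)) with
      ((F k v r ⊖ F k v s ⊖ (r - s) ⊙ G k v) ⊕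
       (lin_comb (fun k v => F k v r) l ⊖ lin_comb (fun k v => F k v s) l ⊖ (r - s) ⊙ lin_comb G l))
      by lin_eq.
    eapply Rle_trans; [apply norm_plus_le|]. lra.
Qed.

Lemma lin_comb_ext (F G : nat -> X -> X) l :
  (forall k v, F k v = G k v) -> lin_comb F l = lin_comb G l.
Proof.
  intros E. induction l as [|p l IH]; [reflexivity|].
  cbn [lin_comb fold_right]. fold (lin_comb F l). fold (lin_comb G l). rewrite IH, E. reflexivity.
Qed.

Lemma lin_lin_comb (L : X -> X) (F : nat -> X -> X) l : is_linear L ->
  L (lin_comb F l) = lin_comb (fun k v => L (F k v)) l.
Proof.
  intros HL. induction l as [|p l IH]; [apply (lin_zero L HL)|].
  cbn [lin_comb fold_right]. fold (lin_comb F l).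
  rewrite (lin_plus L HL), IH. reflexivity.
Qed.

(* The variation-of-constants formula for w' = tau A w + p, where p is within K of a
   polynomial. *)
Lemma voc_estimate tau (w : R -> X) (l : list (nat * X)) K : 0 < tau <= H ->
  (forall th, 0 <= th <= 1 -> cont_in 0 1 w th) ->
  (forall th, 0 < th < 1 -> exists w' z, diff_in 0 1 w th w' /\ is_gen T (w th) z /\
     norm (w' ⊖ tau ⊙ z ⊖ lin_comb (fun k v => (th ^ k / INR (fact k)) ⊙ v) l) <= K) ->
  norm (w 1 ⊖ T tau (w 0) ⊖ lin_comb (fun k v => phiT T (S k) tau v) l) <= M * K.
Proof.
  intros Ht Hw Hd.
  set (P := fun th => lin_comb (fun k v => RInt (integrand (T := T) (H := H) k tau v) 0 th) l).
  assert (HP : forall th, diff_in 0 1 P th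
    (lin_comb (fun k v => integrand (T := T) (H := H) k tau v th) l)).
  { intros th.
    apply (diff_in_lin_comb (fun k v th => RInt (integrand (T := T) (H := H) k tau v) 0 th)).
    intros k v. apply (diff_in_primitive (integrand k tau v) 0 1 0 th).
    apply (continuous_integrand HT). }
  assert (HP1 : P 1 = lin_comb (fun k v => phiT T (S k) tau v) l).
  { apply lin_comb_ext. intros k v. apply RInt_integrand. lra. }
  assert (HP0 : P 0 = vzero).
  { unfold P. rewrite (lin_comb_ext _ (fun _ _ => vzero)).
    - clear. induction l as [|p l IH]; [reflexivity|]. cbn [lin_comb fold_right].
      fold (lin_comb (fun (_ : nat) (_ : X) => (vzero : X)) l). rewrite IH. lin_eq.
    - intros k v. apply (RInt_point 0 (integrand k tau v)). }
  (* P is the primitive of the transported polynomial part. Subtracting it leaves a function with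
     derivative bounded by M K, so the remainder itself never has to be integrated. *)
  pose proof (mean_value_ineq 0 1 (M * K) (fun th => T ((1 - th) * tau) (w th) ⊖ P th) Rle_0_1) as Hm.
  cbv beta in Hm. rewrite HP1, HP0 in Hm.
  replace ((1 - 1) * tau) with 0 in Hm by ring. rewrite (sg_0 _ _ _ _ HT) in Hm.
  replace ((1 - 0) * tau) with tau in Hm by ring. rewrite Rminus_0_r, Rmult_1_r in Hm.
  replace (w 1 ⊖ T tau (w 0) ⊖ lin_comb (fun k v => phiT T (S k) tau v) l) with
    (w 1 ⊖ lin_comb (fun k v => phiT T (S k) tau v) l ⊖ (T tau (w 0) ⊖ vzero)) by lin_eq.
  apply Hm.
  - intros th Hth. apply cont_in_minus.
    + apply transported_cont; [exact Ht|exact Hth|apply Hw, Hth].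
    + eapply diff_in_cont, HP.
  - intros th Hth. destruct (Hd th Hth) as (w' & z & H1 & H2 & H3).
    eexists. split; [|apply diff_in_minus; [apply (transported_diff tau w th w' z); assumption|apply HP]].
    assert (Hr : 0 <= (1 - th) * tau <= H) by nra.
    pose proof (sg_lin _ _ _ _ HT _ (proj1 Hr)) as HL.
    replace (lin_comb (fun k v => integrand (T := T) (H := H) k tau v th) l) with
      (T ((1 - th) * tau) (lin_comb (fun k v => (th ^ k / INR (fact k)) ⊙ v) l)).
    + rewrite <- (lin_minus _ HL). eapply Rle_trans; [apply (sg_bound _ _ _ _ HT), Hr|].
      apply Rmult_le_compat_l; lra.
    + rewrite (lin_lin_comb _ _ _ HL). apply lin_comb_ext. intros k v.
      rewrite (lin_scal _ HL). symmetry. apply (integrand_eq k tau v th); lra.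
Qed.

End Generator.

(** * Integration by parts and the domain of the generator *)

Section Domain.

Context {X : CompleteNormedModule R_AbsRing}.
Context {T : R -> X -> X} {H M C : R} (HT : semigroup_bounds T H M C).
Implicit Types (v x y z : X).

Let H_pos := sg_H _ _ _ _ HT.
Let M_ge_1 := sg_M _ _ _ _ HT.

Lemma diff_in_const a b s v : diff_in a b (fun _ => v) s (vzero : X).
Proof.
  intros eps He. exists 1. split; [lra|]. intros r _ _.
  replace (v ⊖ v ⊖ (r - s) ⊙ vzero) with (vzero : X) by lin_eq.
  rewrite norm_vzero. apply Rmult_le_pos; [lra|apply Rabs_pos].
Qed.

Lemma weight_deriv k s : derivable_pt_lim (fun th => th ^ S k / INR (fact (S k))) s
  (s ^ k / INR (fact k)).
Proof.
  apply is_derive_Reals. auto_derive; [trivial|].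
  change (fact k + k * fact k)%nat with (S k * fact k)%nat. rewrite mult_INR.
  change (match k with O => 1 | S _ => INR k + 1 end) with (INR (S k)).
  assert (0 < INR (S k)) by (apply lt_0_INR; lia). pose proof (INR_fact_lt_0 k).
  field. split; lra.
Qed.

(* Integration by parts: z phi_(k+1)(z) = phi_k(z) - 1/k! on the domain of the generator. *)
Lemma phiT_recurrence k tau x z : 0 < tau <= H -> is_gen T x z ->
  tau ⊙ phiT T (S k) tau z = phiT T k tau x ⊖ (/ INR (fact k)) ⊙ x.
Proof.
  intros Ht Hg. assert (Ht' : 0 <= tau <= H) by lra.
  destruct k as [|k].
  (* The constant path w = x satisfies w' = tau A w - tau z exactly, so the formula holds with K =
     0. *)
  - assert (Hn : norm (x ⊖ T tau x ⊖ lin_comb (fun k v => phiT T (S k) tau v)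
      [(0%nat, (- tau) ⊙ z)]) <= M * 0).
    { apply (voc_estimate HT tau (fun _ => x) [(0%nat, (- tau) ⊙ z)] 0 Ht).
      - intros th _. eapply diff_in_cont, diff_in_const.
      - intros th _. exists vzero, z. split; [apply diff_in_const|]. split; [exact Hg|].
        cbn [lin_comb fold_right fst snd].
        replace (vzero ⊖ tau ⊙ z ⊖ ((th ^ 0 / INR (fact 0)) ⊙ (- tau ⊙ z) ⊕ vzero))
          with (vzero : X) by (simpl fact; simpl pow; rewrite INR_1; lin_field).
        rewrite norm_vzero. lra. }
    rewrite Rmult_0_r in Hn. cbn [lin_comb fold_right fst snd] in Hn.
    rewrite (lin_scal _ (phiT_linear HT 1 tau Ht')) in Hn.
    apply (eq_of_norm_le 0). intros eta _. simpl fact. rewrite INR_1, Rinv_1, Rmult_0_l.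
    replace (tau ⊙ phiT T 1 tau z ⊖ (phiT T 0 tau x ⊖ 1 ⊙ x)) with
      (x ⊖ T tau x ⊖ (- tau ⊙ phiT T 1 tau z ⊕ vzero)) by (cbn [phiT]; lin_eq).
    exact Hn.
  (* The path w(th) = th^{k+1}/(k+1)! x starts at 0, ends at x/(k+1)!, and has the inhomogeneity
     th^k/k! x - th^{k+1}/(k+1)! tau z. *)
  - assert (Hn : norm ((1 ^ S k / INR (fact (S k))) ⊙ x ⊖ T tau ((0 ^ S k / INR (fact (S k))) ⊙ x)
      ⊖ lin_comb (fun k v => phiT T (S k) tau v) [(k, x); (S k, (- tau) ⊙ z)]) <= M * 0).
    { apply (voc_estimate HT tau (fun th => (th ^ S k / INR (fact (S k))) ⊙ x)
        [(k, x); (S k, (- tau) ⊙ z)] 0 Ht).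
      - intros th _. eapply diff_in_cont.
        apply (diff_in_scal 0 1 (fun th => th ^ S k / INR (fact (S k)))). apply weight_deriv.
      - intros th _.
        exists ((th ^ k / INR (fact k)) ⊙ x), ((th ^ S k / INR (fact (S k))) ⊙ z).
        split; [apply (diff_in_scal 0 1 (fun th => th ^ S k / INR (fact (S k)))), weight_deriv|].
        split; [apply (is_gen_scal HT), Hg|].
        cbn [lin_comb fold_right fst snd].
        match goal with |- norm ?e <= 0 => replace e with (vzero : X) by lin_eq end.
        rewrite norm_vzero. lra. }
    rewrite Rmult_0_r in Hn. cbn [lin_comb fold_right fst snd] in Hn.
    rewrite (lin_scal _ (phiT_linear HT (S (S k)) tau Ht')) in Hn.
    rewrite pow1, pow_i in Hn by lia.
    rewrite (lin_scal _ (sg_lin _ _ _ _ HT tau (proj1 Ht'))) in Hn.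
    apply (eq_of_norm_le 0). intros eta _. rewrite Rmult_0_l.
    match type of Hn with norm ?e <= 0 => 
      match goal with |- norm ?g <= 0 => replace g with e; [exact Hn|] end end.
    assert (INR (fact (S k)) <> 0) by apply INR_fact_neq_0. lin_field. assumption.
Qed.

(** v need not lie in the domain, but T(e) v does for e > 0, and there the recurrence gives A T(e) w
    = T(e) B v. Strong continuity at 0 and the mean value inequality carry this over to e = 0. *)
Lemma phiT_gen k tau v : 0 < tau <= H ->
  is_gen T (phiT T (S k) tau v) (/ tau ⊙ (phiT T k tau v ⊖ (/ INR (fact k)) ⊙ v)).
Proof.
  intros Ht. assert (Ht' : 0 <= tau <= H) by lra.
  set (B := fun v => / tau ⊙ (phiT T k tau v ⊖ (/ INR (fact k)) ⊙ v)). fold (B v).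
  set (w := phiT T (S k) tau v).
  assert (Hder : forall e D, 0 < e -> op_deriv T e D -> D w = T e (B v)).
  { intros e D He HD. apply (is_gen_unique (T := T) (T e w)).
    - apply (is_gen_smoothing HT); assumption.
    - unfold w. rewrite (phiT_commute HT) by lra.
      pose proof (is_gen_smoothing HT e D v He HD) as Hg.
      pose proof (is_gen_op (phiT T (S k) tau) _ _ (phiT_linear HT (S k) tau Ht')
        (fun s x Hs => phiT_commute HT (S k) tau s x Ht' Hs) Hg) as Hg2.
      replace (T e (B v)) with (phiT T (S k) tau (D v)); [exact Hg2|].
      apply (phiT_recurrence k tau) in Hg; [|exact Ht].
      pose proof (sg_lin _ _ _ _ HT e (ltac:(lra))) as HL.
      unfold B. rewrite (lin_scal _ HL), (lin_minus _ HL), (lin_scal _ HL).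
      rewrite (phiT_commute HT) by lra. rewrite <- Hg.
      lin_field. lra. }
  intros eta He.
  destruct (sg_cont0 _ _ _ _ HT (B v) eta He) as (d & Hd & Hdd).
  exists (Rmin d H). split; [apply Rmin_glb_lt; assumption|]. intros e Hee.
  pose proof (Rmin_l d H). pose proof (Rmin_r d H).
  pose proof (mean_value_ineq 0 e eta (fun r => T r w ⊖ r ⊙ B v) (ltac:(lra))) as Hm.
  cbv beta in Hm. rewrite (sg_0 _ _ _ _ HT), Rminus_0_r in Hm.
  replace (T e w ⊖ w ⊖ e ⊙ B v) with (T e w ⊖ e ⊙ B v ⊖ (w ⊖ 0 ⊙ B v)) by lin_eq.
  assert (Hid : forall s, diff_in 0 e (fun r => r ⊙ B v) s (B v)).
  { intros s eps Hep. exists 1. split; [lra|]. intros r _ _.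
    replace (r ⊙ B v ⊖ s ⊙ B v ⊖ (r - s) ⊙ B v) with (vzero : X) by lin_eq.
    rewrite norm_vzero. apply Rmult_le_pos; [lra|apply Rabs_pos]. }
  apply Hm.
  - intros s Hs. apply cont_in_minus; [|eapply diff_in_cont, Hid].
    intros eps Hep. destruct (sg_cont_in HT w s (ltac:(lra)) eps Hep) as (d' & Hd' & Hdd').
    exists d'. split; [exact Hd'|]. intros r Hr. apply Hdd'. lra.
  - intros s Hs. exists (T s (B v) ⊖ B v). split; [apply Hdd; lra|].
    apply diff_in_minus; [|apply Hid].
    destruct (sg_deriv _ _ _ _ HT s) as (D & _ & HD & _); [lra|].
    rewrite <- (Hder s D (proj1 Hs) HD). apply op_deriv_diff_in; [lra|exact HD].
Qed.

Definition in_dom (T : R -> X -> X) x : Prop := exists y, is_gen T x y.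

Lemma in_dom_plus x y : in_dom T x -> in_dom T y -> in_dom T (x ⊕ y).
Proof. intros [x' Hx] [y' Hy]. exists (x' ⊕ y'). apply (is_gen_plus HT); assumption. Qed.

Lemma in_dom_scal r x : in_dom T x -> in_dom T (r ⊙ x).
Proof. intros [x' Hx]. exists (r ⊙ x'). apply (is_gen_scal HT), Hx. Qed.

Lemma in_dom_zero : in_dom T vzero.
Proof.
  exists vzero. intros eta He. exists 1. split; [lra|]. intros e Hee.
  rewrite (lin_zero _ (sg_lin _ _ _ _ HT e (ltac:(lra)))).
  replace (vzero ⊖ vzero ⊖ e ⊙ vzero) with (vzero : X) by lin_eq. rewrite norm_vzero. nra.
Qed.

Fixpoint smoothing (f : cfun) : Prop :=
  match f with
  | Phi k c => (1 <= k)%nat /\ 0 < c <= 1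
  | Zero => True
  | Defs.Add f g | Sub f g => smoothing f /\ smoothing g
  | Scale _ f => smoothing f
  end.

Lemma at_op_in_dom f h v : 0 < h <= H -> smoothing f -> in_dom T (at_op f T h v).
Proof.
  intros Hh. induction f as [k c | | f IHf g IHg | f IHf g IHg | r f IHf]; simpl; intros Hf.
  - rewrite at_op_Phi. destruct k as [|k]; [lia|]. eexists. apply phiT_gen. nra.
  - apply in_dom_zero.
  - rewrite at_op_Add. apply in_dom_plus; tauto.
  - rewrite at_op_Sub.
    replace (at_op f T h v ⊖ at_op g T h v) with (at_op f T h v ⊕ (-1) ⊙ at_op g T h v) by lin_eq.
    apply in_dom_plus; [tauto|]. apply in_dom_scal; tauto.
  - rewrite at_op_Scale. apply in_dom_scal; tauto.
Qed.

End Domain.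

(** * The nonlinearity along the exact solution *)

Lemma deriv_on_diff_in {X : CompleteNormedModule R_AbsRing} (a b : R) (u : R -> X) t l :
  a <= t <= b -> deriv_on a b u t l -> diff_in a b u t l.
Proof.
  intros Ht [_ Hd] eps He.
  destruct (Hd t (fun P HP => filter_imp _ _ (fun r Hr _ => Hr) HP) (mkposreal eps He)) as (d & Hdd).
  exists d. split; [apply cond_pos|]. intros r Hr Hrt. exact (Hdd r Hrt Hr).
Qed.

Lemma diff_in_ext {V : NormedModule R_AbsRing} a b (y1 y2 : R -> V) s l :
  a <= s <= b -> (forall r, a <= r <= b -> y1 r = y2 r) -> diff_in a b y1 s l -> diff_in a b y2 s l.
Proof.
  intros Hs E H eps He. destruct (H eps He) as (d & Hd & Hdd).
  exists d. split; [exact Hd|]. intros r Hr Hrs. rewrite <- !E by assumption. apply Hdd; assumption.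
Qed.

Lemma cont_in_bounded {V : NormedModule R_AbsRing} a b (y : R -> V) : a <= b ->
  (forall s, a <= s <= b -> cont_in a b y s) ->
  exists B, forall s, a <= s <= b -> norm (y s) <= B.
Proof.
  intros Hab Hc.
  destruct (continuity_ab_maj (fun s => norm (y (clamp a b s))) a b Hab) as (m & Hm & _).
  - intros s Hs eps He.
    destruct (Hc (clamp a b s) (clamp_in a b s Hab) (eps / 2)) as (d & Hd & Hdd); [lra|].
    exists d. split; [exact Hd|]. intros r [_ Hr]. unfold dist in *; simpl in *.
    unfold R_dist in *.
    assert (Hy : norm (y (clamp a b r) ⊖ y (clamp a b s)) <= eps / 2).
    { apply Hdd; [apply clamp_in, Hab|].
      eapply Rle_lt_trans; [apply clamp_lipschitz|exact Hr]. }
    pose proof (norm_le_add_minus (y (clamp a b r)) (y (clamp a b s))).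
    pose proof (norm_le_add_minus (y (clamp a b s)) (y (clamp a b r))) as H2.
    rewrite norm_minus_sym in H2. apply Rabs_def1; lra.
  - exists (norm (y (clamp a b m))). intros s Hs. specialize (Hm s Hs). cbv beta in Hm.
    rewrite (clamp_id a b s) in Hm by exact Hs. exact Hm.
Qed.

Lemma bounded_family {V : Type} (P : V -> Prop) (F : nat -> V -> R) n :
  (forall k, (k <= n)%nat -> exists B, forall v, P v -> F k v <= B) ->
  exists B, 1 <= B /\ forall k v, (k <= n)%nat -> P v -> F k v <= B.
Proof.
  intros H. induction n as [|n IH].
  - destruct (H 0%nat (le_n 0)) as (B & HB). exists (Rmax 1 B). split; [apply Rmax_l|].
    intros k v Hk Hv. replace k with 0%nat by lia.
    eapply Rle_trans; [apply HB, Hv|apply Rmax_r].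
  - destruct IH as (B1 & HB1 & G1); [intros k Hk; apply H; lia|].
    destruct (H (S n) (le_n _)) as (B2 & G2).
    exists (Rmax B1 B2). split; [eapply Rle_trans; [exact HB1|apply Rmax_l]|].
    intros k v Hk Hv. destruct (Nat.eq_dec k (S n)) as [->|Hne].
    + eapply Rle_trans; [apply G2, Hv|apply Rmax_r].
    + eapply Rle_trans; [apply G1; [lia|exact Hv]|apply Rmax_l].
Qed.

Lemma diff_in_plus {V : NormedModule R_AbsRing} a b (y1 y2 : R -> V) s l1 l2 :
  diff_in a b y1 s l1 -> diff_in a b y2 s l2 -> diff_in a b (fun r => y1 r ⊕ y2 r) s (l1 ⊕ l2).
Proof.
  intros H1 H2 eps He.
  destruct (H1 (eps / 2)) as (d1 & Hd1 & G1); [lra|].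
  destruct (H2 (eps / 2)) as (d2 & Hd2 & G2); [lra|].
  exists (Rmin d1 d2). split; [apply Rmin_glb_lt; assumption|]. intros r Hr Hrs.
  specialize (G1 r Hr (Rlt_le_trans _ _ _ Hrs (Rmin_l _ _))).
  specialize (G2 r Hr (Rlt_le_trans _ _ _ Hrs (Rmin_r _ _))).
  replace (y1 r ⊕ y2 r ⊖ (y1 s ⊕ y2 s) ⊖ (r - s) ⊙ (l1 ⊕ l2)) with
    ((y1 r ⊖ y1 s ⊖ (r - s) ⊙ l1) ⊕ (y2 r ⊖ y2 s ⊖ (r - s) ⊙ l2)) by lin_eq.
  eapply Rle_trans; [apply norm_plus_le|]. lra.
Qed.

Lemma diff_in_small {V : NormedModule R_AbsRing} a b (y : R -> V) s (c : R) (e : R -> R) :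
  y s = vzero -> 0 <= c ->
  (forall eps, 0 < eps -> exists delta, 0 < delta /\
    forall r, a <= r <= b -> Rabs (r - s) < delta -> e r <= eps * Rabs (r - s)) ->
  (forall r, a <= r <= b -> norm (y r) <= c * e r) ->
  diff_in a b y s vzero.
Proof.
  intros Hy Hc He Hb eps Heps.
  destruct (He (eps / (c + 1))) as (d & Hd & Hdd); [apply Rdiv_lt_0_compat; lra|].
  exists d. split; [exact Hd|]. intros r Hr Hrs.
  rewrite Hy. replace (y r ⊖ vzero ⊖ (r - s) ⊙ vzero) with (y r) by lin_eq.
  eapply Rle_trans; [apply Hb, Hr|]. specialize (Hdd r Hr Hrs).
  pose proof (Rabs_pos (r - s)).
  apply Rle_trans with (c * (eps / (c + 1) * Rabs (r - s))); [apply Rmult_le_compat_l; lra|].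
  apply Rle_trans with ((c + 1) * (eps / (c + 1) * Rabs (r - s))); [|right; field; lra].
  apply Rmult_le_compat_r; [|lra]. apply Rmult_le_pos; [apply Rlt_le, Rdiv_lt_0_compat; lra|lra].
Qed.

Definition tsum {V : NormedModule R_AbsRing} (F : list nat -> V) (l : list (list nat)) : V :=
  fold_right (fun p s => F p ⊕ s) vzero l.

Lemma tsum_app {V : NormedModule R_AbsRing} (F : list nat -> V) l1 l2 :
  tsum F (l1 ++ l2) = tsum F l1 ⊕ tsum F l2.
Proof.
  induction l1 as [|p l1 IH]; cbn [app].
  - change (tsum F []) with (vzero : V). lin_eq.
  - change (tsum F (p :: l1 ++ l2)) with (F p ⊕ tsum F (l1 ++ l2)).
    change (tsum F (p :: l1)) with (F p ⊕ tsum F l1). rewrite IH. lin_eq.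
Qed.

Lemma tsum_map {V : NormedModule R_AbsRing} (F : list nat -> V) (G : list nat -> list nat) l :
  tsum F (map G l) = tsum (fun p => F (G p)) l.
Proof. induction l as [|p l IH]; [reflexivity|]. cbn. unfold tsum in IH. rewrite IH. reflexivity. Qed.

Lemma norm_tsum_le {V : NormedModule R_AbsRing} (F : list nat -> V) l c :
  (forall p, In p l -> norm (F p) <= c) -> norm (tsum F l) <= INR (length l) * c.
Proof.
  induction l as [|p l IH]; intros H.
  - cbn. rewrite norm_vzero. lra.
  - cbn [tsum fold_right length]. fold (tsum F l). rewrite S_INR.
    eapply Rle_trans; [apply norm_plus_le|].
    pose proof (H p (or_introl eq_refl)).
    specialize (IH (fun q Hq => H q (or_intror Hq))). lra.
Qed.

(* The term [i_1; ...; i_k] stands for g^(k)(u)(u^(i_1), ..., u^(i_k)); its time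
   derivative is the sum of the terms in [term_deriv]. *)
Fixpoint increments (p : list nat) : list (list nat) :=
  match p with
  | [] => []
  | i :: p => (S i :: p) :: map (cons i) (increments p)
  end.

Definition term_deriv (p : list nat) : list (list nat) := (1%nat :: p) :: increments p.

Fixpoint terms (m : nat) : list (list nat) :=
  match m with O => [[]] | S m => flat_map term_deriv (terms m) end.

Lemma increments_bound p m n : List.Forall (fun i => (i <= m)%nat) p -> length p = n ->
  forall q, In q (increments p) -> List.Forall (fun i => (i <= S m)%nat) q /\ length q = n.
Proof.
  intros Hp. revert n. induction Hp as [|i p Hi Hp IH]; intros n Hn q; [intros []|].
  simpl in Hn. destruct n as [|n]; [discriminate|]. injection Hn as Hn.
  intros [<-|Hq].
  - split; [|simpl; lia]. constructor; [lia|]. eapply List.Forall_impl; [|exact Hp]. simpl; lia.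
  - apply in_map_iff in Hq. destruct Hq as (q' & <- & Hq').
    destruct (IH n Hn q' Hq') as [H1 H2]. split; [constructor; [lia|exact H1]|simpl; lia].
Qed.

Lemma terms_bound m p : In p (terms m) ->
  List.Forall (fun i => (i <= m)%nat) p /\ (length p <= m)%nat /\ ((1 <= m)%nat -> (1 <= length p)%nat).
Proof.
  revert p. induction m as [|m IH]; intros p Hp.
  - destruct Hp as [<-|[]]. split; [constructor|]. simpl. lia.
  - simpl in Hp. apply in_flat_map in Hp. destruct Hp as (q & Hq & Hp).
    destruct (IH q Hq) as (H1 & H2 & H3). destruct Hp as [<-|Hp].
    + split; [|simpl; lia]. constructor; [lia|]. eapply List.Forall_impl; [|exact H1]. simpl; lia.
    + destruct (increments_bound q m (length q) H1 eq_refl p Hp) as [H4 H5].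
      split; [exact H4|]. rewrite H5. split; [lia|]. intros _.
      destruct m as [|m]; [|apply H3; lia].
      destruct Hq as [<-|[]]. destruct Hp.
Qed.

Section Composite.

Context {X : CompleteNormedModule R_AbsRing}.
Variables (N : nat) (a b rho : R) (u : R -> X) (g : X -> X).
Variables (du : nat -> R -> X) (dg : X -> list X -> X) (M B : R).
Hypothesis Hab : a <= b.
Hypothesis rho_pos : 0 < rho.
Hypothesis du_0 : forall t, a <= t <= b -> du 0%nat t = u t.
Hypothesis du_diff : forall k t, (k < N)%nat -> a <= t <= b -> diff_in a b (du k) t (du (S k) t).
Hypothesis B_ge_1 : 1 <= B.
Hypothesis du_bound : forall k t, (k <= N)%nat -> a <= t <= b -> norm (du k t) <= B.
Hypothesis dg_0 : forall x, strip a b u rho x -> dg x nil = g x.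
Hypothesis dg_lin : forall x l1 l2 v w r, strip a b u rho x ->
  (length l1 + S (length l2) <= N)%nat ->
  dg x (l1 ++ v ⊕ r ⊙ w :: l2) = dg x (l1 ++ v :: l2) ⊕ r ⊙ dg x (l1 ++ w :: l2).
Hypothesis M_pos : 0 <= M.
Hypothesis dg_bound : forall x l, strip a b u rho x -> (1 <= length l <= N)%nat ->
  norm (dg x l) <= M * prod_norms l.
Hypothesis dg_diff : forall x k, strip a b u rho x -> (k < N)%nat ->
  forall eps, 0 < eps -> exists delta, 0 < delta /\
  forall y, strip a b u rho y -> norm (y ⊖ x) < delta ->
  forall l, length l = k ->
  norm (dg y l ⊖ dg x l ⊖ dg x (y ⊖ x :: l)) <= eps * norm (y ⊖ x) * prod_norms l.

Lemma strip_u t : a <= t <= b -> strip a b u rho (u t).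
Proof.
  intros Ht. exists t. split; [exact Ht|]. change (norm (u t ⊖ u t) < rho).
  rewrite norm_minus_self. exact rho_pos.
Qed.

Lemma dg_zero x l1 l2 : strip a b u rho x -> (length l1 + S (length l2) <= N)%nat ->
  dg x (l1 ++ vzero :: l2) = vzero.
Proof.
  intros Hx Hl. pose proof (dg_lin x l1 l2 vzero vzero (-1) Hx Hl) as E.
  replace ((vzero : X) ⊕ -1 ⊙ vzero) with (vzero : X) in E by lin_eq.
  rewrite E. lin_eq.
Qed.

Lemma dg_scal x l1 l2 r w : strip a b u rho x -> (length l1 + S (length l2) <= N)%nat ->
  dg x (l1 ++ r ⊙ w :: l2) = r ⊙ dg x (l1 ++ w :: l2).
Proof.
  intros Hx Hl. pose proof (dg_lin x l1 l2 vzero w r Hx Hl) as E.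
  replace (vzero ⊕ r ⊙ w) with (r ⊙ w) in E by lin_eq.
  rewrite E, dg_zero by assumption. lin_eq.
Qed.

Lemma dg_minus x l1 l2 v w : strip a b u rho x -> (length l1 + S (length l2) <= N)%nat ->
  dg x (l1 ++ v ⊖ w :: l2) = dg x (l1 ++ v :: l2) ⊖ dg x (l1 ++ w :: l2).
Proof.
  intros Hx Hl. pose proof (dg_lin x l1 l2 v w (-1) Hx Hl) as E.
  replace (v ⊕ -1 ⊙ w) with (v ⊖ w) in E by lin_eq. rewrite E. lin_eq.
Qed.

Lemma prod_norms_app (l1 l2 : list X) : prod_norms (l1 ++ l2) = prod_norms l1 * prod_norms l2.
Proof.
  induction l1 as [|v l1 IH]; cbn [app prod_norms fold_right]; [rewrite Rmult_1_l; reflexivity|].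
  fold (prod_norms (l1 ++ l2)). fold (prod_norms l1). rewrite IH. ring.
Qed.

Lemma prod_norms_pos (l : list X) : 0 <= prod_norms l.
Proof.
  induction l as [|v l IH]; cbn [prod_norms fold_right]; [lra|].
  apply Rmult_le_pos; [apply norm_ge_0|exact IH].
Qed.

Definition args (p : list nat) (t : R) : list X := map (fun i => du i t) p.

Lemma prod_norms_args p t : List.Forall (fun i => (i <= N)%nat) p -> a <= t <= b ->
  prod_norms (args p t) <= B ^ length p.
Proof.
  intros Hp Ht. induction Hp as [|i p Hi Hp IH]; cbn [args map prod_norms fold_right length pow]; [lra|].
  apply Rmult_le_compat; [apply norm_ge_0|apply prod_norms_pos|apply du_bound; assumption|exact IH].
Qed.

Lemma length_args p t : length (args p t) = length p.
Proof. apply length_map. Qed.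

(** Product rule in the arguments at a fixed base point. The list [l1] holds arguments already
    frozen, so the induction runs along p; its hypothesis is used with the value of the current
    argument and, for the mixed term, with its derivative. *)
Lemma args_diff x p t : strip a b u rho x -> a <= t <= b -> List.Forall (fun i => (i < N)%nat) p ->
  forall l1, (length l1 + length p <= N)%nat ->
  diff_in a b (fun r => dg x (l1 ++ args p r)) t (tsum (fun q => dg x (l1 ++ args q t)) (increments p)).
Proof.
  intros Hx Ht Hp. induction Hp as [|i p Hi Hp IH]; intros l1 Hl; cbn [increments].
  - exact (diff_in_const a b t (dg x (l1 ++ []))).
  - simpl in Hl. cbn [tsum fold_right]. fold (tsum (fun q => dg x (l1 ++ args q t)) (map (cons i) (increments p))).
    rewrite tsum_map.
    assert (Hp' : List.Forall (fun i => (i <= N)%nat) p) by (eapply List.Forall_impl; [|exact Hp]; simpl; lia).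
    assert (Hlen : forall r, (length l1 + S (length (args p r)) <= N)%nat)
      by (intros r; rewrite length_args; lia).
    set (v0 := du i t). set (v1 := du (S i) t).
    pose proof (IH (l1 ++ [v0]) (ltac:(rewrite length_app; simpl; lia))) as D0.
    pose proof (IH (l1 ++ [v1]) (ltac:(rewrite length_app; simpl; lia))) as D1.
    apply diff_in_cont in D1.
    (* The current argument is expanded to first order. Its remainder and the mixed term have
       derivative zero; the last two summands give the terms of the product rule. *)
    apply (diff_in_ext a b (fun r =>
      (dg x (l1 ++ (du i r ⊖ v0 ⊖ (r - t) ⊙ v1) :: args p r)
       ⊕ ((r - t) ⊙ (dg x ((l1 ++ [v1]) ++ args p r) ⊖ dg x ((l1 ++ [v1]) ++ args p t))))
      ⊕ ((r - t) ⊙ dg x ((l1 ++ [v1]) ++ args p t) ⊕ dg x ((l1 ++ [v0]) ++ args p r)))); [exact Ht| |].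
    { intros r Hr. rewrite <- !app_assoc. cbn [app args map].
      fold (args p r). fold (args p t).
      rewrite !dg_minus, dg_scal by (exact Hx || apply Hlen). lin_eq. }
    replace (dg x (l1 ++ args (S i :: p) t) ⊕ tsum (fun p0 => dg x (l1 ++ args (i :: p0) t)) (increments p))
      with ((vzero ⊕ vzero) ⊕ (dg x (l1 ++ args (S i :: p) t)
        ⊕ tsum (fun p0 => dg x (l1 ++ args (i :: p0) t)) (increments p))) by lin_eq.
    apply diff_in_plus; [apply diff_in_plus|apply diff_in_plus].
    + apply (diff_in_small a b _ t (M * (prod_norms l1 * B ^ length p))
        (fun r => norm (du i r ⊖ v0 ⊖ (r - t) ⊙ v1))).
      * replace (du i t ⊖ v0 ⊖ (t - t) ⊙ v1) with (vzero : X) by (unfold v0; lin_eq).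
        apply dg_zero; [exact Hx|apply Hlen].
      * apply Rmult_le_pos; [exact M_pos|]. apply Rmult_le_pos; [apply prod_norms_pos|apply pow_le; lra].
      * intros eps He. destruct (du_diff i t Hi Ht eps He) as (d & Hd & Hdd).
        exists d. split; [exact Hd|exact Hdd].
      * intros r Hr. eapply Rle_trans; [apply dg_bound; [exact Hx|]|].
        { rewrite length_app. cbn [length]. rewrite length_args. lia. }
        rewrite prod_norms_app. cbn [prod_norms fold_right]. fold (prod_norms (args p r)).
        rewrite Rmult_assoc. apply Rmult_le_compat_l; [exact M_pos|].
        rewrite Rmult_assoc. apply Rmult_le_compat_l; [apply prod_norms_pos|].
        rewrite Rmult_comm. apply Rmult_le_compat_r; [apply norm_ge_0|].
        apply prod_norms_args; assumption.
    + apply (diff_in_small a b _ t 1 (fun r => Rabs (r - t) *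
        norm (dg x ((l1 ++ [v1]) ++ args p r) ⊖ dg x ((l1 ++ [v1]) ++ args p t)))).
      * lin_eq.
      * lra.
      * intros eps He. destruct (D1 eps He) as (d & Hd & Hdd). exists d. split; [exact Hd|].
        intros r Hr Hrt. rewrite Rmult_comm. apply Rmult_le_compat_r; [apply Rabs_pos|].
        apply Hdd; assumption.
      * intros r Hr. rewrite Rmult_1_l. apply norm_scal_le.
    + replace (dg x (l1 ++ args (S i :: p) t)) with (dg x ((l1 ++ [v1]) ++ args p t))
        by (rewrite <- app_assoc; reflexivity).
      intros eps He. exists 1. split; [lra|]. intros r _ _.
      match goal with |- norm ?e <= _ => replace e with (vzero : X) by lin_eq end.
      rewrite norm_vzero. apply Rmult_le_pos; [lra|apply Rabs_pos].
    + intros eps He. destruct (D0 eps He) as (d & Hd & Hdd). exists d. split; [exact Hd|].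
      intros r Hr Hrt. specialize (Hdd r Hr Hrt).
      assert (E : tsum (fun p0 => dg x (l1 ++ args (i :: p0) t)) (increments p) =
        tsum (fun q => dg x ((l1 ++ [v0]) ++ args q t)) (increments p)).
      { generalize (increments p). intros L. induction L as [|q L IHL]; [reflexivity|].
        cbn [tsum fold_right]. f_equal; [rewrite <- app_assoc; reflexivity|exact IHL]. }
      rewrite E. exact Hdd.
Qed.

Lemma u_diff t : (0 < N)%nat -> a <= t <= b -> diff_in a b u t (du 1%nat t).
Proof.
  intros HN Ht. apply (diff_in_ext a b (du 0%nat)); [exact Ht|apply du_0|].
  apply du_diff; assumption.
Qed.

Definition term (p : list nat) (t : R) : X := dg (u t) (args p t).

(** The base point and the arguments move together. Differentiability of [dg] is uniform over
    bounded arguments, so the base point can be expanded while the arguments are still taken at r;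
    the expansion inserts u' as a new first argument. *)
Lemma term_diff p t : a <= t <= b -> (length p < N)%nat -> List.Forall (fun i => (i < N)%nat) p ->
  diff_in a b (term p) t (tsum (fun q => term q t) (term_deriv p)).
Proof.
  intros Ht Hlen Hp. pose proof (strip_u t Ht) as Hx.
  assert (HN : (0 < N)%nat) by lia.
  assert (Hp' : List.Forall (fun i => (i <= N)%nat) p) by (eapply List.Forall_impl; [|exact Hp]; simpl; lia).
  pose proof (u_diff t HN Ht) as Hu.
  pose proof (diff_in_cont _ _ _ _ _ Hu) as Huc.
  assert (Hl0 : forall r, (length (@nil X) + S (length (args p r)) <= N)%nat)
    by (intros r; rewrite length_args; simpl; lia).
  pose proof (args_diff (u t) p t Hx Ht Hp [] (ltac:(simpl; lia))) as D0.
  pose proof (args_diff (u t) p t Hx Ht Hp [du 1%nat t] (ltac:(simpl; lia))) as D1.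
  apply diff_in_cont in D1. cbn [app] in D0, D1.
  set (v1 := du 1%nat t) in *.
  apply (diff_in_ext a b (fun r =>
    ((dg (u r) (args p r) ⊖ dg (u t) (args p r) ⊖ dg (u t) (u r ⊖ u t :: args p r))
     ⊕ (dg (u t) (u r ⊖ u t ⊖ (r - t) ⊙ v1 :: args p r)
        ⊕ (r - t) ⊙ (dg (u t) (v1 :: args p r) ⊖ dg (u t) (v1 :: args p t))))
    ⊕ ((r - t) ⊙ dg (u t) (v1 :: args p t) ⊕ dg (u t) (args p r)))); [exact Ht| |].
  { intros r Hr. unfold term.
    pose proof (dg_minus (u t) [] (args p r) (u r ⊖ u t) ((r - t) ⊙ v1) Hx (Hl0 r)) as E1.
    pose proof (dg_scal (u t) [] (args p r) (r - t) v1 Hx (Hl0 r)) as E2.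
    cbn [app] in E1, E2. rewrite E1, E2. lin_eq. }
  cbn [term_deriv tsum fold_right]. fold (tsum (fun q => term q t) (increments p)).
  replace (term (1%nat :: p) t ⊕ tsum (fun q => term q t) (increments p)) with
    ((vzero ⊕ (vzero ⊕ vzero)) ⊕ (term (1%nat :: p) t ⊕ tsum (fun q => term q t) (increments p)))
    by lin_eq.
  apply diff_in_plus; [apply diff_in_plus; [|apply diff_in_plus]|apply diff_in_plus].
  - intros eps He.
    destruct (Hu 1 Rlt_0_1) as (d1 & Hd1 & G1).
    set (K := (1 + norm v1) * B ^ length p).
    assert (HK : 0 < K).
    { apply Rmult_lt_0_compat; [pose proof (norm_ge_0 v1); lra|apply pow_lt; lra]. }
    destruct (dg_diff (u t) (length p) Hx Hlen (eps / K)) as (d2 & Hd2 & G2).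
    { apply Rdiv_lt_0_compat; lra. }
    destruct (Huc (d2 / 2)) as (d3 & Hd3 & G3); [lra|].
    exists (Rmin d1 d3). split; [apply Rmin_glb_lt; assumption|]. intros r Hr Hrt.
    specialize (G1 r Hr (Rlt_le_trans _ _ _ Hrt (Rmin_l _ _))).
    specialize (G3 r Hr (Rlt_le_trans _ _ _ Hrt (Rmin_r _ _))).
    specialize (G2 (u r) (strip_u r Hr) (ltac:(lra)) (args p r) (length_args p r)).
    pose proof (dg_zero (u t) [] (args p t) Hx (Hl0 t)) as E. cbn [app] in E.
    replace (u t ⊖ u t) with (vzero : X) by lin_eq. rewrite E.
    match goal with |- norm ?e <= _ => replace e with
      (dg (u r) (args p r) ⊖ dg (u t) (args p r) ⊖ dg (u t) (u r ⊖ u t :: args p r)) by lin_eq end.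
    eapply Rle_trans; [exact G2|].
    pose proof (norm_le_add_minus (u r ⊖ u t) ((r - t) ⊙ v1)) as N1.
    pose proof (norm_scal_le (r - t) v1) as N2.
    pose proof (prod_norms_args p r Hp' Hr) as N3.
    apply Rle_trans with (eps / K * ((1 + norm v1) * Rabs (r - t)) * B ^ length p).
    + apply Rmult_le_compat; [|apply prod_norms_pos| |exact N3].
      * apply Rmult_le_pos; [apply Rlt_le, Rdiv_lt_0_compat; lra|apply norm_ge_0].
      * apply Rmult_le_compat_l; [apply Rlt_le, Rdiv_lt_0_compat; lra|lra].
    + right. unfold K. field. split; [apply pow_nonzero; lra|pose proof (norm_ge_0 v1); lra].
  - apply (diff_in_small a b _ t (M * B ^ length p)
      (fun r => norm (u r ⊖ u t ⊖ (r - t) ⊙ v1))).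
    + replace (u t ⊖ u t ⊖ (t - t) ⊙ v1) with (vzero : X) by lin_eq.
      apply (dg_zero (u t) [] (args p t) Hx (Hl0 t)).
    + apply Rmult_le_pos; [exact M_pos|apply pow_le; lra].
    + intros eps He. destruct (Hu eps He) as (d & Hd & Hdd). exists d. split; [exact Hd|exact Hdd].
    + intros r Hr. eapply Rle_trans; [apply dg_bound; [exact Hx|]|].
      { cbn [length]. rewrite length_args. lia. }
      cbn [prod_norms fold_right]. fold (prod_norms (args p r)).
      rewrite Rmult_assoc. apply Rmult_le_compat_l; [exact M_pos|].
      rewrite Rmult_comm. apply Rmult_le_compat_r; [apply norm_ge_0|].
      apply prod_norms_args; assumption.
  - apply (diff_in_small a b _ t 1 (fun r => Rabs (r - t) *
      norm (dg (u t) (v1 :: args p r) ⊖ dg (u t) (v1 :: args p t)))).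
    + lin_eq.
    + lra.
    + intros eps He. destruct (D1 eps He) as (d & Hd & Hdd). exists d. split; [exact Hd|].
      intros r Hr Hrt. rewrite Rmult_comm. apply Rmult_le_compat_r; [apply Rabs_pos|].
      apply Hdd; assumption.
    + intros r Hr. rewrite Rmult_1_l. apply norm_scal_le.
  - change (term (1%nat :: p) t) with (dg (u t) (v1 :: args p t)).
    intros eps He. exists 1. split; [lra|]. intros r _ _.
    match goal with |- norm ?e <= _ => replace e with (vzero : X) by lin_eq end.
    rewrite norm_vzero. apply Rmult_le_pos; [lra|apply Rabs_pos].
  - exact D0.
Qed.

Definition composite_deriv (m : nat) (t : R) : X := tsum (fun p => term p t) (terms m).

Lemma composite_deriv_0 t : a <= t <= b -> composite_deriv 0 t = g (u t).
Proof.
  intros Ht. unfold composite_deriv. cbn [terms tsum fold_right].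
  unfold term. cbn [args map]. rewrite dg_0 by apply strip_u, Ht. lin_eq.
Qed.

Lemma tsum_flat_map (F : list nat -> X) (G : list nat -> list (list nat)) l :
  tsum F (flat_map G l) = tsum (fun p => tsum F (G p)) l.
Proof.
  induction l as [|p l IH]; [reflexivity|].
  cbn [flat_map]. rewrite tsum_app, IH. reflexivity.
Qed.

Lemma composite_deriv_diff m t : (m < N)%nat -> a <= t <= b ->
  diff_in a b (composite_deriv m) t (composite_deriv (S m) t).
Proof.
  intros Hm Ht. unfold composite_deriv at 2. cbn [terms]. rewrite tsum_flat_map.
  unfold composite_deriv.
  assert (Hall : forall p, In p (terms m) -> (length p < N)%nat /\ List.Forall (fun i => (i < N)%nat) p).
  { intros p Hp. destruct (terms_bound m p Hp) as (H1 & H2 & _). split; [lia|].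
    eapply List.Forall_impl; [|exact H1]. simpl; lia. }
  induction (terms m) as [|p l IH].
  - exact (diff_in_const a b t vzero).
  - cbn [tsum fold_right]. apply diff_in_plus.
    + apply term_diff; [exact Ht|apply Hall; left; reflexivity|apply Hall; left; reflexivity].
    + apply IH. intros q Hq. apply Hall. right. exact Hq.
Qed.

(** For m >= 1 every term contains a derivative of g of order at least 1, and these are the ones
    with a uniform bound. *)
Lemma composite_deriv_bound m : (1 <= m <= N)%nat ->
  exists K, forall t, a <= t <= b -> norm (composite_deriv m t) <= K.
Proof.
  intros Hm. exists (INR (length (terms m)) * (M * B ^ m)). intros t Ht.
  apply norm_tsum_le. intros p Hp. destruct (terms_bound m p Hp) as (H1 & H2 & H3).
  unfold term. eapply Rle_trans; [apply dg_bound; [apply strip_u, Ht|]|].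
  - rewrite length_args. specialize (H3 (proj1 Hm)). lia.
  - apply Rmult_le_compat_l; [exact M_pos|].
    eapply Rle_trans; [apply prod_norms_args; [|exact Ht]|].
    + eapply List.Forall_impl; [|exact H1]. simpl; lia.
    + apply Rle_pow; [exact B_ge_1|exact H2].
Qed.

Definition jacobian (t : R) (v : X) : X := dg (u t) [v].

Lemma jacobian_bound t v : (1 <= N)%nat -> a <= t <= b -> norm (jacobian t v) <= M * norm v.
Proof.
  intros HN Ht. eapply Rle_trans; [apply dg_bound; [apply strip_u, Ht|simpl; lia]|].
  cbn [prod_norms fold_right]. rewrite Rmult_1_r. lra.
Qed.

Lemma jacobian_linear t : (1 <= N)%nat -> a <= t <= b -> is_linear (jacobian t).
Proof.
  intros HN Ht. pose proof (strip_u t Ht) as Hx. apply (linear_intro _ M).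
  - intros v w. pose proof (dg_lin (u t) [] [] v w 1 Hx (ltac:(simpl; lia))) as E. cbn [app] in E.
    replace (v ⊕ 1 ⊙ w) with (v ⊕ w) in E by lin_eq.
    etransitivity; [exact E|]. unfold jacobian. lin_eq.
  - intros r v. apply (dg_scal (u t) [] [] r v Hx). simpl; lia.
  - intros v. apply jacobian_bound; assumption.
Qed.

(** The derivative of g'(u(t)) v in t is g''(u(t)) (u'(t), v). *)
Lemma jacobian_lipschitz t s v : (2 <= N)%nat -> a <= s -> s <= t -> t <= b ->
  norm (jacobian t v ⊖ jacobian s v) <= M * B * norm v * (t - s).
Proof.
  intros HN Has Hst Htb. apply (mean_value_diff s t _ (fun r => jacobian r v) Hst).
  intros r Hr. assert (Hr' : a <= r <= b) by lra. pose proof (strip_u r Hr') as Hx.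
  exists (dg (u r) [du 1%nat r; v]). split.
  - eapply Rle_trans; [apply dg_bound; [exact Hx|simpl; lia]|].
    cbn [prod_norms fold_right]. rewrite Rmult_1_r, Rmult_assoc.
    apply Rmult_le_compat_l; [exact M_pos|].
    apply Rmult_le_compat_r; [apply norm_ge_0|apply du_bound; [lia|exact Hr']].
  - pose proof (u_diff r (ltac:(lia)) Hr') as Hu.
    set (v1 := du 1%nat r) in *. intros eps He.
    pose proof (norm_ge_0 v) as Hv. pose proof (norm_ge_0 v1) as Hv1.
    destruct (Hu (Rmin 1 (eps / (2 * (M * norm v + 1))))) as (d1 & Hd1 & G1).
    { apply Rmin_glb_lt; [lra|]. apply Rdiv_lt_0_compat; [lra|].
      assert (0 <= M * norm v) by (apply Rmult_le_pos; lra). lra. }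
    set (K := (1 + norm v1) * (norm v + 1)).
    assert (HK : 0 < K) by (apply Rmult_lt_0_compat; lra).
    destruct (dg_diff (u r) 1%nat Hx (ltac:(lia)) (eps / (2 * K))) as (d2 & Hd2 & G2).
    { apply Rdiv_lt_0_compat; lra. }
    destruct (diff_in_cont _ _ _ _ _ Hu (d2 / 2)) as (d3 & Hd3 & G3); [lra|].
    exists (Rmin d1 d3). split; [apply Rmin_glb_lt; assumption|]. intros q Hq Hqr.
    assert (Hq' : a <= q <= b) by lra.
    specialize (G1 q Hq' (Rlt_le_trans _ _ _ Hqr (Rmin_l _ _))).
    specialize (G3 q Hq' (Rlt_le_trans _ _ _ Hqr (Rmin_r _ _))).
    specialize (G2 (u q) (strip_u q Hq') (ltac:(lra)) [v] eq_refl).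
    cbn [prod_norms fold_right] in G2. rewrite Rmult_1_r in G2.
    pose proof (Rmin_l 1 (eps / (2 * (M * norm v + 1)))) as m1.
    pose proof (Rmin_r 1 (eps / (2 * (M * norm v + 1)))) as m2.
    set (m := Rmin 1 (eps / (2 * (M * norm v + 1)))) in *.
    pose proof (Rabs_pos (q - r)) as Hqr0.
    pose proof (dg_minus (u r) [] [v] (u q ⊖ u r) ((q - r) ⊙ v1) Hx (ltac:(simpl; lia))) as E1.
    pose proof (dg_scal (u r) [] [v] (q - r) v1 Hx (ltac:(simpl; lia))) as E2.
    cbn [app] in E1, E2. rewrite E2 in E1.
    unfold jacobian.
    replace (dg (u q) [v] ⊖ dg (u r) [v] ⊖ (q - r) ⊙ dg (u r) [v1; v]) with
      ((dg (u q) [v] ⊖ dg (u r) [v] ⊖ dg (u r) [u q ⊖ u r; v]) ⊕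
       dg (u r) [u q ⊖ u r ⊖ (q - r) ⊙ v1; v]) by (rewrite E1; lin_eq).
    eapply Rle_trans; [apply norm_plus_le|].
    assert (A1 : norm (dg (u q) [v] ⊖ dg (u r) [v] ⊖ dg (u r) [u q ⊖ u r; v])
      <= eps / 2 * Rabs (q - r)).
    { eapply Rle_trans; [exact G2|].
      pose proof (norm_le_add_minus (u q ⊖ u r) ((q - r) ⊙ v1)) as N1.
      pose proof (norm_scal_le (q - r) v1) as N2.
      assert (m * Rabs (q - r) <= 1 * Rabs (q - r)) by (apply Rmult_le_compat_r; lra).
      apply Rle_trans with (eps / (2 * K) * ((1 + norm v1) * Rabs (q - r)) * (norm v + 1)).
      - apply Rmult_le_compat; [|exact Hv| |lra].
        + apply Rmult_le_pos; [apply Rlt_le, Rdiv_lt_0_compat; lra|apply norm_ge_0].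
        + apply Rmult_le_compat_l; [apply Rlt_le, Rdiv_lt_0_compat; lra|lra].
      - right. unfold K. field. split; lra. }
    assert (A2 : norm (dg (u r) [u q ⊖ u r ⊖ (q - r) ⊙ v1; v]) <= eps / 2 * Rabs (q - r)).
    { eapply Rle_trans; [apply dg_bound; [exact Hx|simpl; lia]|].
      cbn [prod_norms fold_right]. rewrite Rmult_1_r.
      assert (HMv : 0 <= M * norm v) by (apply Rmult_le_pos; lra).
      apply Rle_trans with (M * norm v * (eps / (2 * (M * norm v + 1)) * Rabs (q - r))).
      - replace (M * (norm (u q ⊖ u r ⊖ (q - r) ⊙ v1) * norm v)) with
          (M * norm v * norm (u q ⊖ u r ⊖ (q - r) ⊙ v1)) by ring.
        apply Rmult_le_compat_l; [exact HMv|]. eapply Rle_trans; [exact G1|].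
        apply Rmult_le_compat_r; lra.
      - apply Rle_trans with ((M * norm v + 1) * (eps / (2 * (M * norm v + 1)) * Rabs (q - r))).
        + apply Rmult_le_compat_r; [|lra].
          apply Rmult_le_pos; [apply Rlt_le, Rdiv_lt_0_compat; lra|lra].
        + right. field. lra. }
    lra.
Qed.

(** The strip is a union of balls about the points u(t) and need not be convex. It does contain the
    segment from a centre to a point of its ball, along which g is compared with g(u(t)). *)
Lemma strip_segment t d s : a <= t <= b -> norm d < rho -> 0 <= s <= 1 ->
  strip a b u rho (u t ⊕ s ⊙ d).
Proof.
  intros Ht Hd Hs. exists t. split; [exact Ht|].
  change (norm (u t ⊕ s ⊙ d ⊖ u t) < rho).
  replace (u t ⊕ s ⊙ d ⊖ u t) with (s ⊙ d) by lin_eq.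
  eapply Rle_lt_trans; [apply norm_scal_le|]. rewrite Rabs_right by lra.
  pose proof (norm_ge_0 d). nra.
Qed.

Lemma segment_diff t d l s : a <= t <= b -> norm d < rho -> (length l < N)%nat -> 0 <= s <= 1 ->
  diff_in 0 1 (fun q => dg (u t ⊕ q ⊙ d) l) s (dg (u t ⊕ s ⊙ d) (d :: l)).
Proof.
  intros Ht Hd Hl Hs eps He.
  pose proof (strip_segment t d s Ht Hd Hs) as Hx.
  pose proof (norm_ge_0 d) as Hd0. pose proof (prod_norms_pos l) as Hl0.
  set (K := (norm d + 1) * (prod_norms l + 1)).
  assert (HK : 0 < K) by (apply Rmult_lt_0_compat; lra).
  destruct (dg_diff _ (length l) Hx Hl (eps / K)) as (de & Hde & G).
  { apply Rdiv_lt_0_compat; lra. }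
  exists (de / (norm d + 1)). split; [apply Rdiv_lt_0_compat; lra|].
  intros q Hq Hqs.
  assert (Ed : u t ⊕ q ⊙ d ⊖ (u t ⊕ s ⊙ d) = (q - s) ⊙ d) by lin_eq.
  pose proof (norm_scal_le (q - s) d) as Hn.
  pose proof (Rabs_pos (q - s)) as Hqs0.
  specialize (G (u t ⊕ q ⊙ d) (strip_segment t d q Ht Hd Hq)). rewrite Ed in G.
  specialize (G (ltac:(
    apply (Rmult_lt_compat_r (norm d + 1)) in Hqs; [|lra];
    replace (de / (norm d + 1) * (norm d + 1)) with de in Hqs by (field; lra); nra)) l eq_refl).
  assert (El : dg (u t ⊕ s ⊙ d) ((q - s) ⊙ d :: l) = (q - s) ⊙ dg (u t ⊕ s ⊙ d) (d :: l))
    by (apply (dg_scal _ [] l (q - s) d Hx); simpl; lia).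
  rewrite <- El. eapply Rle_trans; [exact G|].
  apply Rle_trans with (eps / K * ((norm d + 1) * Rabs (q - s)) * (prod_norms l + 1)).
  - apply Rmult_le_compat; [|exact Hl0| |lra].
    + apply Rmult_le_pos; [apply Rlt_le, Rdiv_lt_0_compat; lra|apply norm_ge_0].
    + apply Rmult_le_compat_l; [apply Rlt_le, Rdiv_lt_0_compat; lra|]. nra.
  - right. unfold K. field. split; lra.
Qed.

Lemma segment_bound t d l s : a <= t <= b -> norm d < rho -> (length l < N)%nat -> 0 <= s <= 1 ->
  norm (dg (u t ⊕ s ⊙ d) l ⊖ dg (u t) l) <= M * (norm d * prod_norms l) * s.
Proof.
  intros Ht Hd Hl Hs.
  pose proof (mean_value_diff 0 s (M * (norm d * prod_norms l)) (fun q => dg (u t ⊕ q ⊙ d) l)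
    (proj1 Hs)) as Hm.
  cbv beta in Hm. rewrite Rminus_0_r in Hm.
  replace (u t ⊕ 0 ⊙ d) with (u t) in Hm by lin_eq. apply Hm.
  intros q Hq. exists (dg (u t ⊕ q ⊙ d) (d :: l)). split.
  - apply dg_bound; [apply strip_segment; [exact Ht|exact Hd|lra]|simpl; lia].
  - intros eps He.
    destruct (segment_diff t d l q Ht Hd Hl (ltac:(lra)) eps He) as (de & Hde & G).
    exists de. split; [exact Hde|]. intros r Hr. apply G. lra.
Qed.

Lemma g_lipschitz t x : (1 <= N)%nat -> a <= t <= b -> norm (x ⊖ u t) < rho ->
  norm (g x ⊖ g (u t)) <= M * norm (x ⊖ u t).
Proof.
  intros HN Ht Hx. pose proof (segment_bound t (x ⊖ u t) [] 1 Ht Hx (ltac:(simpl; lia)) (ltac:(lra))) as G.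
  pose proof (strip_segment t (x ⊖ u t) 1 Ht Hx (ltac:(lra))) as Hs.
  rewrite dg_0 in G by exact Hs. rewrite dg_0 in G by apply strip_u, Ht.
  replace (u t ⊕ 1 ⊙ (x ⊖ u t)) with x in G by lin_eq.
  cbn [prod_norms fold_right] in G. lra.
Qed.

Lemma g_quadratic t x : (2 <= N)%nat -> a <= t <= b -> norm (x ⊖ u t) < rho ->
  norm (g x ⊖ g (u t) ⊖ jacobian t (x ⊖ u t)) <= M * norm (x ⊖ u t) ^ 2.
Proof.
  intros HN Ht Hx. set (d := x ⊖ u t) in *.
  pose proof (mean_value_diff 0 1 (M * norm d ^ 2)
    (fun q => dg (u t ⊕ q ⊙ d) [] ⊖ q ⊙ jacobian t d) Rle_0_1) as Hm.
  cbv beta in Hm.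
  pose proof (strip_segment t d 1 Ht Hx (ltac:(lra))) as Hs.
  rewrite dg_0 in Hm by exact Hs.
  replace (u t ⊕ 0 ⊙ d) with (u t) in Hm by lin_eq.
  rewrite dg_0 in Hm by apply strip_u, Ht.
  replace (u t ⊕ 1 ⊙ d) with x in Hm by (unfold d; lin_eq).
  replace (g x ⊖ g (u t) ⊖ jacobian t d) with
    (g x ⊖ 1 ⊙ jacobian t d ⊖ (g (u t) ⊖ 0 ⊙ jacobian t d)) by lin_eq.
  rewrite Rminus_0_r, Rmult_1_r in Hm. apply Hm. intros q Hq.
  exists (dg (u t ⊕ q ⊙ d) [d] ⊖ jacobian t d). split.
  - eapply Rle_trans; [apply (segment_bound t d [d] q Ht Hx); [simpl; lia|exact Hq]|].
    cbn [prod_norms fold_right]. rewrite Rmult_1_r.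
    replace (M * (norm d * norm d) * q) with (M * norm d ^ 2 * q) by ring.
    assert (0 <= M * norm d ^ 2) by (apply Rmult_le_pos; [exact M_pos|apply pow2_ge_0]). nra.
  - apply diff_in_minus.
    + apply segment_diff; [exact Ht|exact Hx|simpl; lia|exact Hq].
    + intros eps He. exists 1. split; [lra|]. intros r _ _.
      match goal with |- norm ?e <= _ => replace e with (vzero : X) by lin_eq end.
      rewrite norm_vzero. apply Rmult_le_pos; [lra|apply Rabs_pos].
Qed.

End Composite.

(* f k is the k-th derivative of g(u(t)), and J t the Jacobian g'(u(t)). *)
Record smooth_data {X : CompleteNormedModule R_AbsRing} (a b rho : R) (u : R -> X) (g : X -> X)
    (f : nat -> R -> X) (J : R -> X -> X) (K : R) : Prop := {
  sd_K : 1 <= K;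
  sd_u : forall t, a <= t <= b -> norm (u t) <= K;
  sd_f0 : forall t, a <= t <= b -> f 0%nat t = g (u t);
  sd_f_diff : forall k t, (k < 5)%nat -> a <= t <= b -> diff_in a b (f k) t (f (S k) t);
  sd_f_bound : forall k t, (1 <= k <= 5)%nat -> a <= t <= b -> norm (f k t) <= K;
  sd_J_linear : forall t, a <= t <= b -> is_linear (J t);
  sd_J_bound : forall t v, a <= t <= b -> norm (J t v) <= K * norm v;
  sd_J_lipschitz : forall s t v, a <= s <= b -> a <= t <= b ->
    norm (J t v ⊖ J s v) <= K * Rabs (t - s) * norm v;
  sd_g_lipschitz : forall t x, a <= t <= b -> norm (x ⊖ u t) < rho ->
    norm (g x ⊖ g (u t)) <= K * norm (x ⊖ u t);
  sd_g_quadratic : forall t x, a <= t <= b -> norm (x ⊖ u t) < rho ->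
    norm (g x ⊖ g (u t) ⊖ J t (x ⊖ u t)) <= K * norm (x ⊖ u t) ^ 2 }.

Lemma smooth_data_exists {X : CompleteNormedModule R_AbsRing} (a b rho : R) (u : R -> X)
    (g : X -> X) :
  a < b -> 0 < rho -> smooth_on 5 a b u -> frechet_smooth_bounded 5 (strip a b u rho) g ->
  exists f J K, smooth_data a b rho u g f J K.
Proof.
  intros Hab Hrho (du & Hdu0 & Hdu1 & Hdu2) (dg & M0 & Hg0 & Hg1 & Hg2 & Hg3).
  assert (Hab' : a <= b) by lra.
  assert (Hd : forall k t, (k < 5)%nat -> a <= t <= b -> diff_in a b (du k) t (du (S k) t)).
  { intros k t Hk Ht. apply deriv_on_diff_in; [exact Ht|apply Hdu1; assumption]. }
  assert (Hcont : forall k t, (k <= 5)%nat -> a <= t <= b -> cont_in a b (du k) t).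
  { intros k t Hk Ht eps He.
    destruct (proj1 (filterlim_locally_ball_norm (K := R_AbsRing) (du k) (du k t))
      (Hdu2 k t Hk Ht) (mkposreal eps He)) as (d & Hdd).
    exists d. split; [apply cond_pos|]. intros r Hr Hrt. left. exact (Hdd r Hrt Hr). }
  destruct (bounded_family (fun t => a <= t <= b) (fun k t => norm (du k t)) 5) as (B & HB1 & HB).
  { intros k Hk. apply (cont_in_bounded a b (du k) Hab'). intros s Hs. apply Hcont; assumption. }
  (* The given constant carries no sign, and with few admissible arguments it could be negative. *)
  set (M := Rabs M0).
  assert (HM : 0 <= M) by apply Rabs_pos.
  assert (Hg2' : forall x l, strip a b u rho x -> (1 <= length l <= 5)%nat ->
    norm (dg x l) <= M * prod_norms l).
  { intros x l Hx Hl. eapply Rle_trans; [apply Hg2; assumption|].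
    apply Rmult_le_compat_r; [apply prod_norms_pos|apply Rle_abs]. }
  set (f := composite_deriv u du dg).
  destruct (bounded_family (fun t => a <= t <= b)
    (fun k t => match k with O => 0 | S _ => norm (f k t) end) 5) as (K0 & HK0 & HKf).
  { intros [|k] Hk; [exists 0; intros; lra|].
    apply (composite_deriv_bound 5 a b rho u du dg M B Hrho HB1 HB HM Hg2'). lia. }
  set (K := K0 + M + M * B + B).
  assert (HMB : 0 <= M * B) by (apply Rmult_le_pos; lra).
  exists f, (jacobian u dg), K. split.
  - unfold K. lra.
  - intros t Ht. rewrite <- (Hdu0 t Ht). pose proof (HB 0%nat t (ltac:(lia)) Ht). unfold K. lra.
  - intros t Ht. apply (composite_deriv_0 a b rho u g du dg Hrho Hg0 t Ht).
  - intros k t Hk Ht.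
    exact (composite_deriv_diff 5 a b rho u du dg M B Hrho Hdu0 Hd HB1 HB Hg1 HM Hg2' Hg3 k t Hk Ht).
  - intros k t Hk Ht. destruct k as [|k]; [lia|]. specialize (HKf (S k) t (proj2 Hk) Ht).
    cbv beta iota in HKf. unfold K. lra.
  - intros t Ht. refine (jacobian_linear 5 a b rho u dg M Hrho Hg1 Hg2' t _ Ht). lia.
  - intros t v Ht. eapply Rle_trans.
    + refine (jacobian_bound 5 a b rho u dg M Hrho Hg2' t v _ Ht). lia.
    + apply Rmult_le_compat_r; [apply norm_ge_0|unfold K; lra].
  - assert (HJ : forall s t v, a <= s -> s <= t -> t <= b ->
      norm (jacobian u dg t v ⊖ jacobian u dg s v) <= K * Rabs (t - s) * norm v).
    { intros s t v Hs Hst Ht. eapply Rle_trans.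
      - refine (jacobian_lipschitz 5 a b rho u du dg M B Hrho Hdu0 Hd HB Hg1 HM Hg2' Hg3 t s v _ Hs Hst Ht).
        lia.
      - rewrite Rabs_right by lra.
        replace (M * B * norm v * (t - s)) with (M * B * ((t - s) * norm v)) by ring.
        rewrite (Rmult_assoc K). apply Rmult_le_compat_r; [|unfold K; lra].
        apply Rmult_le_pos; [lra|apply norm_ge_0]. }
    intros s t v Hs Ht. destruct (Rle_dec s t) as [Hst|Hst].
    + apply HJ; lra.
    + rewrite norm_minus_sym, Rabs_minus_sym. apply HJ; lra.
  - intros t x Ht Hx. eapply Rle_trans.
    + refine (g_lipschitz 5 a b rho u g dg M Hrho Hg0 Hg1 Hg2' Hg3 t x _ Ht Hx). lia.
    + apply Rmult_le_compat_r; [apply norm_ge_0|unfold K; lra].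
  - intros t x Ht Hx. eapply Rle_trans.
    + refine (g_quadratic 5 a b rho u g dg M Hrho Hg0 Hg1 HM Hg2' Hg3 t x _ Ht Hx). lia.
    + apply Rmult_le_compat_r; [apply pow2_ge_0|unfold K; lra].
Qed.

(** * Expansion of the exact solution *)

Lemma diff_in_taylor {X : CompleteNormedModule R_AbsRing} (v : nat -> X) n a b s :
  diff_in a b (fun q => vsum (S n) (fun j => (q ^ j / INR (fact j)) ⊙ v j)) s
    (vsum n (fun j => (s ^ j / INR (fact j)) ⊙ v (S j))).
Proof.
  induction n as [|n IH].
  - exact (diff_in_const a b s (vzero ⊕ (1 / 1) ⊙ v 0%nat)).
  - change (vsum (S n) (fun j => (s ^ j / INR (fact j)) ⊙ v (S j))) with
      (vsum n (fun j => (s ^ j / INR (fact j)) ⊙ v (S j)) ⊕ (s ^ n / INR (fact n)) ⊙ v (S n)).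
    apply (diff_in_plus a b (fun q => vsum (S n) (fun j => (q ^ j / INR (fact j)) ⊙ v j))
      (fun q => (q ^ S n / INR (fact (S n))) ⊙ v (S n))).
    + exact IH.
    + apply (diff_in_scal a b (fun q => q ^ S n / INR (fact (S n)))). apply weight_deriv.
Qed.

Lemma diff_in_translate {V : NormedModule R_AbsRing} a b (y : R -> V) t q0 q s l :
  a <= t + q0 -> t + q <= b -> q0 <= s <= q ->
  diff_in a b y (t + s) l -> diff_in q0 q (fun r => y (t + r)) s l.
Proof.
  intros H1 H2 Hs Hy eps He. destruct (Hy eps He) as (d & Hd & Hdd).
  exists d. split; [exact Hd|]. intros r Hr Hrs.
  specialize (Hdd (t + r) (ltac:(lra))). replace (t + r - (t + s)) with (r - s) in Hdd by ring.
  exact (Hdd Hrs).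
Qed.

Lemma diff_in_rescale {V : NormedModule R_AbsRing} a b (y : R -> V) t tau s l :
  a <= t -> 0 < tau -> t + tau <= b -> 0 <= s <= 1 ->
  diff_in a b y (t + s * tau) l -> diff_in 0 1 (fun th => y (t + th * tau)) s (tau ⊙ l).
Proof.
  intros H1 Ht H2 Hs Hy eps He.
  destruct (Hy (eps / tau)) as (d & Hd & Hdd); [apply Rdiv_lt_0_compat; lra|].
  exists (d / tau). split; [apply Rdiv_lt_0_compat; lra|]. intros r Hr Hrs.
  assert (E : t + r * tau - (t + s * tau) = (r - s) * tau) by ring.
  specialize (Hdd (t + r * tau) (ltac:(nra))). rewrite E, Rabs_mult, (Rabs_right tau) in Hdd by lra.
  apply (Rmult_lt_compat_r tau) in Hrs; [|exact Ht].
  replace (d / tau * tau) with d in Hrs by (field; lra). specialize (Hdd Hrs).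
  replace ((r - s) ⊙ (tau ⊙ l)) with (((r - s) * tau) ⊙ l) by lin_eq.
  eapply Rle_trans; [exact Hdd|]. right. field. lra.
Qed.

Lemma lin_comb_seq {X : CompleteNormedModule R_AbsRing} (F : nat -> X -> X) (v : nat -> X) n :
  lin_comb F (map (fun j => (j, v j)) (seq 0 n)) = vsum n (fun j => F j (v j)).
Proof.
  induction n as [|n IH]; [reflexivity|].
  rewrite seq_S, map_app. simpl vsum. rewrite <- IH. simpl (map _ [_]).
  generalize (map (fun j => (j, v j)) (seq 0 n)). intros l.
  induction l as [|p l IHl]; cbn [app lin_comb fold_right fst snd].
  - lin_eq.
  - fold (lin_comb F l). unfold lin_comb in IHl at 1. rewrite IHl.  lin_eq.
Qed.

Section Expansion.

Context {X : CompleteNormedModule R_AbsRing}.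
Context {T : R -> X -> X} {H M C : R} (HT : semigroup_bounds T H M C).
Context {a b rho : R} {u : R -> X} {g : X -> X} {f : nat -> R -> X} {J : R -> X -> X} {K : R}
  (HS : smooth_data a b rho u g f J K).
Variable A : X -> X.
Hypothesis u_gen : forall t, a <= t <= b -> is_gen T (u t) (A (u t)).
Hypothesis u_sol : forall t, a <= t <= b -> diff_in a b u t (A (u t) ⊕ g (u t)).
Hypothesis length_H : b - a <= H.

(** Induction on n for all k at once: the derivative of the remainder of f_k is the remainder of
    f_{k+1} with one term fewer. The factorial in the error bound is given up. *)
Lemma f_taylor n : forall k t q, (1 <= k + n <= 5)%nat -> a <= t -> 0 <= q -> t + q <= b ->
  norm (f k (t + q) ⊖ vsum n (fun j => (q ^ j / INR (fact j)) ⊙ f (k + j) t)) <= K * q ^ n.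
Proof.
  pose proof (sd_K _ _ _ _ _ _ _ _ HS) as HK.
  induction n as [|n IH]; intros k t q Hk Ht Hq Htq.
  - simpl. replace (f k (t + q) ⊖ vzero) with (f k (t + q)) by lin_eq. rewrite Rmult_1_r.
    apply (sd_f_bound _ _ _ _ _ _ _ _ HS); [lia|lra].
  - set (v := fun j => f (k + j) t).
    pose proof (mean_value_diff 0 q (K * q ^ n)
      (fun r => f k (t + r) ⊖ vsum (S n) (fun j => (r ^ j / INR (fact j)) ⊙ v j)) Hq) as Hm.
    cbv beta in Hm. rewrite Rminus_0_r, Rplus_0_r in Hm.
    assert (E0 : vsum (S n) (fun j => (0 ^ j / INR (fact j)) ⊙ v j) = f k t).
    { rewrite (vsum_ext (S n) _ (fun j => (if Nat.eq_dec j 0 then 1 else 0) ⊙ v j)).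
      - clear. induction n as [|n IH].
        + simpl. unfold v. rewrite Nat.add_0_r. lin_eq.
        + change (vsum (S (S n)) (fun j => (if Nat.eq_dec j 0 then 1 else 0) ⊙ v j)) with
            (vsum (S n) (fun j => (if Nat.eq_dec j 0 then 1 else 0) ⊙ v j) ⊕ 0 ⊙ v (S n)).
          rewrite IH. lin_eq.
      - intros j _. f_equal. destruct j as [|j]; [simpl; field|].
        rewrite pow_i by lia. destruct (Nat.eq_dec (S j) 0); [lia|].
        unfold Rdiv. apply Rmult_0_l. }
    rewrite E0 in Hm.
    replace (f k t ⊖ f k t) with (vzero : X) in Hm by lin_eq.
    replace (K * q ^ S n) with (K * q ^ n * q) by (simpl; ring).
    match goal with |- norm ?e <= _ => replace e with (e ⊖ vzero) by lin_eq end.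
    apply Hm. intros r Hr.
    exists (f (S k) (t + r) ⊖ vsum n (fun j => (r ^ j / INR (fact j)) ⊙ v (S j))). split.
    + rewrite (vsum_ext n _ (fun j => (r ^ j / INR (fact j)) ⊙ f (S k + j) t)).
      * eapply Rle_trans; [apply IH; (lia || lra)|].
        apply Rmult_le_compat_l; [lra|]. apply pow_incr; lra.
      * intros j _. unfold v. rewrite Nat.add_succ_r. reflexivity.
    + apply diff_in_minus; [|apply diff_in_taylor].
      apply (diff_in_translate a b (f k) t 0 q r); [lra|lra|exact Hr|].
      apply (sd_f_diff _ _ _ _ _ _ _ _ HS); [lia|lra].
Qed.

(** The path th -> u(t + th tau) solves w' = tau A w + tau g(u), and the Taylor polynomial of g(u)
    is the polynomial inhomogeneity in the variation-of-constants formula. *)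
Lemma exact_expansion n t tau : (1 <= n <= 5)%nat -> a <= t -> 0 < tau -> t + tau <= b ->
  norm (u (t + tau) ⊖ T tau (u t) ⊖ vsum n (fun j => tau ^ S j ⊙ phiT T (S j) tau (f j t)))
  <= M * K * tau ^ S n.
Proof.
  intros Hn Ht Htau Htb. pose proof (sd_K _ _ _ _ _ _ _ _ HS) as HK.
  assert (HtH : 0 < tau <= H) by lra.
  set (v := (fun j => tau ^ S j ⊙ f j t) : nat -> X).
  pose proof (voc_estimate HT tau (fun th => u (t + th * tau))
    (map (fun j => (j, v j)) (seq 0 n)) (K * tau ^ S n) HtH) as Hv.
  cbv beta in Hv. rewrite Rmult_1_l, Rmult_0_l, Rplus_0_r, lin_comb_seq in Hv.
  rewrite (vsum_ext n _ (fun j => tau ^ S j ⊙ phiT T (S j) tau (f j t))) in Hv.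
  2: { intros j _. apply (lin_scal _ (phiT_linear HT (S j) tau (ltac:(lra)))). }
  rewrite Rmult_assoc. apply Hv.
  - intros th Hth. eapply diff_in_cont.
    apply (diff_in_rescale a b u t tau th (A (u (t + th * tau)) ⊕ g (u (t + th * tau)))); try lra.
    apply u_sol. nra.
  - intros th Hth. assert (Hin : a <= t + th * tau <= b) by nra.
    exists (tau ⊙ (A (u (t + th * tau)) ⊕ g (u (t + th * tau)))), (A (u (t + th * tau))).
    split; [apply (diff_in_rescale a b u t tau th); try lra; apply u_sol, Hin|].
    split; [apply u_gen, Hin|].
    rewrite lin_comb_seq.
    rewrite (vsum_ext n _ (fun j => tau ⊙ (((th * tau) ^ j / INR (fact j)) ⊙ f (0 + j) t))).
    + rewrite vsum_scal, <- (sd_f0 _ _ _ _ _ _ _ _ HS _ Hin).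
      replace (tau ⊙ (A (u (t + th * tau)) ⊕ f 0%nat (t + th * tau)) ⊖ tau ⊙ A (u (t + th * tau))
        ⊖ tau ⊙ vsum n (fun j => ((th * tau) ^ j / INR (fact j)) ⊙ f (0 + j) t)) with
        (tau ⊙ (f 0%nat (t + th * tau) ⊖ vsum n (fun j => ((th * tau) ^ j / INR (fact j)) ⊙ f (0 + j) t)))
        by lin_eq.
      eapply Rle_trans; [apply norm_scal_le|]. rewrite Rabs_right by lra.
      replace (K * tau ^ S n) with (tau * (K * tau ^ n)) by (simpl; ring).
      apply Rmult_le_compat_l; [lra|].
      eapply Rle_trans; [apply f_taylor; (lia || nra)|].
      apply Rmult_le_compat_l; [lra|]. apply pow_incr. nra.
    + intros j _. unfold v. rewrite Rpow_mult_distr, Nat.add_0_l. simpl pow. lin_field. apply INR_fact_neq_0.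
Qed.

End Expansion.

(** * One step of the method *)

Lemma sum_n_m_vsum {X : CompleteNormedModule R_AbsRing} (F : nat -> X) n :
  sum_n_m F 2 (S n) = vsum n (fun j => F (2 + j)%nat).
Proof.
  induction n as [|n IH].
  - rewrite sum_n_m_zero by lia. reflexivity.
  - rewrite sum_n_Sm by lia. rewrite IH. reflexivity.
Qed.

Lemma at_op_fold_seq {X : CompleteNormedModule R_AbsRing} (T : R -> X -> X) h v
    (F : nat -> cfun) n :
  at_op (fold_right Defs.Add Zero (map F (seq 2 n))) T h v =
  vsum n (fun j => at_op (F (2 + j)%nat) T h v).
Proof.
  induction n as [|n IH]; [reflexivity|].
  rewrite seq_S, map_app. cbn [vsum]. rewrite <- IH. cbn [map].
  generalize (map F (seq 2 n)). intros l.
  induction l as [|p l IHl]; cbn [app fold_right].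
  - rewrite at_op_Add, at_op_Zero. simpl. lin_eq.
  - rewrite !at_op_Add, IHl. lin_eq.
Qed.

Lemma node58_pos i : (2 <= i <= 8)%nat -> 0 < node58 i <= 1.
Proof.
  intros Hi. do 9 (destruct i as [|i]; [try lia; cbn; lra|]). lia.
Qed.

Lemma acoef58_nodes i j : nodes_in_01 (acoef58 i j).
Proof.
  do 9 (destruct i as [|i]; [do 8 (destruct j as [|j]; [cbn; repeat split; lra|]); cbn; auto|]).
  cbn; auto.
Qed.

Lemma bcoef58_nodes i : nodes_1 (bcoef58 i).
Proof.
  do 9 (destruct i as [|i]; [cbn; repeat split; lra|]). cbn; auto.
Qed.

Lemma bcoef58_smoothing i : smoothing (bcoef58 i).
Proof.
  do 9 (destruct i as [|i]; [cbn; repeat split; (lia || lra)|]). cbn; auto.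
Qed.

Lemma psi58_nodes k i : (2 <= i <= 8)%nat -> nodes_in_01 (psi expRK5s8 k i).
Proof.
  intros Hi. cbn [psi nodes_in_01]. split.
  - unfold csum. generalize (seq 2 (i - 2)). intros l.
    induction l as [|j l IH]; cbn [map fold_right nodes_in_01]; [trivial|].
    split; [apply acoef58_nodes|exact IH].
  - pose proof (node58_pos i Hi). cbn. lra.
Qed.

Lemma vsum_exchange {V : NormedModule R_AbsRing} n m (F : nat -> nat -> V) :
  vsum n (fun j => vsum m (fun k => F j k)) = vsum m (fun k => vsum n (fun j => F j k)).
Proof.
  induction n as [|n IH]; cbn [vsum].
  - rewrite vsum_const. lin_eq.
  - rewrite IH, <- vsum_plus. reflexivity.
Qed.

Lemma vsum_head {V : NormedModule R_AbsRing} n (F : nat -> V) :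
  vsum (S n) F = F 0%nat ⊕ vsum n (fun j => F (S j)).
Proof.
  change (vsum (S n) F) with (vsum n F ⊕ F n). rewrite <- vsum_shift. lin_eq.
Qed.

Section OneStep.

Context {X : CompleteNormedModule R_AbsRing}.
Context {T : R -> X -> X} {H M C : R} (HT : semigroup_bounds T H M C).
Context {a b rho : R} {u : R -> X} {g : X -> X} {f : nat -> R -> X} {J : R -> X -> X} {K : R}
  (HS : smooth_data a b rho u g f J K).
Variable A : X -> X.
Hypothesis u_gen : forall t, a <= t <= b -> is_gen T (u t) (A (u t)).
Hypothesis u_sol : forall t, a <= t <= b -> diff_in a b u t (A (u t) ⊕ g (u t)).
Hypothesis length_H : b - a <= H.
Hypothesis rho_pos : 0 < rho.

Let M_ge_1 := sg_M _ _ _ _ HT.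
Let K_ge_1 := sd_K _ _ _ _ _ _ _ _ HS.

(** One step as a single datum, so that all estimates can be made uniform over step sizes, times and
    numerical values at once. *)
Record step := {
  st_h : R;
  st_t : R;
  st_x : X;
  st_U : nat -> X;
  st_next : X }.

Record valid (p : step) : Prop := {
  v_h : 0 < st_h p;
  v_t : a <= st_t p;
  v_th : st_t p + st_h p <= b;
  v_dom : is_gen T (st_x p) (A (st_x p));
  v_stage : forall i, (2 <= i <= 8)%nat ->
    st_U p i = st_x p
      ⊕ (node58 i * st_h p) ⊙ at_op (Phi 1 (node58 i)) T (st_h p) (A (st_x p) ⊕ g (st_x p))
      ⊕ st_h p ⊙ vsum (i - 2) (fun j =>
          at_op (acoef58 i (2 + j)) T (st_h p) (g (st_U p (2 + j)%nat) ⊖ g (st_x p)));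
  v_next : st_next p = st_x p
      ⊕ st_h p ⊙ at_op (Phi 1 1) T (st_h p) (A (st_x p) ⊕ g (st_x p))
      ⊕ st_h p ⊙ vsum 7 (fun j =>
          at_op (bcoef58 (2 + j)) T (st_h p) (g (st_U p (2 + j)%nat) ⊖ g (st_x p))) }.

Definition err (p : step) : X := st_x p ⊖ u (st_t p).

Definition bigO (k : nat) (q : step -> X) : Prop :=
  exists B eta, 0 <= B /\ 0 < eta <= 1 /\
  forall p, valid p -> st_h p <= eta -> norm (err p) <= eta ->
  norm (q p) <= B * (st_h p ^ k + norm (err p)).

Lemma st_h_range p : valid p -> 0 < st_h p <= H.
Proof. intros Hp. destruct Hp. lra. Qed.

Lemma bigO_ext k (q q' : step -> X) :
  (forall p, valid p -> q p = q' p) -> bigO k q -> bigO k q'.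
Proof.
  intros E (B & eta & HB & He & Hq). exists B, eta. split; [exact HB|]. split; [exact He|].
  intros p Hp H1 H2. rewrite <- E by exact Hp. apply Hq; assumption.
Qed.

Lemma bigO_zero k : bigO k (fun _ => vzero).
Proof.
  exists 0, 1. split; [lra|]. split; [lra|]. intros p _ _ _. rewrite norm_vzero. lra.
Qed.

Lemma bigO_plus k q1 q2 : bigO k q1 -> bigO k q2 -> bigO k (fun p => q1 p ⊕ q2 p).
Proof.
  intros (B1 & e1 & HB1 & He1 & H1) (B2 & e2 & HB2 & He2 & H2).
  exists (B1 + B2), (Rmin e1 e2). split; [lra|].
  pose proof (Rmin_l e1 e2). pose proof (Rmin_r e1 e2).
  split; [split; [apply Rmin_glb_lt; lra|lra]|]. intros p Hp Hh He.
  specialize (H1 p Hp (ltac:(lra)) (ltac:(lra))). specialize (H2 p Hp (ltac:(lra)) (ltac:(lra))).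
  eapply Rle_trans; [apply norm_plus_le|]. lra.
Qed.

Lemma bigO_scal k r q : bigO k q -> bigO k (fun p => r ⊙ q p).
Proof.
  intros (B & eta & HB & He & Hq). exists (Rabs r * B), eta.
  split; [apply Rmult_le_pos; [apply Rabs_pos|exact HB]|]. split; [exact He|].
  intros p Hp Hh Hee. eapply Rle_trans; [apply norm_scal_le|].
  rewrite Rmult_assoc. apply Rmult_le_compat_l; [apply Rabs_pos|apply Hq; assumption].
Qed.

Lemma bigO_minus k q1 q2 : bigO k q1 -> bigO k q2 -> bigO k (fun p => q1 p ⊖ q2 p).
Proof.
  intros H1 H2. apply (bigO_ext k (fun p => q1 p ⊕ (-1) ⊙ q2 p)); [intros; lin_eq|].
  apply bigO_plus; [exact H1|apply bigO_scal, H2].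
Qed.

Lemma bigO_weaken k k' q : (k <= k')%nat -> bigO k' q -> bigO k q.
Proof.
  intros Hk (B & eta & HB & He & Hq). exists B, eta. split; [exact HB|]. split; [exact He|].
  intros p Hp Hh Hee. eapply Rle_trans; [apply Hq; assumption|].
  apply Rmult_le_compat_l; [exact HB|]. apply Rplus_le_compat_r.
  pose proof (v_h p Hp). 
  replace k' with (k + (k' - k))%nat by lia. rewrite pow_add.
  rewrite <- (Rmult_1_r (st_h p ^ k)) at 2. apply Rmult_le_compat_l; [apply pow_le; lra|].
  rewrite <- (pow1 (k' - k)). apply pow_incr. lra.
Qed.

Lemma bigO_h k q : bigO k q -> bigO (S k) (fun p => st_h p ⊙ q p).
Proof.
  intros (B & eta & HB & He & Hq). exists B, eta. split; [exact HB|]. split; [exact He|].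
  intros p Hp Hh Hee. pose proof (v_h p Hp). eapply Rle_trans; [apply norm_scal_le|].
  rewrite Rabs_right by lra. specialize (Hq p Hp Hh Hee).
  apply Rle_trans with (st_h p * (B * (st_h p ^ k + norm (err p))));
    [apply Rmult_le_compat_l; lra|].
  replace (st_h p * (B * (st_h p ^ k + norm (err p)))) with
    (B * (st_h p ^ S k + st_h p * norm (err p))) by (simpl; ring).
  apply Rmult_le_compat_l; [exact HB|]. apply Rplus_le_compat_l.
  pose proof (norm_ge_0 (err p)). nra.
Qed.

Lemma bigO_hpow k q : bigO 0 q -> bigO k (fun p => st_h p ^ k ⊙ q p).
Proof.
  intros Hq. induction k as [|k IH].
  - apply (bigO_ext 0 q); [|exact Hq]. intros; simpl; lin_eq.
  - apply (bigO_ext (S k) (fun p => st_h p ⊙ (st_h p ^ k ⊙ q p))); [intros; simpl; lin_eq|].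
    apply bigO_h, IH.
Qed.

Lemma bigO_bounded (B : R) q : (forall p, valid p -> norm (q p) <= B) -> bigO 0 q.
Proof.
  intros Hq. exists (Rmax 0 B), 1. split; [apply Rmax_l|]. split; [lra|].
  intros p Hp _ _. eapply Rle_trans; [apply Hq, Hp|]. simpl.
  pose proof (norm_ge_0 (err p)). pose proof (Rmax_l 0 B). pose proof (Rmax_r 0 B). nra.
Qed.

Lemma bigO_lin k (L : step -> X -> X) (B : R) q : 0 <= B ->
  (forall p v, valid p -> norm (L p v) <= B * norm v) -> bigO k q -> bigO k (fun p => L p (q p)).
Proof.
  intros HB HL (B' & eta & HB' & He & Hq). exists (B * B'), eta.
  split; [apply Rmult_le_pos; assumption|]. split; [exact He|].
  intros p Hp Hh Hee. eapply Rle_trans; [apply HL, Hp|].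
  rewrite Rmult_assoc. apply Rmult_le_compat_l; [exact HB|apply Hq; assumption].
Qed.

Lemma bigO_op k F q : nodes_in_01 F -> bigO k q -> bigO k (fun p => at_op F T (st_h p) (q p)).
Proof.
  intros HF. apply (bigO_lin k (fun p => at_op F T (st_h p)) (cnorm F * M)).
  - apply Rmult_le_pos; [apply cnorm_pos|lra].
  - intros p v Hp. rewrite Rmult_assoc. apply (at_op_bound HT); [|exact HF].
    pose proof (st_h_range p Hp). lra.
Qed.

Lemma bigO_J k q : bigO k q -> bigO k (fun p => J (st_t p) (q p)).
Proof.
  apply (bigO_lin k (fun p => J (st_t p)) K); [lra|].
  intros p v Hp. apply (sd_J_bound _ _ _ _ _ _ _ _ HS). destruct Hp; lra.
Qed.

Lemma bigO_f k : (1 <= k <= 5)%nat -> bigO 0 (fun p => f k (st_t p)).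
Proof.
  intros Hk. apply (bigO_bounded K). intros p Hp.
  apply (sd_f_bound _ _ _ _ _ _ _ _ HS); [exact Hk|]. destruct Hp; lra.
Qed.

Lemma bigO_vsum k n (q : nat -> step -> X) : (forall j, (j < n)%nat -> bigO k (q j)) ->
  bigO k (fun p => vsum n (fun j => q j p)).
Proof.
  induction n as [|n IH]; intros Hq; [apply bigO_zero|].
  apply (bigO_plus k (fun p => vsum n (fun j => q j p)) (q n)); [|apply Hq; lia].
  apply IH. intros j Hj. apply Hq. lia.
Qed.

Lemma bigO_err k : bigO k err.
Proof.
  exists 1, 1. split; [lra|]. split; [lra|]. intros p Hp Hh _.
  pose proof (v_h p Hp). assert (0 <= st_h p ^ k) by (apply pow_le; lra). lra.
Qed.

(** Ensures that a stage lies within rho of the exact solution; a positive order is needed for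
    this. *)
Lemma bigO_small k q (r : R) : 0 < r -> bigO (S k) q -> exists eta, 0 < eta <= 1 /\
  forall p, valid p -> st_h p <= eta -> norm (err p) <= eta -> norm (q p) < r.
Proof.
  intros Hr Hq. apply (bigO_weaken 1) in Hq; [|lia]. destruct Hq as (B & eta & HB & He & Hq).
  exists (Rmin eta (r / (2 * (B + 1)))).
  assert (Hr2 : 0 < r / (2 * (B + 1))) by (apply Rdiv_lt_0_compat; lra).
  pose proof (Rmin_l eta (r / (2 * (B + 1)))) as m1.
  pose proof (Rmin_r eta (r / (2 * (B + 1)))) as m2.
  split; [split; [apply Rmin_glb_lt; lra|lra]|].
  intros p Hp Hh Hee. specialize (Hq p Hp (ltac:(lra)) (ltac:(lra))).
  rewrite pow_1 in Hq.
  apply Rle_lt_trans with (B * (2 * (r / (2 * (B + 1))))).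
  - eapply Rle_trans; [exact Hq|]. apply Rmult_le_compat_l; lra.
  - replace (B * (2 * (r / (2 * (B + 1))))) with (r * (B / (B + 1))) by (field; lra).
    rewrite <- (Rmult_1_r r) at 2. apply Rmult_lt_compat_l; [exact Hr|].
    apply (Rmult_lt_reg_r (B + 1)); [lra|]. replace (B / (B + 1) * (B + 1)) with B by (field; lra). lra.
Qed.

Lemma bigO_g k (y : step -> X) (s : step -> R) : (forall p, valid p -> a <= s p <= b) ->
  bigO (S k) (fun p => y p ⊖ u (s p)) -> bigO (S k) (fun p => g (y p) ⊖ g (u (s p))).
Proof.
  intros Hs Hy. destruct (bigO_small k _ rho rho_pos Hy) as (e1 & He1 & H1).
  destruct Hy as (B & e2 & HB & He2 & H2).
  exists (K * B), (Rmin e1 e2). split; [apply Rmult_le_pos; lra|].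
  pose proof (Rmin_l e1 e2). pose proof (Rmin_r e1 e2).
  split; [split; [apply Rmin_glb_lt; lra|lra]|]. intros p Hp Hh Hee.
  eapply Rle_trans.
  - apply (sd_g_lipschitz _ _ _ _ _ _ _ _ HS); [apply Hs, Hp|]. apply H1; [exact Hp|lra|lra].
  - rewrite Rmult_assoc. apply Rmult_le_compat_l; [lra|]. apply H2; [exact Hp|lra|lra].
Qed.

(** One order is gained. The quadratic term is at most of order h^{2k+2} plus multiples of the
    error, and moving the Jacobian from s(p) to the start of the step costs a factor h. *)
Lemma bigO_g_linearized k (y : step -> X) (s : step -> R) :
  (forall p, valid p -> a <= s p <= b) ->
  (forall p, valid p -> Rabs (s p - st_t p) <= st_h p) ->
  bigO (S k) (fun p => y p ⊖ u (s p)) ->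
  bigO (S (S k)) (fun p => g (y p) ⊖ g (u (s p)) ⊖ J (st_t p) (y p ⊖ u (s p))).
Proof.
  intros Hs Hst Hy. destruct (bigO_small k _ rho rho_pos Hy) as (e1 & He1 & H1).
  destruct Hy as (B & e2 & HB & He2 & H2).
  exists (K * (4 * B ^ 2) + K * B), (Rmin e1 e2).
  assert (HB2 : 0 <= K * B) by (apply Rmult_le_pos; lra).
  assert (HB3 : 0 <= K * (4 * B ^ 2)).
  { apply Rmult_le_pos; [lra|]. pose proof (pow2_ge_0 B). lra. }
  split; [lra|].
  pose proof (Rmin_l e1 e2). pose proof (Rmin_r e1 e2).
  split; [split; [apply Rmin_glb_lt; lra|lra]|]. intros p Hp Hh Hee.
  set (d := y p ⊖ u (s p)) in *.
  specialize (H1 p Hp (ltac:(lra)) (ltac:(lra))). specialize (H2 p Hp (ltac:(lra)) (ltac:(lra))).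
  cbv beta in H1, H2. fold d in H1, H2.
  pose proof (v_h p Hp) as Hh0. pose proof (norm_ge_0 (err p)) as He0.
  pose proof (norm_ge_0 d) as Hd0.
  assert (Hpk : 0 <= st_h p ^ S k <= 1).
  { split; [apply pow_le; lra|]. rewrite <- (pow1 (S k)). apply pow_incr. lra. }
  assert (Hpk2 : 0 <= st_h p ^ S (S k)) by (apply pow_le; lra).
  assert (Hpk3 : st_h p ^ S k * st_h p ^ S k <= st_h p ^ S (S k)).
  { replace (st_h p ^ S k * st_h p ^ S k) with (st_h p ^ S (S k) * st_h p ^ k) by (simpl; ring).
    assert (st_h p ^ k <= 1) by (rewrite <- (pow1 k); apply pow_incr; lra).
    rewrite <- (Rmult_1_r (st_h p ^ S (S k))) at 2. apply Rmult_le_compat_l; lra. }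
  replace (g (y p) ⊖ g (u (s p)) ⊖ J (st_t p) d) with
    ((g (y p) ⊖ g (u (s p)) ⊖ J (s p) d) ⊕ (J (s p) d ⊖ J (st_t p) d)) by lin_eq.
  eapply Rle_trans; [apply norm_plus_le|].
  assert (A1 : norm (g (y p) ⊖ g (u (s p)) ⊖ J (s p) d) <=
    K * (4 * B ^ 2) * (st_h p ^ S (S k) + norm (err p))).
  { eapply Rle_trans; [apply (sd_g_quadratic _ _ _ _ _ _ _ _ HS); [apply Hs, Hp|exact H1]|].
    fold d. rewrite !Rmult_assoc. apply Rmult_le_compat_l; [lra|].
    apply Rle_trans with ((B * (st_h p ^ S k + norm (err p))) ^ 2); [apply pow_incr; lra|].
    rewrite Rpow_mult_distr.
    replace (4 * (B ^ 2 * (st_h p ^ S (S k) + norm (err p)))) with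
      (B ^ 2 * (4 * (st_h p ^ S (S k) + norm (err p)))) by ring.
    apply Rmult_le_compat_l; [apply pow2_ge_0|].
    assert (norm (err p) * norm (err p) <= norm (err p)) by nra.
    assert (st_h p ^ S k * norm (err p) <= norm (err p)) by nra.
    replace ((st_h p ^ S k + norm (err p)) ^ 2) with (st_h p ^ S k * st_h p ^ S k
      + 2 * (st_h p ^ S k * norm (err p)) + norm (err p) * norm (err p)) by ring.
    lra. }
  assert (A2 : norm (J (s p) d ⊖ J (st_t p) d) <= K * B * (st_h p ^ S (S k) + norm (err p))).
  { eapply Rle_trans; [apply (sd_J_lipschitz _ _ _ _ _ _ _ _ HS)|].
    - destruct Hp; lra.
    - apply Hs, Hp.
    - rewrite !Rmult_assoc. apply Rmult_le_compat_l; [lra|].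
      apply Rle_trans with (st_h p * (B * (st_h p ^ S k + norm (err p)))).
      + apply Rmult_le_compat; [apply Rabs_pos|exact Hd0|apply Hst, Hp|exact H2].
      + replace (st_h p * (B * (st_h p ^ S k + norm (err p)))) with
          (B * (st_h p ^ S (S k) + st_h p * norm (err p))) by (simpl; ring).
        apply Rmult_le_compat_l; [exact HB|]. nra. }
  lra.
Qed.

Lemma stage_time i p : (2 <= i <= 8)%nat -> valid p ->
  a <= st_t p + node58 i * st_h p <= b /\ Rabs (st_t p + node58 i * st_h p - st_t p) <= st_h p.
Proof.
  intros Hi Hp. pose proof (node58_pos i Hi) as Hn. destruct Hp as [P1 P2 P3 _ _ _].
  assert (0 <= node58 i * st_h p <= st_h p) by nra.
  split; [lra|]. rewrite Rabs_right; lra.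
Qed.

Definition st_E (i : nat) (p : step) : X := st_U p i ⊖ u (st_t p + node58 i * st_h p).

Definition st_G (i : nat) (p : step) : X := g (st_U p i) ⊖ g (u (st_t p + node58 i * st_h p)).

Lemma bigO_stage_G k i : (2 <= i <= 8)%nat -> bigO (S k) (st_E i) -> bigO (S k) (st_G i).
Proof.
  intros Hi. apply (bigO_g k (fun p => st_U p i)).
  intros p Hp. apply (stage_time i p Hi Hp).
Qed.

Lemma bigO_stage_G_linearized k i : (2 <= i <= 8)%nat -> bigO (S k) (st_E i) ->
  bigO (S (S k)) (fun p => st_G i p ⊖ J (st_t p) (st_E i p)).
Proof.
  intros Hi. apply (bigO_g_linearized k (fun p => st_U p i));
    intros p Hp; apply (stage_time i p Hi Hp).
Qed.

(* g(u_n) - g(u(t_n)) *)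
Definition st_G1 (p : step) : X := g (st_x p) ⊖ f 0%nat (st_t p).

Lemma bigO_G1 k : bigO k st_G1.
Proof.
  apply (bigO_weaken k (S k)); [lia|].
  apply (bigO_ext (S k) (fun p => g (st_x p) ⊖ g (u (st_t p)))).
  - intros p Hp. unfold st_G1. rewrite (sd_f0 _ _ _ _ _ _ _ _ HS); [reflexivity|].
    destruct Hp; lra.
  - apply (bigO_g k st_x st_t); [intros p Hp; destruct Hp; lra|apply bigO_err].
Qed.

(** The identity z phi_1(z) = e^z - 1 removes the unbounded A u_n, leaving only bounded operators in
    the scheme. *)
Lemma phi1_F c p : 0 < c <= 1 -> valid p ->
  (c * st_h p) ⊙ at_op (Phi 1 c) T (st_h p) (A (st_x p) ⊕ g (st_x p)) =
  T (c * st_h p) (st_x p) ⊖ st_x p ⊕ (c * st_h p) ⊙ phiT T 1 (c * st_h p) (g (st_x p)).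
Proof.
  intros Hc Hp. pose proof (st_h_range p Hp) as Hh. rewrite at_op_Phi.
  assert (Hch : 0 < c * st_h p <= H) by nra.
  rewrite (lin_plus _ (phiT_linear HT 1 (c * st_h p) (ltac:(lra)))).
  pose proof (phiT_recurrence HT 0 (c * st_h p) _ _ Hch (v_dom p Hp)) as E.
  change (phiT T 0 (c * st_h p) (st_x p)) with (T (c * st_h p) (st_x p)) in E.
  replace (/ INR (fact 0)) with 1 in E by (simpl fact; rewrite INR_1, Rinv_1; reflexivity).
  transitivity ((c * st_h p) ⊙ phiT T 1 (c * st_h p) (A (st_x p)) ⊕
    (c * st_h p) ⊙ phiT T 1 (c * st_h p) (g (st_x p))); [lin_eq|].
  rewrite E. lin_eq.
Qed.

Lemma taylor_remainder_bound N c p : (1 <= N <= 5)%nat -> 0 < c <= 1 -> valid p ->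
  norm (f 0%nat (st_t p + c * st_h p)
    ⊖ vsum N (fun k => ((c * st_h p) ^ k / INR (fact k)) ⊙ f k (st_t p))) <= K * st_h p ^ N.
Proof.
  intros HN Hc Hp. destruct Hp as [P1 P2 P3 _ _ _].
  assert (0 <= c * st_h p <= st_h p) by nra.
  eapply Rle_trans; [apply (f_taylor HS N 0); (lia || lra)|].
  apply Rmult_le_compat_l; [lra|]. apply pow_incr. lra.
Qed.

(** For the coefficients of a stage this is psi_{k,i}; for the weights with c = 1 it is the defect
    of a quadrature condition. *)
Definition defect (n : nat) (cf : nat -> cfun) (c : R) (k : nat) : cfun :=
  (fold_right Defs.Add Zero
     (map (fun j => (node58 j ^ (k - 1) / INR (fact (k - 1))) *: cf j) (seq 2 n))
   - (c ^ k) *: Phi k c)%cf.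

(** Stages and update have the same form and are expanded together: with c = c_i and n = i - 2, or
    with c = 1 and n = 7. *)
Lemma step_expansion N n (cf : nat -> cfun) c : (1 <= S N <= 5)%nat -> (n <= 7)%nat ->
  0 < c <= 1 -> (forall j, nodes_in_01 (cf j)) ->
  exists q, bigO (S N) q /\ forall p, valid p ->
  st_x p ⊕ (c * st_h p) ⊙ at_op (Phi 1 c) T (st_h p) (A (st_x p) ⊕ g (st_x p))
  ⊕ st_h p ⊙ vsum n (fun j => at_op (cf (2 + j)%nat) T (st_h p) (g (st_U p (2 + j)%nat) ⊖ g (st_x p)))
  ⊖ u (st_t p + c * st_h p)
  = T (c * st_h p) (err p)
    ⊕ st_h p ⊙ vsum n (fun j => at_op (cf (2 + j)%nat) T (st_h p) (st_G (2 + j) p))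
    ⊕ vsum N (fun k => st_h p ^ (2 + k) ⊙ at_op (defect n cf c (2 + k)) T (st_h p) (f (S k) (st_t p)))
    ⊕ st_h p ⊙ q p.
Proof.
  intros HN Hn Hc Hcf.
  set (r := fun j p => f 0%nat (st_t p + node58 j * st_h p)
    ⊖ vsum (S N) (fun k => ((node58 j * st_h p) ^ k / INR (fact k)) ⊙ f k (st_t p))).
  set (rem := fun p => u (st_t p + c * st_h p) ⊖ T (c * st_h p) (u (st_t p))
    ⊖ vsum (S N) (fun j => (c * st_h p) ^ S j ⊙ phiT T (S j) (c * st_h p) (f j (st_t p)))).
  (* The remainder collects the effect of g(u_n) - g(u(t_n)), the Taylor remainders at the nodes,
     and the remainder of the exact solution, from which one factor h is taken out. *)
  exists (fun p => c ⊙ at_op (Phi 1 c) T (st_h p) (st_G1 p)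
    ⊖ vsum n (fun j => at_op (cf (2 + j)%nat) T (st_h p) (st_G1 p))
    ⊕ vsum n (fun j => at_op (cf (2 + j)%nat) T (st_h p) (r (2 + j)%nat p))
    ⊖ / st_h p ⊙ rem p).
  split.
  - apply (bigO_minus (S N) (fun p => c ⊙ at_op (Phi 1 c) T (st_h p) (st_G1 p)
      ⊖ vsum n (fun j => at_op (cf (2 + j)%nat) T (st_h p) (st_G1 p))
      ⊕ vsum n (fun j => at_op (cf (2 + j)%nat) T (st_h p) (r (2 + j)%nat p)))
      (fun p => / st_h p ⊙ rem p)).
    + apply (bigO_plus (S N) (fun p => c ⊙ at_op (Phi 1 c) T (st_h p) (st_G1 p)
        ⊖ vsum n (fun j => at_op (cf (2 + j)%nat) T (st_h p) (st_G1 p)))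
        (fun p => vsum n (fun j => at_op (cf (2 + j)%nat) T (st_h p) (r (2 + j)%nat p)))).
      * apply (bigO_minus (S N) (fun p => c ⊙ at_op (Phi 1 c) T (st_h p) (st_G1 p))).
        -- apply (bigO_scal (S N) c (fun p => at_op (Phi 1 c) T (st_h p) (st_G1 p))).
           apply (bigO_op (S N) (Phi 1 c)); [cbn; lra|apply bigO_G1].
        -- apply (bigO_vsum (S N) n (fun j p => at_op (cf (2 + j)%nat) T (st_h p) (st_G1 p))).
           intros j _. apply (bigO_op (S N)); [apply Hcf|apply bigO_G1].
      * apply (bigO_vsum (S N) n (fun j p => at_op (cf (2 + j)%nat) T (st_h p) (r (2 + j)%nat p))).
        intros j Hj. apply (bigO_op (S N)); [apply Hcf|].
        exists K, 1. split; [lra|]. split; [lra|]. intros p Hp _ _.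
        eapply Rle_trans; [apply taylor_remainder_bound; [exact HN|apply node58_pos; lia|exact Hp]|].
        apply Rmult_le_compat_l; [lra|]. pose proof (norm_ge_0 (err p)). lra.
    + exists (M * K), 1. split; [apply Rmult_le_pos; lra|]. split; [lra|]. intros p Hp _ _.
      destruct Hp as [P1 P2 P3 _ _ _]. assert (0 < c * st_h p <= st_h p) by nra.
      eapply Rle_trans; [apply norm_scal_le|].
      rewrite Rabs_right by (apply Rle_ge, Rlt_le, Rinv_0_lt_compat, P1).
      apply (Rmult_le_reg_l (st_h p)); [exact P1|].
      rewrite <- Rmult_assoc, Rinv_r, Rmult_1_l by lra.
      eapply Rle_trans; [apply (exact_expansion HT HS A u_gen u_sol length_H (S N)); (lia || lra)|].
      replace (st_h p * (M * K * (st_h p ^ S N + norm (err p)))) with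
        (M * K * (st_h p ^ S (S N) + st_h p * norm (err p))) by (simpl; ring).
      apply Rmult_le_compat_l; [apply Rmult_le_pos; lra|].
      assert ((c * st_h p) ^ S (S N) <= st_h p ^ S (S N)) by (apply pow_incr; lra).
      assert (0 <= st_h p * norm (err p)) by (apply Rmult_le_pos; [lra|apply norm_ge_0]). lra.
  - intros p Hp. cbv beta.
    pose proof (st_h_range p Hp) as Hh. 
    assert (Hl : forall F, nodes_in_01 F -> is_linear (at_op F T (st_h p)))
      by (intros F HF; apply (at_op_linear HT); [lra|exact HF]).
    rewrite (phi1_F c p Hc Hp).
    set (V := fun k => vsum n (fun j => (node58 (2 + j) ^ S k / INR (fact (S k)))
      ⊙ at_op (cf (2 + j)%nat) T (st_h p) (f (S k) (st_t p)))).
    (* D_{nj} splits into the error at stage j, the Taylor remainder at its node, minus the error at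
       u_n, and the Taylor terms of orders 1 to N; the terms of order 0 cancel. *)
    assert (ED : forall j, (j < n)%nat ->
      at_op (cf (2 + j)%nat) T (st_h p) (g (st_U p (2 + j)%nat) ⊖ g (st_x p)) =
      at_op (cf (2 + j)%nat) T (st_h p) (st_G (2 + j) p)
      ⊕ at_op (cf (2 + j)%nat) T (st_h p) (r (2 + j)%nat p)
      ⊖ at_op (cf (2 + j)%nat) T (st_h p) (st_G1 p)
      ⊕ vsum N (fun k => st_h p ^ S k ⊙ ((node58 (2 + j) ^ S k / INR (fact (S k)))
          ⊙ at_op (cf (2 + j)%nat) T (st_h p) (f (S k) (st_t p))))).
    { intros j Hj. pose proof (Hl _ (Hcf (2 + j)%nat)) as L.
      rewrite (vsum_ext N _ (fun k => at_op (cf (2 + j)%nat) T (st_h p)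
        (((node58 (2 + j) * st_h p) ^ S k / INR (fact (S k))) ⊙ f (S k) (st_t p)))).
      - rewrite <- (lin_vsum _ L), <- !(lin_plus _ L), <- (lin_minus _ L), <- (lin_plus _ L).
        f_equal. unfold r, st_G, st_G1. rewrite vsum_head.
        destruct (stage_time (2 + j) p (ltac:(lia)) Hp) as [Ht _].
        rewrite (sd_f0 _ _ _ _ _ _ _ _ HS _ Ht).
        replace ((node58 (2 + j) * st_h p) ^ 0 / INR (fact 0)) with 1
          by (simpl pow; simpl fact; rewrite INR_1; field).
        lin_eq.
      - intros k _. rewrite (lin_scal _ L), Rpow_mult_distr. lin_field. apply INR_fact_neq_0. }
    rewrite (vsum_ext n _ _ ED). clear ED.
    rewrite !vsum_plus, vsum_minus, vsum_plus, vsum_exchange.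
    rewrite (vsum_ext N _ (fun k => st_h p ^ S k ⊙ V k))
      by (intros k _; rewrite vsum_scal; reflexivity).
    rewrite (vsum_ext N (fun k => st_h p ^ (2 + k) ⊙ at_op (defect n cf c (2 + k)) T (st_h p) (f (S k) (st_t p)))
      (fun k => st_h p ⊙ (st_h p ^ S k ⊙ V k)
        ⊖ (c * st_h p) ^ (2 + k) ⊙ phiT T (2 + k) (c * st_h p) (f (S k) (st_t p)))).
    + rewrite vsum_minus, vsum_scal.
      assert (Erem : u (st_t p + c * st_h p) = T (c * st_h p) (u (st_t p))
        ⊕ ((c * st_h p) ⊙ phiT T 1 (c * st_h p) (f 0%nat (st_t p))
        ⊕ vsum N (fun k => (c * st_h p) ^ (2 + k) ⊙ phiT T (2 + k) (c * st_h p) (f (S k) (st_t p))))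
        ⊕ rem p).
      { unfold rem. rewrite vsum_head. simpl (_ ^ 1). rewrite Rmult_1_r.
        cbn [Nat.add]. lin_eq. }
      rewrite Erem. unfold err.
      assert (Hch : 0 <= c * st_h p <= H) by nra.
      rewrite (lin_minus _ (sg_lin _ _ _ _ HT _ (proj1 Hch))).
      assert (EG : at_op (Phi 1 c) T (st_h p) (st_G1 p) = phiT T 1 (c * st_h p) (g (st_x p))
        ⊖ phiT T 1 (c * st_h p) (f 0%nat (st_t p))).
      { rewrite at_op_Phi. apply (lin_minus _ (phiT_linear HT 1 (c * st_h p) Hch)). }
      rewrite EG.
      lin_field. lra.
    + intros k _. unfold defect. rewrite at_op_Sub, at_op_fold_seq, at_op_Scale, at_op_Phi.
      unfold V.
      rewrite (vsum_ext n (fun j => at_op ((node58 (2 + j) ^ (2 + k - 1) / INR (fact (2 + k - 1)))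
        *: cf (2 + j)%nat)%cf T (st_h p) (f (S k) (st_t p)))
        (fun j => (node58 (2 + j) ^ S k / INR (fact (S k)))
          ⊙ at_op (cf (2 + j)%nat) T (st_h p) (f (S k) (st_t p)))).
      * rewrite Rpow_mult_distr. change (st_h p ^ (2 + k)) with (st_h p * st_h p ^ S k). lin_eq.
      * intros j _. replace (2 + k - 1)%nat with (S k) by lia. apply at_op_Scale.
Qed.

Lemma at_op_vanishes F h v : (forall P, evalR P F = 0) -> at_op F T h v = vzero.
Proof. intros E. apply (at_op_eq F Zero). exact E. Qed.

Lemma stage_expansion i : (2 <= i <= 8)%nat -> exists q, bigO 5 q /\ forall p, valid p ->
  st_E i p =
  st_h p ⊙ vsum (i - 2) (fun j => at_op (acoef58 i (2 + j)) T (st_h p) (st_G (2 + j) p))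
  ⊕ (st_h p ^ 2 ⊙ at_op (psi expRK5s8 2 i) T (st_h p) (f 1%nat (st_t p))
     ⊕ st_h p ^ 3 ⊙ at_op (psi expRK5s8 3 i) T (st_h p) (f 2%nat (st_t p))
     ⊕ st_h p ^ 4 ⊙ at_op (psi expRK5s8 4 i) T (st_h p) (f 3%nat (st_t p)))
  ⊕ q p.
Proof.
  intros Hi.
  destruct (step_expansion 3 (i - 2) (acoef58 i) (node58 i)) as (q & Hq & Eq);
    [lia|lia|apply node58_pos, Hi|intros j; apply acoef58_nodes|].
  exists (fun p => at_op (Phi 0 (node58 i)) T (st_h p) (err p) ⊕ st_h p ⊙ q p). split.
  - apply bigO_plus; [|apply bigO_h, Hq].
    apply bigO_op; [|apply bigO_err]. pose proof (node58_pos i Hi). cbn. lra.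
  - intros p Hp. unfold st_E. rewrite (v_stage p Hp i Hi), (Eq p Hp), at_op_Phi.
    cbn [vsum Nat.add phiT].
    change (defect (i - 2) (acoef58 i) (node58 i)) with (fun k => psi expRK5s8 k i).
    cbv beta. lin_eq.
Qed.

Lemma bigO_h_op k F (q : step -> X) : nodes_in_01 F -> bigO k q ->
  bigO (S k) (fun p => st_h p ⊙ at_op F T (st_h p) (q p)).
Proof. intros HF Hq. apply bigO_h, bigO_op; assumption. Qed.

Lemma bigO_psi k j i m : (2 <= i <= 8)%nat -> (1 <= m <= 5)%nat ->
  bigO k (fun p => st_h p ^ k ⊙ at_op (psi expRK5s8 j i) T (st_h p) (f m (st_t p))).
Proof.
  intros Hi Hm. apply (bigO_hpow k (fun p => at_op (psi expRK5s8 j i) T (st_h p) (f m (st_t p)))).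
  apply (bigO_op 0 (psi expRK5s8 j i)); [apply psi58_nodes, Hi|apply bigO_f, Hm].
Qed.

(** * Orders and leading terms of the stage errors *)

Ltac stage_terms :=
  cbn [vsum Nat.sub Nat.add acoef58]; rewrite ?at_op_Zero.

(** The h^2 term with psi_{2,2} stays. Only stage 3 uses stage 2, and there the factor h makes the
    contribution of order 3. *)
Lemma stage2 : bigO 2 (st_E 2).
Proof.
  destruct (stage_expansion 2) as (q & Hq & Eq); [lia|].
  eapply bigO_ext; [intros p Hp; symmetry; apply (Eq p Hp)|].
  apply bigO_plus; [|apply (bigO_weaken 2 5); [lia|exact Hq]].
  apply bigO_plus.
  - apply (bigO_ext 2 (fun _ => vzero)); [intros; simpl; lin_eq|apply bigO_zero].
  - apply bigO_plus; [apply bigO_plus|].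
    + apply bigO_psi; lia.
    + apply (bigO_weaken 2 3); [lia|]. apply bigO_psi; lia.
    + apply (bigO_weaken 2 4); [lia|]. apply bigO_psi; lia.
Qed.

Lemma stage3 : bigO 3 (st_E 3).
Proof.
  destruct (stage_expansion 3) as (q & Hq & Eq); [lia|].
  apply (bigO_ext 3 (fun p =>
    st_h p ⊙ at_op (acoef58 3 2) T (st_h p) (st_G 2 p)
    ⊕ (st_h p ^ 3 ⊙ at_op (psi expRK5s8 3 3) T (st_h p) (f 2%nat (st_t p))
       ⊕ st_h p ^ 4 ⊙ at_op (psi expRK5s8 4 3) T (st_h p) (f 3%nat (st_t p)))
    ⊕ q p)).
  - intros p Hp. rewrite (Eq p Hp), (at_op_vanishes (psi expRK5s8 2 3)) by (apply psi2_zero; lia).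
    cbn [vsum Nat.sub Nat.add]. lin_eq.
  - apply bigO_plus; [apply bigO_plus; [|apply bigO_plus]|].
    + apply (bigO_h_op 2); [apply acoef58_nodes|]. apply (bigO_stage_G 1); [lia|apply stage2].
    + apply bigO_psi; lia.
    + apply (bigO_weaken 3 4); [lia|]. apply bigO_psi; lia.
    + apply (bigO_weaken 3 5); [lia|exact Hq].
Qed.

(** Stage 4 is the only stage with an error of order 3 that the stages 6 to 8 use directly, so its
    leading term is kept explicitly. *)
Definition lead4 (p : step) : X := at_op (psi expRK5s8 3 4) T (st_h p) (f 2%nat (st_t p)).

Lemma stage4 : bigO 4 (fun p => st_E 4 p ⊖ st_h p ^ 3 ⊙ lead4 p).
Proof.
  destruct (stage_expansion 4) as (q & Hq & Eq); [lia|].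
  apply (bigO_ext 4 (fun p =>
    st_h p ⊙ at_op (acoef58 4 3) T (st_h p) (st_G 3 p)
    ⊕ st_h p ^ 4 ⊙ at_op (psi expRK5s8 4 4) T (st_h p) (f 3%nat (st_t p))
    ⊕ q p)).
  - intros p Hp. rewrite (Eq p Hp), (at_op_vanishes (psi expRK5s8 2 4)) by (apply psi2_zero; lia).
    unfold lead4. stage_terms. lin_eq.
  - apply bigO_plus; [apply bigO_plus|].
    + apply (bigO_h_op 3); [apply (acoef58_nodes 4 3)|].
      apply (bigO_stage_G 2); [lia|apply stage3].
    + apply bigO_psi; lia.
    + apply (bigO_weaken 4 5); [lia|exact Hq].
Qed.

Lemma bigO_add_lead k q (l : step -> X) : bigO (S k) (fun p => q p ⊖ st_h p ^ k ⊙ l p) ->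
  bigO 0 l -> bigO k q.
Proof.
  intros Hq Hl. apply (bigO_ext k (fun p => (q p ⊖ st_h p ^ k ⊙ l p) ⊕ st_h p ^ k ⊙ l p));
    [intros; lin_eq|].
  apply bigO_plus; [apply (bigO_weaken k (S k)); [lia|exact Hq]|apply bigO_hpow, Hl].
Qed.

Lemma bigO_lead4 : bigO 0 lead4.
Proof. apply bigO_op; [apply psi58_nodes; lia|apply bigO_f; lia]. Qed.

(** To leading order, g maps an error of a stage to its image under the Jacobian at the start of the
    step. *)
Lemma stage_G_lead k i (l : step -> X) : (2 <= i <= 8)%nat ->
  bigO (S (S k)) (fun p => st_E i p ⊖ st_h p ^ S k ⊙ l p) -> bigO 0 l ->
  bigO (S (S k)) (fun p => st_G i p ⊖ st_h p ^ S k ⊙ J (st_t p) (l p)).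
Proof.
  intros Hi HE Hl.
  apply (bigO_ext (S (S k)) (fun p => (st_G i p ⊖ J (st_t p) (st_E i p))
    ⊕ J (st_t p) (st_E i p ⊖ st_h p ^ S k ⊙ l p))).
  - intros p Hp.
    assert (HJ : is_linear (J (st_t p))) by (apply (sd_J_linear _ _ _ _ _ _ _ _ HS); destruct Hp; lra).
    rewrite (lin_minus _ HJ), (lin_scal _ HJ). lin_eq.
  - apply bigO_plus.
    + apply bigO_stage_G_linearized; [exact Hi|]. apply (bigO_add_lead (S k) _ l HE Hl).
    + apply bigO_J, HE.
Qed.

Lemma stage_G4 : bigO 4 (fun p => st_G 4 p ⊖ st_h p ^ 3 ⊙ J (st_t p) (lead4 p)).
Proof. apply (stage_G_lead 2 4 lead4); [lia|apply stage4|apply bigO_lead4]. Qed.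

Lemma stage_G4_3 : bigO 3 (st_G 4).
Proof.
  apply (bigO_stage_G 2); [lia|]. apply (bigO_add_lead 3 _ lead4); [apply stage4|apply bigO_lead4].
Qed.

Lemma stage5 : bigO 4 (st_E 5).
Proof.
  destruct (stage_expansion 5) as (q & Hq & Eq); [lia|].
  apply (bigO_ext 4 (fun p =>
    (st_h p ⊙ at_op (acoef58 5 3) T (st_h p) (st_G 3 p)
     ⊕ st_h p ⊙ at_op (acoef58 5 4) T (st_h p) (st_G 4 p))
    ⊕ st_h p ^ 4 ⊙ at_op (psi expRK5s8 4 5) T (st_h p) (f 3%nat (st_t p))
    ⊕ q p)).
  - intros p Hp. rewrite (Eq p Hp), (at_op_vanishes (psi expRK5s8 2 5)) by (apply psi2_zero; lia).
    rewrite (at_op_vanishes (psi expRK5s8 3 5)) by (apply psi3_zero; lia).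
    stage_terms. lin_eq.
  - apply bigO_plus; [apply bigO_plus; [apply bigO_plus|]|].
    + apply (bigO_h_op 3); [apply (acoef58_nodes 5 3)|]. apply (bigO_stage_G 2); [lia|apply stage3].
    + apply (bigO_h_op 3); [apply (acoef58_nodes 5 4)|apply stage_G4_3].
    + apply bigO_psi; lia.
    + apply (bigO_weaken 4 5); [lia|exact Hq].
Qed.

(* The factor a_(i4) of the leading term is Zero for i = 8. *)
Definition lead (i : nat) (p : step) : X :=
  at_op (psi expRK5s8 4 i) T (st_h p) (f 3%nat (st_t p))
  ⊕ at_op (acoef58 i 4) T (st_h p) (J (st_t p) (lead4 p)).

Lemma bigO_lead i : (2 <= i <= 8)%nat -> bigO 0 (lead i).
Proof.
  intros Hi. apply bigO_plus.
  - apply bigO_op; [apply psi58_nodes, Hi|apply bigO_f; lia].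
  - apply bigO_op; [apply acoef58_nodes|apply bigO_J, bigO_lead4].
Qed.

(** Here a_{i2} = a_{i3} = 0. The stages from 5 on have errors of order 4 and contribute at order 5
    through the factor h; so at order 4 only psi_{4,i} and stage 4 remain. *)
Lemma stage_late i : (6 <= i <= 8)%nat ->
  (forall j, (5 <= j < i)%nat -> bigO 4 (st_E j)) ->
  bigO 5 (fun p => st_E i p ⊖ st_h p ^ 4 ⊙ lead i p).
Proof.
  intros Hi HE. destruct (stage_expansion i) as (q & Hq & Eq); [lia|].
  set (tail := fun p => st_h p ⊙ vsum (i - 5) (fun j => at_op (acoef58 i (5 + j)) T (st_h p) (st_G (5 + j) p))).
  apply (bigO_ext 5 (fun p =>
    st_h p ⊙ at_op (acoef58 i 4) T (st_h p) (st_G 4 p ⊖ st_h p ^ 3 ⊙ J (st_t p) (lead4 p))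
    ⊕ tail p ⊕ q p)).
  - intros p Hp. rewrite (Eq p Hp), (at_op_vanishes (psi expRK5s8 2 i)) by (apply psi2_zero; lia).
    rewrite (at_op_vanishes (psi expRK5s8 3 i)) by (apply psi3_zero; lia).
    assert (L : is_linear (at_op (acoef58 i 4) T (st_h p))).
    { apply (at_op_linear HT); [pose proof (st_h_range p Hp); lra|apply acoef58_nodes]. }
    rewrite (lin_minus _ L), (lin_scal _ L). unfold tail, lead.
    assert (Hc : i = 6%nat \/ i = 7%nat \/ i = 8%nat) by lia.
    destruct Hc as [->|[->| ->]]; stage_terms; lin_eq.
  - apply bigO_plus; [apply bigO_plus|exact Hq].
    + apply (bigO_h_op 4); [apply acoef58_nodes|apply stage_G4].
    + apply (bigO_h 4 (fun p => vsum (i - 5) (fun j => at_op (acoef58 i (5 + j)) T (st_h p) (st_G (5 + j) p)))).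
      apply (bigO_vsum 4 (i - 5) (fun j p => at_op (acoef58 i (5 + j)) T (st_h p) (st_G (5 + j) p))).
      intros j Hj. apply bigO_op; [apply acoef58_nodes|].
      apply (bigO_stage_G 3); [lia|]. apply HE. lia.
Qed.

Lemma stage_late_4 i : (6 <= i <= 8)%nat -> (forall j, (5 <= j < i)%nat -> bigO 4 (st_E j)) ->
  bigO 4 (st_E i).
Proof.
  intros Hi HE. apply (bigO_add_lead 4 _ (lead i)); [apply stage_late; assumption|].
  apply bigO_lead. lia.
Qed.

Lemma stages_4 i : (5 <= i <= 8)%nat -> bigO 4 (st_E i).
Proof.
  induction i as [i IH] using lt_wf_ind. intros Hi.
  destruct (Nat.eq_dec i 5) as [->|Hne]; [apply stage5|].
  apply stage_late_4; [lia|]. intros j Hj. apply IH; lia.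
Qed.

Lemma stage_G_late i : (6 <= i <= 8)%nat ->
  bigO 5 (fun p => st_G i p ⊖ st_h p ^ 4 ⊙ J (st_t p) (lead i p)).
Proof.
  intros Hi. apply (stage_G_lead 3 i (lead i)); [lia| |apply bigO_lead; lia].
  apply stage_late; [exact Hi|]. intros j Hj. apply stages_4. lia.
Qed.

Definition quadrature_defect : cfun := (weight_moment 4 - Phi 5 1)%cf.

(* Order conditions 9 and 10 with b_i(0), combined by linearity of the Jacobian *)
Lemma weighted_lead_zero p : valid p ->
  at_zero (bcoef58 6) ⊙ J (st_t p) (lead 6 p) ⊕ at_zero (bcoef58 7) ⊙ J (st_t p) (lead 7 p)
  ⊕ at_zero (bcoef58 8) ⊙ J (st_t p) (lead 8 p) = vzero.
Proof.
  intros Hp.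
  assert (HJ : is_linear (J (st_t p))) by (apply (sd_J_linear _ _ _ _ _ _ _ _ HS); destruct Hp; lra).
  rewrite <- !(lin_scal _ HJ), <- !(lin_plus _ HJ).
  rewrite <- (lin_zero _ HJ). f_equal. unfold lead.
  set (v := J (st_t p) (lead4 p)). set (w := f 3%nat (st_t p)).
  transitivity (at_op (at_zero (bcoef58 6) *: psi expRK5s8 4 6 + at_zero (bcoef58 7) *: psi expRK5s8 4 7
      + at_zero (bcoef58 8) *: psi expRK5s8 4 8)%cf T (st_h p) w
    ⊕ at_op (at_zero (bcoef58 6) *: acoef58 6 4 + at_zero (bcoef58 7) *: acoef58 7 4)%cf T (st_h p) v).
  - rewrite !at_op_Add, !at_op_Scale. cbn [acoef58]. rewrite (at_op_Zero (st_h p) v). lin_eq.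
  - rewrite at_op_vanishes by (intros P; exact (weighted_psi4_zero P)).
    rewrite at_op_vanishes by (intros P; exact (weighted_a4_zero P)). lin_eq.
Qed.

Definition smoothed (F : cfun) (p : step) (v : X) : X :=
  at_op F T (st_h p) v ⊖ at_zero F ⊙ v.

Lemma local_error : exists q, bigO 5 q /\ forall p, valid p ->
  st_next p ⊖ u (st_t p + st_h p) =
  T (st_h p) (err p)
  ⊕ st_h p ^ 5 ⊙ (smoothed quadrature_defect p (f 4%nat (st_t p))
     ⊕ (smoothed (bcoef58 6) p (J (st_t p) (lead 6 p))
     ⊕ (smoothed (bcoef58 7) p (J (st_t p) (lead 7 p))
     ⊕ smoothed (bcoef58 8) p (J (st_t p) (lead 8 p)))))
  ⊕ st_h p ⊙ q p.
Proof.
  destruct (step_expansion 4 7 bcoef58 1) as (q & Hq & Eq);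
    [lia|lia|lra|intros j; apply nodes_1_in_01, bcoef58_nodes|].
  exists (fun p => q p ⊕
    (at_op (bcoef58 6) T (st_h p) (st_G 6 p ⊖ st_h p ^ 4 ⊙ J (st_t p) (lead 6 p))
     ⊕ (at_op (bcoef58 7) T (st_h p) (st_G 7 p ⊖ st_h p ^ 4 ⊙ J (st_t p) (lead 7 p))
     ⊕ at_op (bcoef58 8) T (st_h p) (st_G 8 p ⊖ st_h p ^ 4 ⊙ J (st_t p) (lead 8 p))))).
  split.
  - apply bigO_plus; [exact Hq|].
    apply bigO_plus; [|apply bigO_plus];
      (apply bigO_op; [apply nodes_1_in_01, bcoef58_nodes|apply stage_G_late; lia]).
  - intros p Hp. specialize (Eq p Hp). rewrite Rmult_1_l in Eq. rewrite (v_next p Hp).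
    rewrite Eq. cbn [vsum Nat.add].
    assert (D : forall k, (2 <= k <= 4)%nat -> forall v, at_op (defect 7 bcoef58 1 k) T (st_h p) v = vzero).
    { intros k Hk v. apply at_op_vanishes. intros P.
      pose proof (weight_moments (k - 1) (ltac:(lia)) P) as W.
      change (defect 7 bcoef58 1 k) with (weight_moment (k - 1) - (1 ^ k) *: Phi k 1)%cf.
      cbn [evalR]. rewrite W, pow1. replace (S (k - 1)) with k by lia. ring. }
    rewrite !D by lia.
    assert (D5 : forall v, at_op (defect 7 bcoef58 1 5) T (st_h p) v = smoothed quadrature_defect p v).
    { intros v. unfold smoothed.
      transitivity (at_op quadrature_defect T (st_h p) v).
      - apply at_op_eq. intros P. unfold quadrature_defect.
        change (defect 7 bcoef58 1 5) with (weight_moment 4 - (1 ^ 5) *: Phi 5 1)%cf.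
        cbn [evalR]. ring.
      - replace (at_zero quadrature_defect) with 0; [lin_eq|].
        unfold quadrature_defect. pose proof weight_moment4_at_zero as W.
        unfold at_zero in *. cbn [evalR]. rewrite W. ring. }
    rewrite D5.
    pose proof (weighted_lead_zero p Hp) as W.
    assert (L : forall i, is_linear (at_op (bcoef58 i) T (st_h p))).
    { intros i. apply (at_op_linear HT); [pose proof (st_h_range p Hp); lra|].
      apply nodes_1_in_01, bcoef58_nodes. }
    unfold smoothed at 3 4 5.
    rewrite !(lin_minus _ (L _)), !(lin_scal _ (L _)).
    change (bcoef58 2) with Zero. change (bcoef58 3) with Zero. change (bcoef58 4) with Zero.
    change (bcoef58 5) with Zero. rewrite !at_op_Zero.
    set (J6 := J (st_t p) (lead 6 p)) in *. set (J7 := J (st_t p) (lead 7 p)) in *.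
    set (J8 := J (st_t p) (lead 8 p)) in *.
    (* One side contains b_i(hA), the other b_i(hA) - b_i(0); they differ by the combination W,
       which vanishes. *)
    match goal with |- ?x = ?y =>
      transitivity (y ⊕ st_h p ^ 5 ⊙ (at_zero (bcoef58 6) ⊙ J6 ⊕ at_zero (bcoef58 7) ⊙ J7
        ⊕ at_zero (bcoef58 8) ⊙ J8)); [lin_eq|rewrite W; lin_eq] end.
Qed.

End OneStep.

(** * Error accumulation *)

Lemma vsum_rev {V : NormedModule R_AbsRing} n (F : nat -> V) :
  vsum n (fun j => F (n - 1 - j)%nat) = vsum n F.
Proof.
  induction n as [|n IH]; [reflexivity|].
  rewrite vsum_head. cbn [vsum]. rewrite <- IH.
  replace (S n - 1 - 0)%nat with n by lia.
  rewrite (vsum_ext n (fun j => F (S n - 1 - S j)%nat) (fun j => F (n - 1 - j)%nat)); [lin_eq|].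
  intros j Hj. f_equal. lia.
Qed.

(** The geometric sum of discrete Gronwall, multiplied by l so that no quotient occurs. *)
Lemma norm_vsum_geometric {V : NormedModule R_AbsRing} n (F : nat -> V) c1 c2 l : 0 <= l ->
  (forall j, (j < n)%nat -> norm (F j) <= c1 + c2 * (1 + l) ^ j) ->
  l * norm (vsum n F) <= l * INR n * c1 + c2 * ((1 + l) ^ n - 1).
Proof.
  intros Hl. induction n as [|n IH]; intros HF.
  - simpl. rewrite norm_vzero. lra.
  - specialize (IH (fun j Hj => HF j (Nat.lt_lt_succ_r _ _ Hj))).
    specialize (HF n (Nat.lt_succ_diag_r n)).
    cbn [vsum]. pose proof (norm_plus_le (vsum n F) (F n)) as Hp.
    apply (Rmult_le_compat_l l) in Hp; [|exact Hl].
    apply (Rmult_le_compat_l l) in HF; [|exact Hl].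
    rewrite S_INR. simpl pow. lra.
Qed.

Lemma pow_le_exp x n : 0 <= x -> (1 + x) ^ n <= exp (INR n * x).
Proof.
  intros Hx. induction n as [|n IH].
  - simpl. rewrite Rmult_0_l, exp_0. lra.
  - rewrite S_INR. replace ((INR n + 1) * x) with (x + INR n * x) by ring. rewrite exp_plus.
    simpl pow. apply Rmult_le_compat; [lra|apply pow_le; lra|apply exp_ineq1_le|exact IH].
Qed.

Section Accumulation.

Context {X : CompleteNormedModule R_AbsRing}.
Context {T : R -> X -> X} {H M C : R} (HT : semigroup_bounds T H M C).

Let M_ge_1 := sg_M _ _ _ _ HT.

(** The solution of e_{n+1} = T(h) e_n + q_n with e_0 = 0. *)
Definition conv (h : R) (n : nat) (q : nat -> X) : X :=
  vsum n (fun j => T (INR (n - 1 - j) * h) (q j)).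

Lemma T_grid_linear h k : 0 < h -> is_linear (T (INR k * h)).
Proof.
  intros Hh. apply (sg_lin _ _ _ _ HT). apply Rmult_le_pos; [apply pos_INR|lra].
Qed.

Lemma conv_S h n q : 0 < h -> conv h (S n) q = T h (conv h n q) ⊕ q n.
Proof.
  intros Hh. unfold conv. cbn [vsum].
  rewrite (lin_vsum _ (sg_lin _ _ _ _ HT h (ltac:(lra)))).
  replace (S n - 1 - n)%nat with 0%nat by lia.
  replace (INR 0 * h) with 0 by (simpl; ring). rewrite (sg_0 _ _ _ _ HT). f_equal.
  apply vsum_ext. intros j Hj.
  rewrite <- (sg_add _ _ _ _ HT) by (first [lra | apply Rmult_le_pos; [apply pos_INR|lra]]).
  f_equal. replace (S n - 1 - j)%nat with (S (n - 1 - j)) by lia. rewrite S_INR. ring.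
Qed.

Lemma conv_head h n q : conv h (S n) q = T (INR n * h) (q 0%nat) ⊕ conv h n (fun j => q (S j)).
Proof.
  unfold conv. rewrite vsum_head. replace (S n - 1 - 0)%nat with n by lia. f_equal.
  apply vsum_ext. intros j Hj. replace (S n - 1 - S j)%nat with (n - 1 - j)%nat by lia. reflexivity.
Qed.

Definition abel_const (F : cfun) : R := cnorm F * sum_const (M := M) (C := C).

Lemma abel_const_pos F : 0 <= abel_const F.
Proof.
  apply Rmult_le_pos; [apply cnorm_pos|]. unfold sum_const. pose proof (pow2_ge_0 C). lra.
Qed.

(* Summation by parts: the operators F(hA) - F(0) sum up to bounded operators, so
   a slowly varying w may be applied without loss. *)
Lemma conv_smoothed_bound F h d n : nodes_1 F -> 0 < h <= H -> 0 <= d -> INR n * h <= H ->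
  forall w : nat -> X, (forall j, (S j < n)%nat -> norm (w (S j) ⊖ w j) <= d) ->
  norm (conv h n (fun j => at_op F T h (w j) ⊖ at_zero F ⊙ w j))
  <= abel_const F * (norm (w 0%nat) + INR n * d).
Proof.
  intros HF Hh Hd. pose proof (abel_const_pos F) as Hac.
  assert (HL : is_linear (fun v => at_op F T h v ⊖ at_zero F ⊙ v)).
  { pose proof (at_op_linear HT F h (ltac:(lra)) (nodes_1_in_01 F HF)) as L.
    apply (linear_intro _ (cnorm F * M + Rabs (at_zero F))).
    - intros x y. rewrite (lin_plus _ L). lin_eq.
    - intros r x. rewrite (lin_scal _ L). lin_eq.
    - intros x. eapply Rle_trans; [apply norm_minus_le|].
      pose proof (at_op_bound HT F h x (ltac:(lra)) (nodes_1_in_01 F HF)).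
      pose proof (norm_scal_le (at_zero F) x). lra. }
  induction n as [|n IH]; intros Hn w Hw.
  - unfold conv. cbn [vsum]. rewrite norm_vzero. apply Rmult_le_pos; [exact Hac|].
    simpl. pose proof (norm_ge_0 (w 0%nat)). lra.
  - assert (Hn' : INR n * h <= H) by (rewrite S_INR in Hn; lra).
    set (L := fun v => at_op F T h v ⊖ at_zero F ⊙ v) in *.
    change (norm (conv h (S n) (fun j => L (w j))) <= abel_const F * (norm (w 0%nat) + INR (S n) * d)).
    (* The constant part w_0 is split off. In the rest the entry j = 0 vanishes, so a sum with one
       term fewer remains, and its first entry has norm at most d. *)
    replace (conv h (S n) (fun j => L (w j))) with
      (conv h (S n) (fun _ => L (w 0%nat)) ⊕ conv h (S n) (fun j => L (w j ⊖ w 0%nat))).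
    + eapply Rle_trans; [apply norm_plus_le|].
      assert (A1 : norm (conv h (S n) (fun _ => L (w 0%nat))) <= abel_const F * norm (w 0%nat)).
      { unfold conv. rewrite (vsum_rev (S n) (fun k => T (INR k * h) (L (w 0%nat)))).
        unfold abel_const. rewrite Rmult_assoc. apply (sum_at_op_bound HT); [lra|exact Hn|lra|exact HF]. }
      assert (A2 : norm (conv h (S n) (fun j => L (w j ⊖ w 0%nat))) <= abel_const F * (INR (S n) * d)).
      { rewrite conv_head.
        replace (w 0%nat ⊖ w 0%nat) with (vzero : X) by lin_eq.
        rewrite (lin_zero L HL), (lin_zero _ (T_grid_linear h n (proj1 Hh))).
        match goal with |- norm (vzero ⊕ ?v) <= _ => replace (vzero ⊕ v) with v by lin_eq end.
        destruct n as [|n].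
        - unfold conv. cbn [vsum]. rewrite norm_vzero. simpl. apply Rmult_le_pos; lra.
        - eapply Rle_trans; [apply (IH Hn' (fun j => w (S j) ⊖ w 0%nat))|].
          + intros j Hj. replace (w (S (S j)) ⊖ w 0%nat ⊖ (w (S j) ⊖ w 0%nat))
              with (w (S (S j)) ⊖ w (S j)) by lin_eq. apply Hw. lia.
          + apply Rmult_le_compat_l; [exact Hac|].
            pose proof (Hw 0%nat (ltac:(lia))). rewrite (S_INR (S n)). lra. }
      lra.
    + unfold conv. rewrite <- vsum_plus. apply vsum_ext. intros j Hj.
      rewrite <- (lin_plus _ (T_grid_linear h _ (proj1 Hh))), <- (lin_plus L HL). do 2 f_equal. lin_eq.
Qed.

End Accumulation.

(** * The global error *)

Section Global.

Context {X : CompleteNormedModule R_AbsRing}.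
Context {T : R -> X -> X} {H M C : R} (HT : semigroup_bounds T H M C).
Context {a b rho : R} {u : R -> X} {g : X -> X} {f : nat -> R -> X} {J : R -> X -> X} {K : R}
  (HS : smooth_data a b rho u g f J K).
Variable A : X -> X.
Hypothesis u_gen : forall t, a <= t <= b -> is_gen T (u t) (A (u t)).
Hypothesis u_sol : forall t, a <= t <= b -> diff_in a b u t (A (u t) ⊕ g (u t)).
Hypothesis A_gen : forall x, in_dom T x -> is_gen T x (A x).
Hypothesis length_H : b - a = H.
Hypothesis rho_pos : 0 < rho.

Let M_ge_1 := sg_M _ _ _ _ HT.
Let K_ge_1 := sd_K _ _ _ _ _ _ _ _ HS.
Let H_pos := sg_H _ _ _ _ HT.

(** The first argument is the step size, and B must not depend on it; only the variation in time
    matters for summation by parts. *)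
Definition bounded_lipschitz (w : R -> R -> X) : Prop :=
  exists B, 0 <= B /\ forall h t, 0 < h <= H -> a <= t <= b -> norm (w h t) <= B /\
  forall s, a <= s <= b -> norm (w h t ⊖ w h s) <= B * Rabs (t - s).

Lemma bl_f k : (1 <= k <= 4)%nat -> bounded_lipschitz (fun _ t => f k t).
Proof.
  intros Hk. exists K. split; [lra|]. intros _ t _ Ht. split.
  - apply (sd_f_bound _ _ _ _ _ _ _ _ HS); [lia|exact Ht].
  - assert (HL : forall s t, a <= s -> s <= t -> t <= b -> norm (f k t ⊖ f k s) <= K * Rabs (t - s)).
    { intros s r Hs Hsr Hr. pose proof (f_taylor HS 1 k s (r - s) (ltac:(lia)) Hs (ltac:(lra)) (ltac:(lra))) as E.
      cbn [vsum] in E. rewrite Nat.add_0_r, pow_1 in E. rewrite Rabs_right by lra.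
      replace (s + (r - s)) with r in E by ring.
      replace (f k r ⊖ f k s) with (f k r ⊖ (vzero ⊕ ((r - s) ^ 0 / INR (fact 0)) ⊙ f k s)); [exact E|].
      simpl pow. simpl fact. rewrite INR_1. lin_field. }
    intros s Hs. destruct (Rle_dec s t).
    + apply HL; lra.
    + rewrite norm_minus_sym, Rabs_minus_sym. apply HL; lra.
Qed.

Lemma bl_plus w1 w2 : bounded_lipschitz w1 -> bounded_lipschitz w2 ->
  bounded_lipschitz (fun h t => w1 h t ⊕ w2 h t).
Proof.
  intros (B1 & HB1 & H1) (B2 & HB2 & H2). exists (B1 + B2). split; [lra|].
  intros h t Hh Ht. destruct (H1 h t Hh Ht) as [G1 G2]. destruct (H2 h t Hh Ht) as [G3 G4]. split.
  - eapply Rle_trans; [apply norm_plus_le|]. lra.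
  - intros s Hs. replace (w1 h t ⊕ w2 h t ⊖ (w1 h s ⊕ w2 h s)) with
      ((w1 h t ⊖ w1 h s) ⊕ (w2 h t ⊖ w2 h s)) by lin_eq.
    eapply Rle_trans; [apply norm_plus_le|]. specialize (G2 s Hs). specialize (G4 s Hs). lra.
Qed.

Lemma bl_op F w : nodes_in_01 F -> bounded_lipschitz w ->
  bounded_lipschitz (fun h t => at_op F T h (w h t)).
Proof.
  intros HF (B & HB & Hw). pose proof (cnorm_pos F) as Hc.
  assert (HcM : 0 <= cnorm F * M) by (apply Rmult_le_pos; lra).
  exists (cnorm F * M * B). split; [apply Rmult_le_pos; lra|].
  intros h t Hh Ht. destruct (Hw h t Hh Ht) as [G1 G2].
  assert (Hop : forall v, norm (at_op F T h v) <= cnorm F * M * norm v).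
  { intros v. rewrite Rmult_assoc. apply (at_op_bound HT); [lra|exact HF]. }
  split.
  - eapply Rle_trans; [apply Hop|]. apply Rmult_le_compat_l; lra.
  - intros s Hs. rewrite <- (lin_minus _ (at_op_linear HT F h (ltac:(lra)) HF)).
    eapply Rle_trans; [apply Hop|]. rewrite (Rmult_assoc (cnorm F * M)).
    apply Rmult_le_compat_l; [lra|apply G2, Hs].
Qed.

Lemma bl_J w : bounded_lipschitz w -> bounded_lipschitz (fun h t => J t (w h t)).
Proof.
  intros (B & HB & Hw). exists (2 * (K * B)).
  assert (HKB : 0 <= K * B) by (apply Rmult_le_pos; lra).
  split; [lra|]. intros h t Hh Ht. destruct (Hw h t Hh Ht) as [G1 G2].
  assert (HJb := sd_J_bound _ _ _ _ _ _ _ _ HS). split.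
  - eapply Rle_trans; [apply HJb, Ht|].
    assert (K * norm (w h t) <= K * B) by (apply Rmult_le_compat_l; lra). lra.
  - intros s Hs. destruct (Hw h s Hh Hs) as [G3 _]. specialize (G2 s Hs).
    replace (J t (w h t) ⊖ J s (w h s)) with
      (J t (w h t ⊖ w h s) ⊕ (J t (w h s) ⊖ J s (w h s))).
    2: { rewrite (lin_minus _ (sd_J_linear _ _ _ _ _ _ _ _ HS t Ht)). lin_eq. }
    eapply Rle_trans; [apply norm_plus_le|].
    pose proof (HJb t (w h t ⊖ w h s) Ht) as E1.
    pose proof (sd_J_lipschitz _ _ _ _ _ _ _ _ HS s t (w h s) Hs Ht) as E2.
    assert (E3 : K * norm (w h t ⊖ w h s) <= K * (B * Rabs (t - s))) by (apply Rmult_le_compat_l; lra).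
    assert (E4 : K * Rabs (t - s) * norm (w h s) <= K * Rabs (t - s) * B).
    { apply Rmult_le_compat_l; [|exact G3]. apply Rmult_le_pos; [lra|apply Rabs_pos]. }
    lra.
Qed.

(** The leading error of stage i, multiplied by the Jacobian, as a function of h and t alone; on the
    grid it agrees with the expression in the local error. *)
Definition lead_at (i : nat) (h t : R) : X :=
  J t (at_op (psi expRK5s8 4 i) T h (f 3%nat t)
    ⊕ at_op (acoef58 i 4) T h (J t (at_op (psi expRK5s8 3 4) T h (f 2%nat t)))).

Lemma bl_lead_at i : (2 <= i <= 8)%nat -> bounded_lipschitz (lead_at i).
Proof.
  intros Hi. apply bl_J. apply bl_plus.
  - apply (bl_op (psi expRK5s8 4 i) (fun _ t => f 3%nat t)); [apply psi58_nodes, Hi|apply bl_f; lia].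
  - apply bl_op; [apply acoef58_nodes|]. apply bl_J.
    apply (bl_op (psi expRK5s8 3 4) (fun _ t => f 2%nat t)); [apply psi58_nodes; lia|apply bl_f; lia].
Qed.

(** Neighbouring grid values differ by at most B h, so the total variation over n steps is at most B
    H, whatever h is. *)
Lemma bl_conv F w : nodes_1 F -> bounded_lipschitz w -> exists B, 0 <= B /\
  forall h n, 0 < h <= H -> INR n * h <= H ->
  norm (conv (T := T) h n (fun j => at_op F T h (w h (a + INR j * h))
    ⊖ at_zero F ⊙ w h (a + INR j * h))) <= B.
Proof.
  intros HF (B & HB & Hw). pose proof (abel_const_pos HT F) as Hac.
  exists (abel_const (M := M) (C := C) F * (B + B * H)).
  split; [apply Rmult_le_pos; [exact Hac|]; nra|].
  intros h n Hh Hn.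
  eapply Rle_trans.
  - apply (conv_smoothed_bound HT F h (B * h) n HF Hh (ltac:(nra)) Hn (fun j => w h (a + INR j * h))).
    intros j Hj.
    assert (Hjn : INR (S j) * h <= H).
    { eapply Rle_trans; [|exact Hn]. apply Rmult_le_compat_r; [lra|]. apply le_INR. lia. }
    pose proof (pos_INR j). rewrite S_INR in *.
    assert (0 <= INR j * h) by (apply Rmult_le_pos; lra).
    destruct (Hw h (a + (INR j + 1) * h) Hh (ltac:(lra))) as [_ G].
    eapply Rle_trans; [apply (G (a + INR j * h)); lra|].
    replace (a + (INR j + 1) * h - (a + INR j * h)) with h by ring. rewrite Rabs_right; lra.
  - apply Rmult_le_compat_l; [exact Hac|].
    destruct (Hw h (a + INR 0 * h) Hh) as [G _]; [simpl; lra|].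
    replace (INR n * (B * h)) with (B * (INR n * h)) by ring.
    assert (B * (INR n * h) <= B * H) by (apply Rmult_le_compat_l; lra). lra.
Qed.

Section Numerical.

Variables (h : R) (un : nat -> X) (U : nat -> nat -> X).
Hypothesis h_range : 0 < h <= H.
Hypothesis num : numerical_solution expRK5s8 T A g (u a) h un U.

Lemma num_next n : un (S n) = un n
  ⊕ h ⊙ at_op (Phi 1 1) T h (A (un n) ⊕ g (un n))
  ⊕ h ⊙ vsum 7 (fun j => at_op (bcoef58 (2 + j)) T h (g (U n (2 + j)%nat) ⊖ g (un n))).
Proof.
  destruct num as [_ Hn]. destruct (Hn n) as [_ E]. rewrite E.
  rewrite <- (sum_n_m_vsum (fun j => at_op (bcoef58 j) T h (g (U n j) ⊖ g (un n))) 7).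
  reflexivity.
Qed.

Lemma num_stage n i : (2 <= i <= 8)%nat -> U n i = un n
  ⊕ (node58 i * h) ⊙ at_op (Phi 1 (node58 i)) T h (A (un n) ⊕ g (un n))
  ⊕ h ⊙ vsum (i - 2) (fun j => at_op (acoef58 i (2 + j)) T h (g (U n (2 + j)%nat) ⊖ g (un n))).
Proof.
  intros Hi. destruct num as [_ Hn]. destruct (Hn n) as [E _]. rewrite (E i Hi).
  rewrite <- (sum_n_m_vsum (fun j => at_op (acoef58 i j) T h (g (U n j) ⊖ g (un n))) (i - 2)).
  replace (S (i - 2)) with (i - 1)%nat by lia. reflexivity.
Qed.

Lemma in_dom_vsum n (F : nat -> X) : (forall j, (j < n)%nat -> in_dom T (F j)) ->
  in_dom T (vsum n F).
Proof.
  induction n as [|n IH]; intros HF; [apply (in_dom_zero HT)|].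
  cbn [vsum]. apply (in_dom_plus HT); [apply IH; intros; apply HF; lia|apply HF; lia].
Qed.

(** A u_n occurs in the scheme, and it is the value of the generator only on the domain. The domain
    is preserved because the update involves phi_k(hA) with k >= 1 only. *)
Lemma num_in_dom n : in_dom T (un n).
Proof.
  induction n as [|n IH].
  - destruct num as [E _]. rewrite E. exists (A (u a)). apply u_gen. lra.
  - rewrite num_next. apply (in_dom_plus HT); [apply (in_dom_plus HT); [exact IH|]|].
    + apply (in_dom_scal HT), (at_op_in_dom HT); [lra|]. cbn. split; [lia|lra].
    + apply (in_dom_scal HT), in_dom_vsum. intros j _.
      apply (at_op_in_dom HT); [lra|apply bcoef58_smoothing].
Qed.

Definition step_of (n : nat) : step :=
  {| st_h := h; st_t := a + INR n * h; st_x := un n; st_U := U n; st_next := un (S n) |}.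

Lemma step_of_valid n : a + INR (S n) * h <= b ->
  valid (T := T) (a := a) (b := b) (g := g) A (step_of n).
Proof.
  intros Hn. rewrite S_INR in Hn. pose proof (pos_INR n).
  assert (0 <= INR n * h) by (apply Rmult_le_pos; lra).
  split; cbn [step_of st_h st_t st_x st_U st_next]; try lra.
  - apply A_gen, num_in_dom.
  - intros i Hi. apply num_stage, Hi.
  - apply num_next.
Qed.

End Numerical.

Lemma global_error : exists Cst h0, 0 <= Cst /\ 0 < h0 /\ forall h un U, 0 < h <= h0 ->
  numerical_solution expRK5s8 T A g (u a) h un U ->
  forall n, a + INR n * h <= b -> norm (un n ⊖ u (a + INR n * h)) <= Cst * h ^ 5.
Proof.
  destruct (local_error HT HS A u_gen u_sol (Req_le _ _ length_H) rho_pos)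
    as (q & (B0 & eta & HB0 & Heta & Hq) & Eq).
  assert (Hbl : forall i, (6 <= i <= 8)%nat -> exists B, 0 <= B /\ forall h n, 0 < h <= H -> INR n * h <= H ->
    norm (conv (T := T) h n (fun j => at_op (bcoef58 i) T h (lead_at i h (a + INR j * h))
      ⊖ at_zero (bcoef58 i) ⊙ lead_at i h (a + INR j * h))) <= B).
  { intros i Hi. apply bl_conv; [apply bcoef58_nodes|apply bl_lead_at; lia]. }
  destruct (Hbl 6%nat (ltac:(lia))) as (B6 & HB6 & G6).
  destruct (Hbl 7%nat (ltac:(lia))) as (B7 & HB7 & G7).
  destruct (Hbl 8%nat (ltac:(lia))) as (B8 & HB8 & G8). clear Hbl.
  destruct (bl_conv quadrature_defect (fun _ t => f 4%nat t)) as (B5 & HB5 & G5);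
    [cbn; repeat split; lra|apply bl_f; lia|].
  (* The 1 makes L positive, so that the Gronwall estimate may be multiplied by L and divided
     again. *)
  set (B := B0 + 1). set (L := M * B).
  assert (HL : 0 < L) by (unfold L, B; apply Rmult_lt_0_compat; lra).
  (* The first four constants bound the smoothed sums; L H accounts for the parts h^5 of the local
     remainders, added over all steps. *)
  set (D := B5 + B6 + B7 + B8 + L * H).
  assert (HLH : 0 <= L * H) by (apply Rmult_le_pos; lra).
  assert (HD : 0 <= D) by (unfold D; lra).
  set (Cst := D * exp (L * H)).
  assert (Hexp : 0 < exp (L * H)) by apply exp_pos.
  assert (HCst : 0 <= Cst) by (apply Rmult_le_pos; lra).
  assert (Hh0 : 0 < eta / (Cst + 1)) by (apply Rdiv_lt_0_compat; lra).
  (* The last bound gives Cst h^5 <= Cst h <= eta, so the claimed estimate keeps the error below the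
     threshold under which the local expansion is valid. *)
  exists Cst, (Rmin (Rmin eta H) (eta / (Cst + 1))).
  split; [exact HCst|]. split; [repeat apply Rmin_glb_lt; lra|].
  intros h un U Hh num.
  pose proof (Rmin_l (Rmin eta H) (eta / (Cst + 1))) as m1.
  pose proof (Rmin_r (Rmin eta H) (eta / (Cst + 1))) as m2.
  pose proof (Rmin_l eta H) as m3. pose proof (Rmin_r eta H) as m4.
  assert (HhH : 0 < h <= H) by lra. assert (Hhe : h <= eta) by lra.
  assert (Hh5 : 0 <= h ^ 5 <= h).
  { split; [apply pow_le; lra|]. replace (h ^ 5) with (h * h ^ 4) by ring.
    pose proof (pow_incr h 1 4 (ltac:(lra))) as Hp. rewrite pow1 in Hp. nra. }
  assert (HCh : Cst * h ^ 5 <= eta).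
  { apply Rle_trans with ((Cst + 1) * (eta / (Cst + 1))); [|right; field; lra].
    apply Rmult_le_compat; lra. }
  set (e := fun n => un n ⊖ u (a + INR n * h)).
  set (p := step_of h un U).
  set (s5 := fun j => at_op quadrature_defect T h (f 4%nat (a + INR j * h))
    ⊖ at_zero quadrature_defect ⊙ f 4%nat (a + INR j * h)).
  set (s := fun i j => at_op (bcoef58 i) T h (lead_at i h (a + INR j * h))
    ⊖ at_zero (bcoef58 i) ⊙ lead_at i h (a + INR j * h)).
  assert (Hrange : forall n, a + INR n * h <= b -> INR n * h <= H) by (intros; lra).
  assert (Hprev : forall n m, (m <= n)%nat -> a + INR n * h <= b -> a + INR m * h <= b).
  { intros n m Hmn Hn. apply le_INR in Hmn.
    apply (Rmult_le_compat_r h) in Hmn; lra. }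
  assert (Hrec : forall n, a + INR n * h <= b -> e n =
    h ^ 5 ⊙ (conv (T := T) h n s5 ⊕ (conv (T := T) h n (s 6%nat) ⊕ (conv (T := T) h n (s 7%nat)
      ⊕ conv (T := T) h n (s 8%nat)))) ⊕ h ⊙ conv (T := T) h n (fun j => q (p j))).
  { induction n as [|n IH]; intros Hn.
    - unfold conv. cbn [vsum]. unfold e. destruct num as [E0 _]. rewrite E0.
      simpl INR. rewrite Rmult_0_l, Rplus_0_r. lin_eq.
    - assert (Hn' : a + INR n * h <= b) by (apply (Hprev (S n)); [lia|exact Hn]).
      specialize (IH Hn').
      pose proof (step_of_valid h un U HhH num n Hn) as Hv.
      specialize (Eq (p n) Hv). unfold e.
      replace (a + INR (S n) * h) with (st_t (p n) + st_h (p n))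
        by (rewrite S_INR; cbn [p step_of st_t st_h]; ring).
      change (un (S n)) with (st_next (p n)). rewrite Eq.
      change (st_h (p n)) with h. change (err (p n)) with (e n). rewrite IH.
      rewrite !(conv_S HT) by lra.
      pose proof (sg_lin _ _ _ _ HT h (ltac:(lra))) as LT.
      rewrite !(lin_plus _ LT), !(lin_scal _ LT), !(lin_plus _ LT).
      change (smoothed quadrature_defect (p n) (f 4%nat (st_t (p n)))) with (s5 n).
      change (smoothed (bcoef58 6) (p n) (J (st_t (p n)) (lead 6 (p n)))) with (s 6%nat n).
      change (smoothed (bcoef58 7) (p n) (J (st_t (p n)) (lead 7 (p n)))) with (s 7%nat n).
      change (smoothed (bcoef58 8) (p n) (J (st_t (p n)) (lead 8 (p n)))) with (s 8%nat n).
      lin_eq. }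
  assert (Hbound : forall n, a + INR n * h <= b -> norm (e n) <= D * h ^ 5 * (1 + L * h) ^ n).
  (* All earlier bounds are needed: they enter the Gronwall sum, and they show that the local
     expansion applies to each earlier step. *)
  { induction n as [n IH] using lt_wf_ind. intros Hn.
    assert (HnH : INR n * h <= H) by lra.
    rewrite (Hrec n Hn).
    eapply Rle_trans; [apply norm_plus_le|].
    assert (E1 : norm (h ^ 5 ⊙ (conv (T := T) h n s5 ⊕ (conv (T := T) h n (s 6%nat)
      ⊕ (conv (T := T) h n (s 7%nat) ⊕ conv (T := T) h n (s 8%nat))))) <= h ^ 5 * (B5 + B6 + B7 + B8)).
    { eapply Rle_trans; [apply norm_scal_le|]. rewrite Rabs_right by lra.
      apply Rmult_le_compat_l; [lra|].
      specialize (G5 h n HhH HnH). specialize (G6 h n HhH HnH).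
      specialize (G7 h n HhH HnH). specialize (G8 h n HhH HnH).
      eapply Rle_trans; [apply norm_plus_le|].
      eapply Rle_trans; [apply Rplus_le_compat_l, norm_plus_le|].
      eapply Rle_trans; [apply Rplus_le_compat_l, Rplus_le_compat_l, norm_plus_le|].
      unfold s5, s. lra. }
    assert (E2 : norm (h ⊙ conv (T := T) h n (fun j => q (p j))) <=
      L * H * h ^ 5 + D * h ^ 5 * ((1 + L * h) ^ n - 1)).
    { eapply Rle_trans; [apply norm_scal_le|]. rewrite Rabs_right by lra.
      pose proof (norm_vsum_geometric n (fun j => T (INR (n - 1 - j) * h) (q (p j)))
        (L * h ^ 5) (L * (D * h ^ 5)) (L * h) (ltac:(nra))) as G.
      fold (conv (T := T) h n (fun j => q (p j))) in G.
      apply (Rmult_le_reg_l L); [exact HL|].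
      rewrite <- Rmult_assoc. eapply Rle_trans; [apply G|].
      - intros j Hj.
        assert (Hj1 : a + INR (S j) * h <= b) by (apply (Hprev n); [lia|exact Hn]).
        assert (Hj0 : a + INR j * h <= b) by (apply (Hprev (S j)); [lia|exact Hj1]).
        pose proof (IH j Hj Hj0) as Ej.
        assert (Hjeta : norm (e j) <= eta).
        { eapply Rle_trans; [exact Ej|]. eapply Rle_trans; [|exact HCh]. unfold Cst.
          replace (D * exp (L * H) * h ^ 5) with (D * h ^ 5 * exp (L * H)) by ring.
          apply Rmult_le_compat_l; [apply Rmult_le_pos; lra|].
          eapply Rle_trans; [apply pow_le_exp; nra|].
          replace (INR j * (L * h)) with (L * (INR j * h)) by ring.
          assert (HjL : L * (INR j * h) <= L * H) by (apply Rmult_le_compat_l; lra).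
          destruct HjL as [HjL|HjL]; [left; apply exp_increasing, HjL|rewrite HjL; lra]. }
        pose proof (step_of_valid h un U HhH num j Hj1) as Hv.
        specialize (Hq (p j) Hv Hhe Hjeta).
        change (st_h (p j)) with h in Hq. change (err (p j)) with (e j) in Hq.
        eapply Rle_trans; [apply (sg_bound _ _ _ _ HT)|].
        + split; [apply Rmult_le_pos; [apply pos_INR|lra]|].
          eapply Rle_trans; [|exact HnH]. apply Rmult_le_compat_r; [lra|]. apply le_INR. lia.
        + replace (L * h ^ 5 + L * (D * h ^ 5) * (1 + L * h) ^ j) with
            (M * (B * (h ^ 5 + D * h ^ 5 * (1 + L * h) ^ j))) by (unfold L; ring).
          apply Rmult_le_compat_l; [lra|]. eapply Rle_trans; [exact Hq|].
          pose proof (norm_ge_0 (e j)).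
          apply Rmult_le_compat; [exact HB0|lra|unfold B; lra|lra].
      - assert (Hx : L * h * INR n * (L * h ^ 5) <= L * (L * H * h ^ 5)).
        { replace (L * h * INR n * (L * h ^ 5)) with (L * L * h ^ 5 * (INR n * h)) by ring.
          replace (L * (L * H * h ^ 5)) with (L * L * h ^ 5 * H) by ring.
          apply Rmult_le_compat_l; [|exact HnH]. apply Rmult_le_pos; [|lra]. nra. }
        lra. }
    unfold D in *. lra. }
  intros n Hn. eapply Rle_trans; [apply (Hbound n Hn)|]. unfold Cst.
  replace (D * exp (L * H) * h ^ 5) with (D * h ^ 5 * exp (L * H)) by ring.
  apply Rmult_le_compat_l; [apply Rmult_le_pos; lra|].
  eapply Rle_trans; [apply pow_le_exp; nra|].
  replace (INR n * (L * h)) with (L * (INR n * h)) by ring.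
  assert (HnL : L * (INR n * h) <= L * H) by (apply Rmult_le_compat_l; [lra|apply Hrange, Hn]).
  destruct HnL as [HnL|HnL]; [left; apply exp_increasing, HnL|rewrite HnL; lra].
Qed.

End Global.

Theorem mainTheorem3 :
  (forall (n : nat) (Z J K L : sqmx n) (B : cvec n -> cvec n -> cvec n),
     bilinear_map B ->
     quadrature_cond expRK5s8 2 Z /\
     quadrature_cond expRK5s8 3 Z /\
     cond3 expRK5s8 Z Z J /\
     quadrature_cond expRK5s8 4 Z /\
     cond5 expRK5s8 Z Z J /\
     cond6 expRK5s8 Z Z J /\
     cond7 expRK5s8 Z Z K /\
     quadrature_cond expRK5s8 5 (zero : sqmx n) /\
     cond9 expRK5s8 zero Z J /\
     cond10 expRK5s8 zero Z J /\
     cond11 expRK5s8 zero Z J /\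
     cond12 expRK5s8 zero Z J K /\
     cond13 expRK5s8 zero Z K /\
     cond14 expRK5s8 zero Z J K /\
     cond15 expRK5s8 zero Z B /\
     cond16 expRK5s8 zero Z L) /\
  exists N : nat,
    forall (X : CompleteNormedModule R_AbsRing)
      (dom : X -> Prop) (A : X -> X) (expA : R -> X -> X)
      (g : X -> X) (t0 T : R) (u0 : X) (u : R -> X) (rho : R),
    generates_analytic_semigroup dom A expA ->
    t0 < T ->
    is_solution dom A g t0 T u0 u ->
    smooth_on N t0 T u ->
    0 < rho ->
    frechet_smooth_bounded N (strip t0 T u rho) g ->
    exists Cst h0 : R, 0 < h0 /\
    forall (h : R) (un : nat -> X) (U : nat -> nat -> X),
      0 < h ->
      numerical_solution expRK5s8 expA A g u0 h un U ->
      forall n : nat, t0 + INR n * h <= T ->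
        h <= h0 \/ strip t0 T u rho (un n) ->
        norm (minus (un n) (u (t0 + INR n * h))) <= Cst * h ^ 5.
Proof.
  split; [intros n Z J K L B; apply order_conditions58|].
  (* In the local error g(u(t)) is expanded up to its fourth derivative, with a remainder bounded by
     the fifth. *)
  exists 5%nat. intros X dom A expA g t0 T u0 u rho [Hsg [Hdom HA]] Ht0T [Hu0 Hu] Hsm Hrho Hg.
  destruct (smooth_data_exists t0 T rho u g Ht0T Hrho Hsm Hg) as (f & J & K & HS).
  destruct (analytic_semigroup_bounds expA (T - t0) Hsg) as (M & C & HT); [lra|].
  assert (HAgen : forall x, dom x -> is_gen expA x (A x)).
  { intros x Hx. apply quotient_is_gen. exact (HA x Hx). }
  assert (Hgen : forall x, in_dom expA x -> is_gen expA x (A x)).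
  { intros x [y Hy]. apply HAgen, Hdom. exists y. exact (proj2 (quotient_is_gen x y) Hy). }
  destruct (global_error HT HS A) as (Cst & h0 & HCst & Hh0 & Hglob).
  - intros t Ht. apply HAgen, (Hu t Ht).
  - intros t Ht. apply deriv_on_diff_in; [exact Ht|apply (Hu t Ht)].
  - exact Hgen.
  - reflexivity.
  - exact Hrho.
  (* For h > h0 the numerical value lies in the strip, so its error is at most rho + 2 K, and h^5 >
     h0^5 turns this bound into K' h^5. *)
  - set (K' := (rho + 2 * K) / h0 ^ 5).
    pose proof (sd_K _ _ _ _ _ _ _ _ HS) as HK.
    assert (Hh05 : 0 < h0 ^ 5) by (apply pow_lt; exact Hh0).
    assert (HK' : 0 <= K') by (apply Rlt_le, Rdiv_lt_0_compat; lra).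
    exists (Cst + K'), h0. split; [exact Hh0|]. intros h un U Hh Hnum n Hn Hcase.
    assert (Hh5 : 0 <= h ^ 5) by (apply pow_le; lra).
    change (norm (un n ⊖ u (t0 + INR n * h)) <= (Cst + K') * h ^ 5).
    destruct (Rle_dec h h0) as [Hle|Hgt].
    + rewrite <- Hu0 in Hnum.
      pose proof (Hglob h un U (conj Hh Hle) Hnum n Hn).
      assert (0 <= K' * h ^ 5) by (apply Rmult_le_pos; lra). lra.
    + destruct Hcase as [Hle|(t & Ht & Hstrip)]; [contradiction|].
      apply Rnot_le_lt in Hgt.
      change (norm (un n ⊖ u t) < rho) in Hstrip.
      assert (Htn : t0 <= t0 + INR n * h <= T).
      { split; [|exact Hn]. assert (0 <= INR n * h) by (apply Rmult_le_pos; [apply pos_INR|lra]). lra. }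
      pose proof (norm_minus_triangle (un n) (u t) (u (t0 + INR n * h))) as N1.
      pose proof (norm_minus_le (u t) (u (t0 + INR n * h))) as N2.
      pose proof (sd_u _ _ _ _ _ _ _ _ HS t Ht). pose proof (sd_u _ _ _ _ _ _ _ _ HS _ Htn).
      assert (N3 : rho + 2 * K <= K' * h ^ 5).
      { apply Rle_trans with (K' * h0 ^ 5); [right; unfold K'; field; lra|].
        apply Rmult_le_compat_l; [exact HK'|]. apply pow_incr. lra. }
      assert (0 <= Cst * h ^ 5) by (apply Rmult_le_pos; lra). lra.
Qed.
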